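(* (1) The augmentation ideals $\mathcal{H}_{\mathcal{SP}}^+$, $\mathcal{H}_{\mathcal{HOP}}^+$, $\mathcal{H}_{\mathcal{SPP}}^+$, $\mathcal{H}_{\mathcal{OF}}^+$, $\mathcal{H}_{\mathcal{HOF}}^+$, $\mathcal{H}_{\mathcal{SWNP}}^+$ and $\mathcal{H}_{\mathcal{SPF}}^+$ are $Dup$-$Dend$ bialgebras (for the products $\cdot,\nwarrow$ and coproducts $\Delta_\prec,\Delta_\succ$ of $\mathcal{H}_{\mathcal{SP}}^+$). (2) Each of the graded Hopf algebras $\mathcal{H}_{\mathcal{SP}}$, $\mathcal{H}_{\mathcal{HOP}}$, $\mathcal{H}_{\mathcal{SPP}}$, $\mathcal{H}_{\mathcal{OF}}$, $\mathcal{H}_{\mathcal{HOF}}$, $\mathcal{H}_{\mathcal{SWNP}}$ and $\mathcal{H}_{\mathcal{SPF}}$ is isomorphic to a non commutative Connes-Kreimer Hopf algebra of decorated plane trees, for a particular graded set of decorations.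
   Context: $\mathbb{K}$ is a commutative field. A double poset is a finite set with two partial orders $(P,\leq_1,\leq_2)$, up to isomorphism; subsets are double posets by restriction (double subposets). It is special if $\leq_2$ is total. Families. $\mathcal{SP}$: special posets. $\mathcal{HOP}$: heap-ordered posets, i.e. special posets in which $x\leq_1 y$ implies $x\leq_2 y$. $\mathcal{OF}$: ordered forests, i.e. special posets such that $(P,\leq_1)$ is a rooted forest with minimal elements as roots. $\mathcal{HOF}=\mathcal{HOP}\cap\mathcal{OF}$. A plane poset is a double poset $(P,\leq_h,\leq_r)$ such that two distinct elements are comparable for $\leq_h$ iff they are not comparable for $\leq_r$; then $x\leq y$ iff ($x\leq_h y$ or $x\leq_r y$) is a total order, and $(P,\leq_h,\leq)$ is a special poset. $\mathcal{SPP}$: special posets $(P,\leq_h,\leq)$ arising from plane posets. $\mathcal{SPF}=\mathcal{OF}\cap\mathcal{SPP}$. $\mathcal{SWNP}$: elements of $\mathcal{SPP}$ arising from plane posets which are WN, i.e. contain no double subposet isomorphic to one of the two plane posets on $\{1,2,3,4\}$ whose strict relations are, respectively, ($1<_h2$, $1<_h4$, $3<_h4$; $1<_r3$, $2<_r3$, $2<_r4$) and ($1<_h3$, $2<_h3$, $2<_h4$; $1<_r2$, $1<_r4$, $3<_r4$). Hopf algebras. $\mathcal{H}_{\mathcal{SP}}$ has basis $\mathcal{SP}$, graded by cardinality. $PQ$ is the disjoint union with $P,Q$ as subposets, $x\leq_2 y$ for $x\in P,y\in Q$, and no $\leq_1$-comparabilities between $P$ and $Q$. $\Delta(P)=\sum_I(P\setminus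 I)\otimes I$ over ideals $I$ (subsets with: $x\in I$, $x\leq_1 y$ imply $y\in I$). The spans $\mathcal{H}_{\mathcal{X}}$ of the other families $\mathcal{X}$ are Hopf subalgebras. $\mathcal{H}_{\mathcal{X}}^+$ is the span of the nonempty elements of $\mathcal{X}$. Further structure. For nonempty $P$, $g_P$ is the maximum of $(P,\leq_2)$. $P\nwarrow Q$ is the disjoint union with $P,Q$ as subposets and for $x\in P,y\in Q$: $x\leq_2 y$; $x\leq_1 y$ iff $x\leq_1 g_P$ (never $y\leq_1 x$). $\Delta_\prec(P)$ (resp. $\Delta_\succ(P)$) is $\sum_I(P\setminus I)\otimes I$ over ideals $I\neq\emptyset,P$ with $g_P\notin I$ (resp. $g_P\in I$). A $Dup$-$Dend$ bialgebra is a vector space $A$ with two products $\cdot$ (juxtaposition), $\nwarrow$ and two coproducts $\Delta_\prec,\Delta_\succ$ such that, with $\tilde\Delta=\Delta_\prec+\Delta_\succ$: (i) $(xy)z=x(yz)$, $(x\nwarrow y)\nwarrow z=x\nwarrow(y\nwarrow z)$, $(xy)\nwarrow z=x(y\nwarrow z)$; (ii) $(\Delta_\prec\otimes Id)\Delta_\prec=(Id\otimes\tilde\Delta)\Delta_\prec$, $(\Delta_\succ\otimes Id)\Delta_\prec=(Id\otimes\Delta_\prec)\Delta_\succ$, $(\tilde\Delta\otimes Id)\Delta_\succ=(Id\otimes\Delta_\succ)\Delta_\succ$; (iii) with $\tilde\Delta(a)=a'\otimes a''$, $\Delta_\prec(a)=a'_\prec\otimes a''_\prec$, $\Delta_\succ(a)=a'_\succ\otimes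 a''_\succ$: $\Delta_\prec(xy)=y\otimes x+y'_\prec\otimes xy''_\prec+xy'_\prec\otimes y''_\prec+x'y\otimes x''+x'y'_\prec\otimes x''y''_\prec$, $\Delta_\succ(xy)=x\otimes y+xy'_\succ\otimes y''_\succ+y'_\succ\otimes xy''_\succ+x'\otimes x''y+x'y'_\succ\otimes x''y''_\succ$, $\Delta_\prec(x\nwarrow y)=x\nwarrow y'_\prec\otimes y''_\prec+x'_\prec\nwarrow y\otimes x''_\prec+x'_\prec\nwarrow y'_\prec\otimes x''_\prec y''_\prec$, $\Delta_\succ(x\nwarrow y)=x\otimes y+x\nwarrow y'_\succ\otimes y''_\succ+x'_\succ\otimes x''_\succ\nwarrow y+x'_\prec\otimes x''_\prec y+x'_\prec\nwarrow y'_\succ\otimes x''_\prec y''_\succ$. Non commutative Connes-Kreimer Hopf algebra: for a graded set $\mathcal{D}=\bigsqcup_{n\geq1}\mathcal{D}(n)$, it has as basis the plane (rooted) forests with vertices decorated by elements of $\mathcal{D}$, the degree of a forest being the sum of the degrees of its decorations. Its product is concatenation of forests, and its coproduct is $\Delta(F)=\sum_I (F\setminus I)\otimes I$ over the sets $I$ of vertices of $F$ which contain all descendants of their elements ($I$ and $F\setminus I$ being the induced decorated plane forests). *)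

(* Defs.v *)
From HB Require Import structures.
From mathcomp Require Import all_boot all_algebra.
From mathcomp Require Import finmap.
From mathcomp.multinomials Require Import monalg.

Set Implicit Arguments.
Unset Strict Implicit.
Unset Printing Implicit Defensive.

Import GRing.Theory.
Local Open Scope ring_scope.

(** * Double posets *)

Definition porder (T : finType) (r : rel T) : bool :=
  [&& [forall x, r x x],
      [forall x, forall y, r x y && r y x ==> (x == y)] &
      [forall x, forall y, forall z, r x y && r y z ==> r x z]].

Lemma porderP (T : finType) (r : rel T) :
  reflect [/\ reflexive r, antisymmetric r & transitive r] (porder r).
Proof.
apply: (iffP and3P) => [[/forallP h1 /forallP h2 /forallP h3]|[h1 h2 h3]].
  split=> // [x y rxy|y x z rxy ryz].
    by have /forallP/(_ y)/implyP/(_ rxy)/eqP := h2 x.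
  have /forallP/(_ y)/forallP/(_ z)/implyP := h3 x.
  by apply; rewrite rxy.
split; first exact/forallP.
  apply/forallP=> x; apply/forallP=> y; apply/implyP=> rxy.
  by apply/eqP/h2.
apply/forallP=> x; apply/forallP=> y; apply/forallP=> z.
by apply/implyP=> /andP[rxy]; apply: h3.
Qed.

(* Relations are stored as sets of pairs, so that the double posets on a given
   finite type form a finite type. *)
Definition dposet (T : finType) : Type :=
  {Q : {set T * T} * {set T * T} |
    porder (fun x y => (x, y) \in Q.1) && porder (fun x y => (x, y) \in Q.2)}.

Definition le1 (T : finType) (Q : dposet T) : rel T :=
  fun x y => (x, y) \in (val Q).1.
Definition le2 (T : finType) (Q : dposet T) : rel T :=
  fun x y => (x, y) \in (val Q).2.

Lemma porder_set (T : finType) (r : rel T) :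
  porder r -> porder (fun x y => (x, y) \in [set p : T * T | r p.1 p.2]).
Proof.
move=> /porderP[h1 h2 h3]; apply/porderP; split=> [x|x y|y x z].
- by rewrite inE h1.
- by rewrite !inE; apply: h2.
- by rewrite !inE; apply: h3.
Qed.

Definition mk_dposet (T : finType) (r1 r2 : rel T)
    (h1 : porder r1) (h2 : porder r2) : dposet T :=
  exist _ ([set p | r1 p.1 p.2], [set p | r2 p.1 p.2])
    (introT andP (conj (porder_set h1) (porder_set h2))).

Lemma le1_mk (T : finType) (r1 r2 : rel T) (h1 : porder r1) (h2 : porder r2) :
  le1 (mk_dposet h1 h2) =2 r1.
Proof. by move=> x y; rewrite /le1 inE. Qed.

Lemma le2_mk (T : finType) (r1 r2 : rel T) (h1 : porder r1) (h2 : porder r2) :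
  le2 (mk_dposet h1 h2) =2 r2.
Proof. by move=> x y; rewrite /le2 inE. Qed.

Lemma dposetP (T : finType) (Q : dposet T) : porder (le1 Q) /\ porder (le2 Q).
Proof. exact/andP/(valP Q). Qed.

Lemma dposet_eq (T : finType) (P Q : dposet T) :
  le1 P =2 le1 Q -> le2 P =2 le2 Q -> P = Q.
Proof.
move=> h1 h2; apply: val_inj; apply: injective_projections.
  by apply/setP=> -[x y]; apply: h1.
by apply/setP=> -[x y]; apply: h2.
Qed.

Definition diso (T U : finType) (P : dposet T) (Q : dposet U) : bool :=
  [exists f : {ffun T -> U},
    [&& injectiveb f, [forall u, exists x, f x == u] &
        [forall x, forall y, (le1 Q (f x) (f y) == le1 P x y) &&
                             (le2 Q (f x) (f y) == le2 P x y)]]].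

Lemma disoP (T U : finType) (P : dposet T) (Q : dposet U) :
  reflect (exists f : T -> U, [/\ bijective f,
             {mono f : x y / le1 P x y >-> le1 Q x y} &
             {mono f : x y / le2 P x y >-> le2 Q x y}])
          (diso P Q).
Proof.
apply: (iffP existsP) => [[f /and3P[/injectiveP fi /forallP fs /forallP fm]]|].
  exists f; split.
  - have fx u := xchooseP (existsP (fs u)).
    exists (fun u => xchoose (existsP (fs u))) => [x|u].
      by apply: fi; apply/eqP/fx.
    exact/eqP/fx.
  - by move=> x y; have /forallP/(_ y)/andP[/eqP] := fm x.
  - by move=> x y; have /forallP/(_ y)/andP[_ /eqP] := fm x.
move=> [f [fb f1 f2]]; exists [ffun x => f x]; apply/and3P; split.
- by apply/injectiveP=> x y; rewrite !ffunE; apply: bij_inj.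
- case: fb => g _ gK; apply/forallP=> u; apply/existsP; exists (g u).
  by rewrite ffunE gK.
- apply/forallP=> x; apply/forallP=> y.
  by rewrite !ffunE f1 f2 !eqxx.
Qed.

Lemma porder_pre (T U : finType) (f : U -> T) (r : rel T) :
  injective f -> porder r -> porder (relpre f r).
Proof.
move=> fi /porderP[h1 h2 h3]; apply/porderP; split=> [x|x y|y x z] /=.
- exact: h1.
- by move=> /h2/fi.
- exact: h3.
Qed.

Definition dsub (T : finType) (Q : dposet T) (A : {set T}) :
    dposet {x : T | x \in A} :=
  mk_dposet (porder_pre (f := val) val_inj (proj1 (dposetP Q)))
            (porder_pre (f := val) val_inj (proj2 (dposetP Q))).

Definition ideal (T : finType) (Q : dposet T) (I : {set T}) : bool :=
  [forall x in I, forall y, le1 Q x y ==> (y \in I)].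

(** * Special posets *)

Definition special (T : finType) (Q : dposet T) : bool :=
  [forall x, forall y, le2 Q x y || le2 Q y x].

Definition sposet (T : finType) : Type := {Q : dposet T | special Q}.

Coercion dposet_of (T : finType) (P : sposet T) : dposet T := val P.

Lemma sposet_total (T : finType) (P : sposet T) x y : le2 P x y || le2 P y x.
Proof. by have /forallP/(_ x)/forallP/(_ y) := valP P. Qed.

Lemma special_sub (T : finType) (P : sposet T) (A : {set T}) :
  special (dsub P A).
Proof.
by apply/forallP=> x; apply/forallP=> y; rewrite !le2_mk /= sposet_total.
Qed.

Definition ssub (T : finType) (P : sposet T) (A : {set T}) :
    sposet {x : T | x \in A} :=
  exist _ (dsub P A) (special_sub P A).

(* [c x y] tells whether [x] is below [y], for [x] in the first summand and
   [y] in the second one. *)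
Definition sum_rel (T U : finType) (r : rel T) (s : rel U) (c : T -> U -> bool) :
    rel (T + U)%type :=
  fun a b => match a, b with
             | inl x, inl y => r x y
             | inr x, inr y => s x y
             | inl x, inr y => c x y
             | inr _, inl _ => false
             end.

Lemma porder_sum (T U : finType) (r : rel T) (s : rel U) (c : T -> U -> bool) :
    porder r -> porder s ->
    (forall x x' y, r x x' -> c x' y -> c x y) ->
    (forall x y y', c x y -> s y y' -> c x y') ->
  porder (sum_rel r s c).
Proof.
move=> /porderP[r1 r2 r3] /porderP[s1 s2 s3] cl cr; apply/porderP; split.
- by case=> x /=.
- by case=> x [] y //=; [move=> /r2-> | rewrite andbF | move=> /s2->].
- case=> y [] x [] z //=; [exact: r3|exact: cl|exact: cr|].
  exact: s3.
Qed.

Lemma special_sum (T U : finType) (P : sposet T) (Q : sposet U) r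
    (h : porder r) (h' : porder (sum_rel (le2 P) (le2 Q) (fun _ _ => true))) :
  special (mk_dposet h h').
Proof.
apply/forallP=> a; apply/forallP=> b; rewrite !le2_mk.
by case: a b => x [] y //=; rewrite ?sposet_total ?orbT.
Qed.

Lemma scat_proof1 (T U : finType) (P : sposet T) (Q : sposet U) :
  porder (sum_rel (le1 P) (le1 Q) (fun _ _ => false)).
Proof. by apply: porder_sum => //; apply: (dposetP _).1. Qed.

Lemma scat_proof2 (T U : finType) (P : sposet T) (Q : sposet U) :
  porder (sum_rel (le2 P) (le2 Q) (fun _ _ => true)).
Proof. by apply: porder_sum => //; apply: (dposetP _).2. Qed.

Definition scat (T U : finType) (P : sposet T) (Q : sposet U) :
    sposet (T + U)%type :=
  exist _ (mk_dposet (scat_proof1 P Q) (scat_proof2 P Q))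
    (special_sum _ _).

Definition is_max (T : finType) (P : dposet T) (g : T) : bool :=
  [forall z, le2 P z g].

(* "x <=_1 g_P", where g_P is the maximum of (P, <=_2) *)
Definition below_max (T : finType) (P : dposet T) (x : T) : bool :=
  [exists g, is_max P g && le1 P x g].

Lemma snw_proof (T U : finType) (P : sposet T) (Q : sposet U) :
  porder (sum_rel (le1 P) (le1 Q) (fun x _ => below_max P x)).
Proof.
have hP := (dposetP P).1; have hQ := (dposetP Q).1.
apply: porder_sum => // x x' _ xx' /existsP[g /andP[gm x'g]].
apply/existsP; exists g; rewrite gm /=.
by case/porderP: hP => _ _ tr; apply: tr x'g.
Qed.

Definition snw (T U : finType) (P : sposet T) (Q : sposet U) :
    sposet (T + U)%type :=
  exist _ (mk_dposet (snw_proof P Q) (scat_proof2 P Q)) (special_sum _ _).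

(* Isomorphism classes of special posets.  A special poset with n elements is
   isomorphic, by a unique isomorphism, to a special poset on 'I_n whose second
   order is the usual order of 'I_n; the latter is used as the canonical
   representative of its class.  See [sclass_eq] and [sclass_srep]. *)
Definition std_sposet (n : nat) : Type :=
  {P : sposet 'I_n | [forall x, forall y, le2 P x y == (x <= y)%N]}.

Definition spclass : Type := {n : nat & std_sposet n}.

Definition scard (P : spclass) : nat := tag P.
Definition srep (P : spclass) : sposet 'I_(scard P) := val (tagged P).

Section Class.
Variables (T : finType) (P : sposet T).

Lemma rank_proof (x : T) :
  (#|[set y | le2 P y x && (y != x)]| < #|T|)%N.
Proof.
rewrite -cardsT; apply: proper_card; apply/properP; split=> //.
by exists x; rewrite ?inE ?eqxx ?andbF.
Qed.

Definition rank (x : T) : 'I_#|T| := Ordinal (rank_proof x).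

Lemma rank_le x y : (rank x <= rank y)%N = le2 P x y.
Proof.
have [_ /porderP[r as_ tr]] := dposetP P.
have lt_rank u v : le2 P u v -> u != v -> (rank u < rank v)%N.
  move=> uv nuv; apply: proper_card; apply/properP; split.
    apply/subsetP=> z; rewrite !inE => /andP[zu nzu].
    rewrite (tr _ _ _ zu uv); apply: contra_neq nzu => zv.
    by rewrite zv in zu *; apply: as_; rewrite zu uv.
  by exists u; rewrite !inE ?uv ?nuv ?eqxx ?andbF.
have [->|nxy] := eqVneq x y; first by rewrite leqnn r.
case xy: (le2 P x y); first by rewrite ltnW // lt_rank.
apply/negbTE; rewrite -ltnNge lt_rank // 1?eq_sym //.
by have := sposet_total P x y; rewrite xy.
Qed.

Lemma rank_inj : injective rank.
Proof.
have [_ /porderP[r as_ tr]] := dposetP P.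
move=> x y exy; apply: as_; by rewrite -!rank_le exy leqnn.
Qed.

Lemma rank_bij : bijective rank.
Proof. by apply: inj_card_bij rank_inj _; rewrite card_ord. Qed.

Definition rank_le1 : rel 'I_#|T| :=
  fun i j => [exists x, exists y, [&& rank x == i, rank y == j & le1 P x y]].

Lemma rank_le1E x y : rank_le1 (rank x) (rank y) = le1 P x y.
Proof.
apply/existsP/idP => [[x' /existsP[y' /and3P[/eqP/rank_inj-> /eqP/rank_inj->]]]|].
  by [].
by move=> xy; exists x; apply/existsP; exists y; rewrite !eqxx.
Qed.

Lemma rank_le1_porder : porder rank_le1.
Proof.
have [/porderP[r as_ tr] _] := dposetP P; have [inv _ rK] := rank_bij.
apply/porderP; split=> [i|i j|j i k].
- by rewrite -[i]rK rank_le1E r.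
- by rewrite -[i]rK -[j]rK !rank_le1E => /as_->.
- by rewrite -[i]rK -[j]rK -[k]rK !rank_le1E; apply: tr.
Qed.

Lemma ord_le_porder n : porder (fun i j : 'I_n => (i <= j)%N).
Proof.
apply/porderP; split=> [i|i j|j i k]; first exact: leqnn.
  by move=> /anti_leq/val_inj.
exact: leq_trans.
Qed.

Lemma rank_special : special (mk_dposet rank_le1_porder (ord_le_porder _)).
Proof. by apply/forallP=> i; apply/forallP=> j; rewrite !le2_mk leq_total. Qed.

Definition rank_sposet : sposet 'I_#|T| :=
  exist _ (mk_dposet rank_le1_porder (ord_le_porder _)) rank_special.

Lemma rank_std : [forall x, forall y, le2 rank_sposet x y == (x <= y)%N].
Proof. by apply/forallP=> i; apply/forallP=> j; rewrite le2_mk. Qed.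

Definition sclass : spclass := Tagged std_sposet (exist _ rank_sposet rank_std).

Lemma diso_sclass : diso P (srep sclass).
Proof.
apply/disoP; exists rank; split=> [|x y|x y]; first exact: rank_bij.
  by rewrite le1_mk rank_le1E.
by rewrite le2_mk rank_le.
Qed.

End Class.

Lemma diso_sym (T U : finType) (P : dposet T) (Q : dposet U) :
  diso P Q -> diso Q P.
Proof.
move=> /disoP[f [[g fK gK] f1 f2]]; apply/disoP; exists g.
split=> [|x y|x y]; first by exists f.
  by rewrite -{2}[x]gK -{2}[y]gK f1.
by rewrite -{2}[x]gK -{2}[y]gK f2.
Qed.

Lemma diso_trans (T U V : finType) (P : dposet T) (Q : dposet U)
    (R : dposet V) :
  diso P Q -> diso Q R -> diso P R.
Proof.
move=> /disoP[f [fb f1 f2]] /disoP[g [gb g1 g2]]; apply/disoP.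
exists (g \o f); split=> [|x y|x y] /=; first exact: bij_comp.
  by rewrite g1 f1.
by rewrite g2 f2.
Qed.

Lemma srep_le2 (P : spclass) x y : le2 (srep P) x y = (x <= y)%N.
Proof.
by have /forallP/(_ x)/forallP/(_ y)/eqP := valP (tagged P).
Qed.

Lemma ord_mono_id n (f : 'I_n -> 'I_n) :
  {mono f : i j / (i <= j)%N} -> f =1 id.
Proof.
move=> fm i; apply: val_inj => /=.
have fi : injective f.
  move=> a b eab; apply/val_inj/eqP.
  by rewrite eqn_leq -(fm a b) -(fm b a) eab leqnn.
have fb : bijective f by apply: injF_bij.
have card_lt (k : 'I_n) : #|[set j : 'I_n | (j < k)%N]| = k.
  rewrite cardsE -sum1_card (eq_bigl (fun j : 'I_n => (j < k)%N)) //.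
  rewrite -(big_ord_widen n (fun=> 1%N)) ?sum1_card ?card_ord //.
  exact: ltnW.
rewrite -[LHS]card_lt -[RHS]card_lt -[RHS](card_imset _ fi); apply: eq_card => j.
case: fb => g fK gK; rewrite inE -[j]gK (mem_imset _ _ fi) inE.
by rewrite !ltnNge fm.
Qed.

Lemma srep_inj (P Q : spclass) : diso (srep P) (srep Q) -> P = Q.
Proof.
move=> /disoP[f [fb f1 f2]].
have epq : scard P = scard Q.
  by rewrite -[LHS]card_ord -[RHS]card_ord; apply: bij_eq_card fb.
case: P Q epq f fb f1 f2 => [n P] [m Q]; rewrite /scard /= => enm.
rewrite -{}enm {m} in Q * => f fb f1 f2.
have fid : f =1 id.
  apply: ord_mono_id => i j; rewrite -(@srep_le2 (existT _ n Q)).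
  by rewrite -(@srep_le2 (existT _ n P)); apply: f2.
congr Tagged; do 2!apply: val_inj; apply: dposet_eq => x y.
  by have := f1 x y; rewrite /srep /= !fid.
by have := f2 x y; rewrite /srep /= !fid.
Qed.

Lemma sclass_srep (P : spclass) : sclass (srep P) = P.
Proof. exact/srep_inj/diso_sym/diso_sclass. Qed.

Lemma sclass_eq (T U : finType) (P : sposet T) (Q : sposet U) :
  diso P Q <-> sclass P = sclass Q.
Proof.
split=> [PQ|ePQ].
  apply/srep_inj/(diso_trans _ (diso_sclass Q)).
  exact/(diso_trans _ PQ)/diso_sym/diso_sclass.
by apply: diso_trans (diso_sclass P) _; rewrite ePQ; apply/diso_sym/diso_sclass.
Qed.

(** * The families *)

(* The Hasse graph of (P, <=_1) is a rooted forest, with minimal elements as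
   roots, iff the elements below any given element form a chain. *)
Definition rooted_forest (T : finType) (P : dposet T) : bool :=
  [forall x, forall y, forall z,
    le1 P x z && le1 P y z ==> le1 P x y || le1 P y x].

Definition heap_ordered (T : finType) (P : dposet T) : bool :=
  [forall x, forall y, le1 P x y ==> le2 P x y].

(* A plane poset (P, <=_h, <=_r) is seen as a double poset with
   <=_h = <=_1 and <=_r = <=_2. *)
Definition plane (T : finType) (P : dposet T) : bool :=
  [forall x, forall y, (x != y) ==>
    ((le1 P x y || le1 P y x) == ~~ (le2 P x y || le2 P y x))].

(* [P = (Q, <=_h, <=)], for [Q = (Q, <=_h, <=_r)] *)
Definition arises_from (T : finType) (P : sposet T) (Q : dposet T) : bool :=
  [forall x, forall y, (le1 P x y == le1 Q x y) &&
                       (le2 P x y == le1 Q x y || le2 Q x y)].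

(* The elements 1, 2, 3, 4 are encoded as 0, 1, 2, 3 : 'I_4. *)
Definition rel4 (s : seq (nat * nat)) : rel 'I_4 :=
  fun i j => (i == j) || ((nat_of_ord i, nat_of_ord j) \in s).


Lemma rel4A_porder : porder (rel4 [:: (0, 1); (0, 3); (2, 3)]%N).
Proof.
apply/porderP; split.
- by move=> i; rewrite /rel4 eqxx.
- by case=> [[|[|[|[|?]]]] ?] [[|[|[|[|?]]]] ?] //= _; apply: val_inj.
- by case=> [[|[|[|[|?]]]] ?] [[|[|[|[|?]]]] ?] [[|[|[|[|?]]]] ?].
Qed.

Lemma rel4B_porder : porder (rel4 [:: (0, 2); (1, 2); (1, 3)]%N).
Proof.
apply/porderP; split.
- by move=> i; rewrite /rel4 eqxx.
- by case=> [[|[|[|[|?]]]] ?] [[|[|[|[|?]]]] ?] //= _; apply: val_inj.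
- by case=> [[|[|[|[|?]]]] ?] [[|[|[|[|?]]]] ?] [[|[|[|[|?]]]] ?].
Qed.

Definition N1 : dposet 'I_4 := mk_dposet rel4A_porder rel4B_porder.
Definition N2 : dposet 'I_4 := mk_dposet rel4B_porder rel4A_porder.

Definition without_N (T : finType) (Q : dposet T) : bool :=
  ~~ [exists A : {set T}, diso (dsub Q A) N1 || diso (dsub Q A) N2].

Variant poset_family := SP | HOP | SPP | OF | HOF | SWNP | SPF.

Definition from_plane (P : spclass) : bool :=
  [exists Q : dposet 'I_(scard P), plane Q && arises_from (srep P) Q].

Definition in_family (X : poset_family) (P : spclass) : bool :=
  match X with
  | SP => true
  | HOP => heap_ordered (srep P)
  | SPP => from_plane P
  | OF => rooted_forest (srep P)
  | HOF => heap_ordered (srep P) && rooted_forest (srep P)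
  | SWNP => [exists Q : dposet 'I_(scard P),
              [&& plane Q, without_N Q & arises_from (srep P) Q]]
  | SPF => rooted_forest (srep P) && from_plane P
  end.

(* The bases of H_X and of its augmentation ideal. *)
Definition fam (X : poset_family) : choiceType := {P : spclass | in_family X P}.
Definition fam_plus (X : poset_family) : choiceType :=
  {P : spclass | in_family X P && (0 < scard P)%N}.

(** * Vector spaces with a basis, and their tensor products *)

(* The vector space with basis [B] is [{malg K[B]}], and the tensor product of
   [{malg K[A]}] and [{malg K[B]}] is [{malg K[A * B]}], where the pair (a, b)
   stands for the tensor of a and b. *)
Section Linear.
Variable K : fieldType.
Implicit Types A B C D : choiceType.

(* Linear and bilinear extension of maps defined on bases. *)
Definition lext B (V : lmodType K) (f : B -> V) (x : {malg K[B]}) : V :=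
  \sum_(b <- msupp x) x@_b *: f b.

Definition bext A B (V : lmodType K) (f : A -> B -> V)
    (x : {malg K[A]}) (y : {malg K[B]}) : V :=
  \sum_(a <- msupp x) \sum_(b <- msupp y) (x@_a * y@_b) *: f a b.

Definition tens A B : {malg K[A]} -> {malg K[B]} -> {malg K[(A * B)%type]} :=
  bext (fun a b => << (a, b) >>).

(* f (x) g, for linear f and g *)
Definition tmap A B C D (f : {malg K[A]} -> {malg K[C]})
    (g : {malg K[B]} -> {malg K[D]}) : {malg K[(A * B)%type]} -> {malg K[(C * D)%type]} :=
  lext (fun p : A * B => tens (f << p.1 >>) (g << p.2 >>)).

(* (a (x) b, c (x) d) |-> m a c (x) m' b d, for bilinear m and m' *)
Definition tmap2 B (m m' : {malg K[B]} -> {malg K[B]} -> {malg K[B]}) :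
    {malg K[(B * B)%type]} -> {malg K[(B * B)%type]} -> {malg K[(B * B)%type]} :=
  bext (fun p q : B * B =>
          tens (m << p.1 >> << q.1 >>) (m' << p.2 >> << q.2 >>)).

Definition tassoc A B C : {malg K[(A * B * C)%type]} -> {malg K[(A * (B * C))%type]} :=
  lext (fun p : A * B * C => << (p.1.1, (p.1.2, p.2)) >>).

Definition incl B (p : pred B) : {malg K[{b : B | p b}]} -> {malg K[B]} :=
  lext (fun b : {b : B | p b} => << val b >>).

Definition bilinear B (m : {malg K[B]} -> {malg K[B]} -> {malg K[B]}) : Prop :=
  (forall x, linear (m x)) /\ (forall y, linear (m^~ y)).

Definition homogeneous B (deg : B -> nat) (n : nat) (x : {malg K[B]}) : Prop :=
  forall b, b \in msupp x -> deg b = n.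

End Linear.

(** * Dup-Dend bialgebras *)

Record dup_dend (K : fieldType) (B : choiceType) := DupDend {
  dd_mul : {malg K[B]} -> {malg K[B]} -> {malg K[B]};
  dd_nw : {malg K[B]} -> {malg K[B]} -> {malg K[B]};
  dd_prec : {malg K[B]} -> {malg K[(B * B)%type]};
  dd_succ : {malg K[B]} -> {malg K[(B * B)%type]}
}.

Section DupDendAxioms.
Variables (K : fieldType) (B : choiceType) (S : dup_dend K B).

Local Notation A := {malg K[B]}.
Local Notation "x · y" := (dd_mul S x y) (at level 40, left associativity).
Local Notation "x ↖ y" := (dd_nw S x y) (at level 40, left associativity).
Local Notation "x ⊗ y" := (tens x y) (at level 45).
Local Notation "f ⊠ g" := (tmap f g) (at level 45).
Local Notation Δl := (dd_prec S).
Local Notation Δr := (dd_succ S).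
Local Notation Δt := (fun x : A => Δl x + Δr x).
Local Notation id := (fun x : A => x).

Definition is_duplicial : Prop :=
  [/\ forall x y z, (x · y) · z = x · (y · z),
      forall x y z, (x ↖ y) ↖ z = x ↖ (y ↖ z) &
      forall x y z, (x · y) ↖ z = x · (y ↖ z)].

Definition is_codendriform : Prop :=
  [/\ forall x, tassoc ((Δl ⊠ id) (Δl x)) = (id ⊠ Δt) (Δl x),
      forall x, tassoc ((Δr ⊠ id) (Δl x)) = (id ⊠ Δl) (Δr x) &
      forall x, tassoc ((Δt ⊠ id) (Δr x)) = (id ⊠ Δr) (Δr x)].

(* In Sweedler notation, [(dd_mul S x ⊠ id) (Δl y)] is xy' (x) y'', summed over
   Δl y = y' (x) y'', and [tmap2 m m' u v] is (m u' v') (x) (m' u'' v''). *)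
Definition dup_dend_compat : Prop :=
  [/\ forall x y,
        Δl (x · y) =
          y ⊗ x + (id ⊠ dd_mul S x) (Δl y) + (dd_mul S x ⊠ id) (Δl y)
          + ((fun u => u · y) ⊠ id) (Δt x)
          + tmap2 (dd_mul S) (dd_mul S) (Δt x) (Δl y),
      forall x y,
        Δr (x · y) =
          x ⊗ y + (dd_mul S x ⊠ id) (Δr y) + (id ⊠ dd_mul S x) (Δr y)
          + (id ⊠ (fun u => u · y)) (Δt x)
          + tmap2 (dd_mul S) (dd_mul S) (Δt x) (Δr y),
      forall x y,
        Δl (x ↖ y) =
          (dd_nw S x ⊠ id) (Δl y) + ((fun u => u ↖ y) ⊠ id) (Δl x)
          + tmap2 (dd_nw S) (dd_mul S) (Δl x) (Δl y) &
      forall x y,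
        Δr (x ↖ y) =
          x ⊗ y + (dd_nw S x ⊠ id) (Δr y)
          + (id ⊠ (fun u => u ↖ y)) (Δr x)
          + (id ⊠ (fun u => u · y)) (Δl x)
          + tmap2 (dd_nw S) (dd_mul S) (Δl x) (Δr y)].

Definition is_dup_dend_bialgebra : Prop :=
  [/\ [/\ bilinear (dd_mul S), bilinear (dd_nw S), linear Δl & linear Δr],
      is_duplicial, is_codendriform & dup_dend_compat].

End DupDendAxioms.

Definition dup_dend_hom (K : fieldType) (B C : choiceType)
    (S : dup_dend K B) (S' : dup_dend K C) (f : {malg K[B]} -> {malg K[C]}) :
    Prop :=
  [/\ linear f,
      forall x y, f (dd_mul S x y) = dd_mul S' (f x) (f y),
      forall x y, f (dd_nw S x y) = dd_nw S' (f x) (f y),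
      forall x, tmap f f (dd_prec S x) = dd_prec S' (f x) &
      forall x, tmap f f (dd_succ S x) = dd_succ S' (f x)].

(** * Graded Hopf algebras *)

(* The operations of a graded Hopf algebra with a homogeneous basis.  Unit,
   counit and antipode are determined by the product and the coproduct;
   bialgebra isomorphisms preserve the antipode. *)
Record graded_hopf (K : fieldType) (B : choiceType) := GradedHopf {
  h_mul : {malg K[B]} -> {malg K[B]} -> {malg K[B]};
  h_one : {malg K[B]};
  h_comul : {malg K[B]} -> {malg K[(B * B)%type]};
  h_counit : {malg K[B]} -> K;
  h_deg : B -> nat
}.

Definition hopf_hom (K : fieldType) (B C : choiceType)
    (S : graded_hopf K B) (S' : graded_hopf K C)
    (f : {malg K[B]} -> {malg K[C]}) : Prop :=
  [/\ linear f,
      (forall x y, f (h_mul S x y) = h_mul S' (f x) (f y)) /\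
        f (h_one S) = h_one S',
      forall x, tmap f f (h_comul S x) = h_comul S' (f x),
      forall x, h_counit S' (f x) = h_counit S x &
      forall n x, homogeneous (h_deg S) n x -> homogeneous (h_deg S') n (f x)].

Definition hopf_isomorphic (K : fieldType) (B C : choiceType)
    (S : graded_hopf K B) (S' : graded_hopf K C) : Prop :=
  exists2 f : {malg K[B]} -> {malg K[C]}, hopf_hom S S' f & bijective f.

(** * The structures on special posets *)

Section HSP.
Variable K : fieldType.

Definition empty_proof : porder (fun _ _ : void => true).
Proof. by apply/porderP; split=> -[]. Qed.

Definition empty_special : special (mk_dposet empty_proof empty_proof).
Proof. by apply/forallP=> -[]. Qed.

Definition sempty : spclass :=
  sclass (exist _ (mk_dposet empty_proof empty_proof) empty_special).

(* (P \ I, I) *)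
Definition cut (P : spclass) (I : {set 'I_(scard P)}) : spclass * spclass :=
  (sclass (ssub (srep P) (~: I)), sclass (ssub (srep P) I)).

Definition sp_mul (P Q : spclass) : {malg K[spclass]} :=
  << sclass (scat (srep P) (srep Q)) >>.

Definition sp_comul (P : spclass) : {malg K[(spclass * spclass)%type]} :=
  \sum_(I | ideal (srep P) I) << cut I >>.

(* The next three operations are only meant for nonempty special posets, on
   which [is_max] is satisfied by g_P only; their values at the empty special
   poset are irrelevant. *)
Definition sp_nw (P Q : spclass) : {malg K[spclass]} :=
  << sclass (snw (srep P) (srep Q)) >>.

Definition sp_prec (P : spclass) : {malg K[(spclass * spclass)%type]} :=
  \sum_(I | [&& ideal (srep P) I, I != set0, I != setT &
                [forall g, is_max (srep P) g ==> (g \notin I)]]) << cut I >>.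

Definition sp_succ (P : spclass) : {malg K[(spclass * spclass)%type]} :=
  \sum_(I | [&& ideal (srep P) I, I != set0, I != setT &
                [forall g, is_max (srep P) g ==> (g \in I)]]) << cut I >>.

Definition SP_hopf : graded_hopf K spclass :=
  {| h_mul := bext sp_mul;
     h_one := << sempty >>;
     h_comul := lext sp_comul;
     h_counit := fun x => x@_sempty;
     h_deg := scard |}.

Definition SP_dup_dend : dup_dend K spclass :=
  {| dd_mul := bext sp_mul;
     dd_nw := bext sp_nw;
     dd_prec := lext sp_prec;
     dd_succ := lext sp_succ |}.

End HSP.

(* Being injective, [incl] determines the operations of [S]. *)
Definition sub_hopf (K : fieldType) (X : poset_family) (S : graded_hopf K (fam X)) :
    Prop :=
  hopf_hom S (SP_hopf K) (@incl K _ (in_family X)).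

Definition sub_dup_dend (K : fieldType) (X : poset_family)
    (S : dup_dend K (fam_plus X)) : Prop :=
  dup_dend_hom S (SP_dup_dend K)
    (@incl K _ (fun P => in_family X P && (0 < scard P)%N)).

(** * The noncommutative Connes-Kreimer Hopf algebra *)

Record graded_set := GradedSet {
  gs_sort :> choiceType;
  gs_deg : gs_sort -> nat;
  gs_deg_gt0 : forall d, (0 < gs_deg d)%N
}.

Inductive ptree (D : Type) : Type := PNode of D & seq (ptree D).
Definition pforest (D : Type) : Type := seq (ptree D).

Section PtreeChoice.
Variable D : choiceType.

Fixpoint ptree_encode (t : ptree D) : GenTree.tree D :=
  let: PNode d s := t in
  GenTree.Node 0 (GenTree.Leaf d :: map ptree_encode s).

Fixpoint ptree_decode (t : GenTree.tree D) : option (ptree D) :=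
  if t is GenTree.Node _ (GenTree.Leaf d :: s)
  then Some (PNode d (pmap ptree_decode s)) else None.

Lemma ptree_encodeK : pcancel ptree_encode ptree_decode.
Proof.
rewrite /pcancel; fix IH 1 => -[d s] /=; congr (Some (PNode d _)).
by elim: s => //= t s IHs; rewrite IH /= IHs.
Qed.

End PtreeChoice.

HB.instance Definition _ (D : choiceType) :=
  Choice.copy (ptree D) (pcan_type (@ptree_encodeK D)).

Section Mapi.
Variables (T U : Type) (f : nat -> T -> U).
Fixpoint mapi (i : nat) (s : seq T) : seq U :=
  if s is x :: s' then f i x :: mapi i.+1 s' else [::].
End Mapi.

Section PlaneForests.
Variable D : graded_set.

Fixpoint tdeg (t : ptree D) : nat :=
  let: PNode d s := t in (gs_deg d + sumn (map tdeg s))%N.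
Definition fdeg (F : pforest D) : nat := sumn (map tdeg F).

(* A vertex of a forest is represented by its address, a sequence of natural
   numbers: the address of a root is [:: i], where i is its position, and the
   address of the i-th child of v is obtained from that of v by appending i.
   Hence w is a descendant of v iff the address of v is a prefix of that of w. *)
Fixpoint taddr (t : ptree D) : seq (seq nat) :=
  let: PNode _ s := t in
  [::] :: flatten (mapi (fun i u => map (cons i) (taddr u)) 0 s).
Definition faddr (F : pforest D) : seq (seq nat) :=
  flatten (mapi (fun i u => map (cons i) (taddr u)) 0 F).

Definition vertex (F : pforest D) : finType := seq_sub (faddr F).

Definition fideal (F : pforest D) (I : {set vertex F}) : bool :=
  [forall v in I, forall w : vertex F, prefix (val v) (val w) ==> (w \in I)].

(* The forest induced on the vertices whose addresses satisfy [p]: when a vertex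
   is removed, the trees above it take its place. *)
Fixpoint tinduced (p : pred (seq nat)) (t : ptree D) : pforest D :=
  let: PNode d s := t in
  let c := flatten (mapi (fun i u => tinduced (fun a => p (i :: a)) u) 0 s) in
  if p [::] then [:: PNode d c] else c.
Definition finduced (F : pforest D) (I : {set vertex F}) : pforest D :=
  let p a := a \in [seq val v | v in I] in
  flatten (mapi (fun i u => tinduced (fun a => p (i :: a)) u) 0 F).

Variable K : fieldType.

Definition ck_mul (F G : pforest D) : {malg K[pforest D]} := << F ++ G >>.

Definition ck_comul (F : pforest D) : {malg K[(pforest D * pforest D)%type]} :=
  \sum_(I : {set vertex F} | fideal I) << (finduced (~: I), finduced I) >>.

Definition CK_hopf : graded_hopf K (pforest D) :=
  {| h_mul := bext ck_mul;
     h_one := << [::] : pforest D >>;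
     h_comul := lext ck_comul;
     h_counit := fun x => x@_([::] : pforest D);
     h_deg := fdeg |}.

End PlaneForests.

(* Main.v *)
Require Import Defs.
From HB Require Import structures.
From mathcomp Require Import all_boot all_algebra.
From mathcomp Require Import finmap zify.
From mathcomp.multinomials Require Import monalg.

Set Implicit Arguments.
Unset Strict Implicit.
Unset Printing Implicit Defensive.

Import GRing.Theory.

(** Write Delta for the coproduct. A class [b] of special posets has two lists of
    cuts, [cuts false b] and [cuts true b], according to the side on which the
    greatest element of the second order falls; they split Delta in two halves,
    called rho and lambda in the comments, which extend the two reduced half
    coproducts to the unit: for [b] nonempty, rho is Delta_prec plus b (x) 1 and
    lambda is Delta_succ plus 1 (x) b. On these full halves the axioms of
    Dup-Dend bialgebras become short multiplicativity and coassociativity laws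
    ([cuts_mulc], [cutsF_nwc], [cutsT_nwc], [coassFF], [coassTF], [coassTT]),
    proved by enumerating ideals. Removing the trivial cuts gives back the
    axioms themselves ([rcutsF_mul] to [rcutsT_nw], [dup_dend_ofP]).

    For the isomorphism with a Connes-Kreimer algebra, two decompositions of the
    same poset, both along its second order, refine each other ([mulc_eq],
    [nwc_eq], [mulc_nwc_eq]). Hence a nonempty class is in a unique way a product
    l (g nw r) in which g is decomposable for neither product, and unfolding l
    and r identifies the classes with the plane forests whose decorations are
    the indecomposable classes ([forest_val]). This bijection does not respect
    coproducts, because an indecomposable class may have nontrivial cuts. But if
    v is primitive for both halves, then
      Delta(v nw y) = 1 (x) (v nw y) + (v nw -) (x) Id applied to Delta(y)
    ([cdel_graft]), which is the recursion satisfied by the coproduct of a plane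
    tree with root v ([ck_comulE]). Replacing each indecomposable g by a
    primitive element that differs from g by decomposable terms thus gives a
    morphism of Hopf algebras ([ck_map]); it is unitriangular for the number of
    vertices of forests ([forest_map_lead]), so it is bijective.

    Such a primitive element exists by a rigidity argument
    ([primitive_projection]). For a homogeneous element a, take the slices of a,
    obtained by extracting x on the left of lambda and then y on the right of
    rho. The slices of largest total degree m = |x| + |y| are primitive, by
    coassociativity ([primitive_top]). Conversely, for v primitive, the top
    slices of X nw (Y v) are the multiples of v whose coefficients are those of
    rho(X) Delta(Y) ([graft_slices]), where tensors are multiplied by nw on the left
    and by the product on the right; and the elements rho(X) Delta(Y) with
    |X| + |Y| = m span everything in degree m ([tau_surj]). So the top slices of
    a are cancelled by subtracting decomposable elements ([rigidity_step]), and
    after finitely many steps there remains a primitive element.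

    All this uses little of posets: the laws of cuts, and the fact that a family
    is stable under both products, under taking factors and under cuts. It is
    carried out for an abstract [cut_bialgebra], of which the seven families are
    instances ([family_bialgebra]). *)

(** * Classes of subposets *)

Definition cl (T : finType) (P : sposet T) (A : {set T}) : spclass :=
  sclass (ssub P A).

Lemma sclass_iso (T U : finType) (P : sposet T) (Q : sposet U) (f : T -> U) :
  bijective f -> {mono f : x y / le1 P x y >-> le1 Q x y} ->
  {mono f : x y / le2 P x y >-> le2 Q x y} -> sclass P = sclass Q.
Proof. by move=> fb f1 f2; apply/sclass_eq/disoP; exists f. Qed.

Definition embedding (T U : finType) (P : sposet T) (Q : sposet U)
    (A : {set T}) (f : T -> U) : Prop :=
  [/\ {in A &, injective f},
      {in A &, {mono f : x y / le1 P x y >-> le1 Q x y}} &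
      {in A &, {mono f : x y / le2 P x y >-> le2 Q x y}}].

(** Posets are compared as subsets of one ambient poset: an embedding transports the
    class of a subset. *)
Lemma cl_embedding (T U : finType) (P : sposet T) (Q : sposet U)
    (A : {set T}) (f : T -> U) :
  embedding P Q A f -> cl Q (f @: A) = cl P A.
Proof.
case=> fi f1 f2; apply/esym.
pose F (x : {x : T | x \in A}) : {y : U | y \in f @: A} :=
  exist _ (f (val x)) (imset_f f (valP x)).
apply: (@sclass_iso _ _ _ _ F).
- apply: inj_card_bij => [x y /(congr1 val)/= exy|].
    by apply/val_inj/fi => //; apply: valP.
  by rewrite !card_sig (eq_card (B := f @: A)) // (eq_card (B := A)) // card_in_imset.
- by move=> x y; rewrite !le1_mk /= f1 //; apply: valP.
- by move=> x y; rewrite !le2_mk /= f2 //; apply: valP.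
Qed.

Lemma cl_setT (T : finType) (P : sposet T) : cl P setT = sclass P.
Proof.
apply: (@sclass_iso _ _ _ _ val).
- apply: inj_card_bij; first exact: val_inj.
  by rewrite card_sig; apply/subset_leq_card/subsetP.
- by move=> x y; rewrite le1_mk.
- by move=> x y; rewrite le2_mk.
Qed.

(** The canonical representative of the class of a subset embeds onto that subset,
    which reduces statements about classes to statements about subsets. *)
Lemma cl_subset (T : finType) (P : sposet T) (A : {set T}) :
  exists f : 'I_(scard (cl P A)) -> T,
    [/\ injective f, f @: setT = A & embedding (srep (cl P A)) P setT f].
Proof.
have /diso_sym/disoP[f [fb f1 f2]] := diso_sclass (ssub P A).
exists (fun i => val (f i)).
have fi : injective (fun i => val (f i)).
  by move=> i j /val_inj/(bij_inj fb).
split=> //.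
  apply/setP=> x; apply/imsetP/idP=> [[i _ ->]|xA]; first exact: valP.
  case: fb => g _ gK; exists (g (exist _ x xA)) => //.
  by rewrite gK.
split=> [i j _ _|i j _ _|i j _ _]; first exact: fi.
  by rewrite -[RHS]f1 le1_mk.
by rewrite -[RHS]f2 le2_mk.
Qed.

Lemma scard_cl (T : finType) (P : sposet T) A : scard (cl P A) = #|A|.
Proof.
have [f [fi fA _]] := cl_subset P A.
by rewrite -[in RHS]fA card_imset // cardsT card_ord.
Qed.

Lemma sclass_cl (b : spclass) : cl (srep b) setT = b.
Proof. by rewrite cl_setT sclass_srep. Qed.

(** * Ideals *)

Section Ideals.
Variables (T : finType) (P : sposet T).
Implicit Types A I J : {set T}.

(** Ideals relative to a subposet, so that iterated cuts live in one ambient type. *)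
Definition idealin A I : bool :=
  (I \subset A) && [forall x in I, forall y in A, le1 P x y ==> (y \in I)].

(** For [I] inside [A], this says that [I] contains the maximum of the second order of
    [A]. *)
Definition topin A I : bool := [exists g in I, [forall z in A, le2 P z g]].

Lemma idealinP A I :
  reflect (I \subset A /\ forall x y, x \in I -> y \in A -> le1 P x y -> y \in I)
          (idealin A I).
Proof.
apply: (iffP andP) => -[sIA h]; split=> //.
  move=> x y xI yA xy; move/forallP/(_ x)/implyP/(_ xI)/forallP/(_ y): h.
  by move=> /implyP/(_ yA)/implyP/(_ xy).
apply/forallP=> x; apply/implyP=> xI; apply/forallP=> y; apply/implyP=> yA.
by apply/implyP; apply: h.
Qed.

Lemma topinP A I :
  reflect (exists2 g, g \in I & forall z, z \in A -> le2 P z g) (topin A I).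
Proof.
apply: (iffP existsP) => [[g /andP[gI /forallP h]]|[g gI h]].
  by exists g => // z zA; move/implyP: (h z); apply.
by exists g; rewrite gI; apply/forallP=> z; apply/implyP; apply: h.
Qed.

Lemma le2_refl x : le2 P x x.
Proof. by have [_ /porderP[r _ _]] := dposetP P. Qed.

Lemma le2_anti x y : le2 P x y -> le2 P y x -> x = y.
Proof.
have [_ /porderP[_ a _]] := dposetP P.
by move=> xy yx; apply: a; rewrite xy.
Qed.

Lemma le2_trans y x z : le2 P x y -> le2 P y z -> le2 P x z.
Proof. by have [_ /porderP[_ _ t]] := dposetP P; apply: t. Qed.

Lemma le1_refl x : le1 P x x.
Proof. by have [/porderP[r _ _] _] := dposetP P. Qed.

Lemma topE A I g : g \in A -> (forall z, z \in A -> le2 P z g) ->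
  I \subset A -> topin A I = (g \in I).
Proof.
move=> gA gmax sIA; apply/topinP/idP=> [[h hI hmax]|gI].
  have -> // : g = h.
  by apply: le2_anti; [apply: hmax | apply/gmax/(subsetP sIA)].
by exists g.
Qed.

Lemma max_exists A : A != set0 ->
  exists2 g, g \in A & forall z, z \in A -> le2 P z g.
Proof.
move=> /set0Pn[x xA].
have [g gA gmax] := arg_maxnP (P := mem A) (fun z => rank P z : nat) xA.
by exists g => // z zA; rewrite -rank_le; apply: gmax.
Qed.

End Ideals.

Section CutSums.
Implicit Types (F : spclass * spclass -> nat).

(** Cuts are handled through sums over them of an arbitrary function, which can be
    reindexed; [perm_eq_sum] turns equalities of such sums into permutations of lists. *)
Definition cutsum (T : finType) (P : sposet T) (s : bool) (A : {set T}) F : nat :=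
  \sum_(I | idealin P A I && (topin P A I == s)) F (cl P (A :\: I), cl P I).

Lemma cutsum_embedding (T U : finType) (P : sposet T) (Q : sposet U)
    (A : {set T}) (f : T -> U) s F :
  embedding P Q A f -> cutsum Q s (f @: A) F = cutsum P s A F.
Proof.
move=> fe; have [fi f1 f2] := fe.
have fIn (I : {set T}) x : I \subset A -> x \in A -> (f x \in f @: I) = (x \in I).
  move=> sIA xA; apply/imsetP/idP=> [[y yI /fi]|xI]; last by exists x.
  by move=> -> //; apply: (subsetP sIA).
rewrite /cutsum (reindex_onto (fun I : {set T} => f @: I)
  (fun J : {set U} => A :&: f @^-1: J)) /=; last first.
  move=> J /andP[/idealinP[sJ _] _]; apply/setP=> y.
  apply/imsetP/idP=> [[x]|yJ]; first by rewrite !inE => /andP[_ xJ] ->.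
  by have /imsetP[x xA exy] := subsetP sJ _ yJ; exists x => //; rewrite !inE xA -exy.
have sub (I : {set T}) : A :&: f @^-1: (f @: I) == I -> I \subset A.
  by move/eqP<-; apply: subsetIl.
apply: eq_big => [I|I /andP[_ /sub sIA]].
  apply/andP/andP=> [[/andP[ifI tI] eI]|[iI tI]].
    have sIA := sub _ eI; split.
      apply/idealinP; split=> // x y xI yA xy; rewrite -fIn //.
      case/idealinP: ifI => _; apply; first exact: (imset_f f xI).
        exact: imset_f.
      by rewrite f1 //; apply: (subsetP sIA).
    rewrite -(eqP tI); apply/eqP; apply/topinP/topinP => -[g gI gmax].
      exists (f g); first exact: imset_f.
      by move=> _ /imsetP[z zA ->]; rewrite f2 ?gmax //; apply: (subsetP sIA).
    case/imsetP: gI gmax => {}g gI -> gmax.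
    exists g => // z zA; rewrite -f2 //; last exact: (subsetP sIA).
    by apply: gmax; apply: imset_f.
  case/idealinP: (iI) => sIA iI'; split; last first.
    apply/eqP/setP=> x; rewrite !inE; have [xA|xA] := boolP (x \in A).
      by rewrite fIn.
    by apply/esym/negbTE; apply: contra xA; apply: (subsetP sIA).
  apply/andP; split.
    apply/idealinP; split; first exact: imsetS.
    move=> _ _ /imsetP[x xI ->] /imsetP[y yA ->].
    have xA := subsetP sIA _ xI.
    by rewrite f1 // fIn //; apply: iI'.
  rewrite -(eqP tI); apply/eqP; apply/topinP/topinP => -[g gI gmax].
    case/imsetP: gI gmax => {}g gI -> gmax.
    exists g => // z zA; rewrite -f2 //; last exact: (subsetP sIA).
    by apply: gmax; apply: imset_f.
  exists (f g); first exact: imset_f.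
  by move=> _ /imsetP[z zA ->]; rewrite f2 ?gmax //; apply: (subsetP sIA).
have eD : f @: A :\: f @: I = f @: (A :\: I).
  apply/setP=> y; rewrite !inE; apply/andP/imsetP.
    case=> yI /imsetP[x xA exy]; exists x => //; rewrite inE xA andbT.
    by apply: contra yI => xI; rewrite exy imset_f.
  case=> x; rewrite inE => /andP[xI xA] ->; split; last exact: imset_f.
  by rewrite fIn.
have sub_emb (B : {set T}) : B \subset A -> embedding P Q B f.
  move=> /subsetP sBA; split=> x y xB yB; first by apply: fi; apply: sBA.
    by apply: f1; apply: sBA.
  by apply: f2; apply: sBA.
by rewrite eD !(@cl_embedding _ _ P) //; apply: sub_emb; rewrite // subsetDl.
Qed.

(** The terms of lambda for [s = true] and of rho for [s = false]. The empty class has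
    no greatest element, so its unique cut belongs to rho. *)
Definition cuts (s : bool) (b : spclass) : seq (spclass * spclass) :=
  [seq (cl (srep b) (setT :\: J), cl (srep b) J)
     | J <- enum [pred J : {set 'I_(scard b)} |
                   idealin (srep b) setT J && (topin (srep b) setT J == s)]].

Lemma sum_cuts (T : finType) (P : sposet T) (A : {set T}) s F :
  \sum_(p <- cuts s (cl P A)) F p = cutsum P s A F.
Proof.
rewrite /cuts big_map big_enum /=.
have [f [fi fA fe]] := cl_subset P A.
by have := cutsum_embedding s F fe; rewrite fA => ->.
Qed.

End CutSums.

(** * Decompositions of special posets *)

Definition mulc (a b : spclass) : spclass := sclass (scat (srep a) (srep b)).
Definition nwc (a b : spclass) : spclass := sclass (snw (srep a) (srep b)).

Section Splits.
Variables (T : finType) (P : sposet T).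
Implicit Types A I J S : {set T}.

(** The second-order part of both products. *)
Definition before S1 S2 : Prop :=
  forall x y, x \in S1 -> y \in S2 -> le2 P x y && (x != y).

Definition below S x : Prop :=
  exists2 g, g \in S /\ (forall z, z \in S -> le2 P z g) & le1 P x g.

(** In this situation [S1 :|: S2] is the product of its parts; see [cl_mulrel]. *)
Definition mulrel S1 S2 : Prop :=
  before S1 S2 /\
  forall x y, x \in S1 -> y \in S2 -> ~~ le1 P x y && ~~ le1 P y x.

(** In this situation [S1 :|: S2] is the grafting of its parts; see [cl_nwrel]. *)
Definition nwrel S1 S2 : Prop :=
  before S1 S2 /\
  forall x y, x \in S1 -> y \in S2 ->
    (le1 P x y <-> below S1 x) /\ ~~ le1 P y x.

Lemma before_disjoint S1 S2 : before S1 S2 -> [disjoint S1 & S2].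
Proof.
move=> b12; apply/pred0P=> x /=; apply/negbTE/andP=> -[x1 x2].
by have := b12 _ _ x1 x2; rewrite eqxx andbF.
Qed.

Lemma before_le2 S1 S2 x y : before S1 S2 -> x \in S1 -> y \in S2 ->
  le2 P y x = false.
Proof.
move=> b12 x1 y2; have /andP[xy /eqP nxy] := b12 _ _ x1 y2.
by apply/negbTE/negP=> yx; apply/nxy/le2_anti/yx.
Qed.

Lemma sub_before S1 S2 S1' S2' : S1' \subset S1 -> S2' \subset S2 ->
  before S1 S2 -> before S1' S2'.
Proof. by move=> /subsetP s1 /subsetP s2 b x y /s1 x1 /s2; apply: b. Qed.

Lemma sub_mulrel S1 S2 S1' S2' : S1' \subset S1 -> S2' \subset S2 ->
  mulrel S1 S2 -> mulrel S1' S2'.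
Proof.
move=> s1 s2 [b m]; split; first exact: sub_before b.
by move=> x y /(subsetP s1) x1 /(subsetP s2); apply: m.
Qed.

Lemma image_case (T1 T2 : finType) (f : T1 -> T) (g : T2 -> T) :
  [set match z with inl x => f x | inr y => g y end | z in [set: (T1 + T2)%type]]
  = (f @: setT) :|: (g @: setT).
Proof.
apply/setP=> x; rewrite !inE; apply/imsetP/orP.
  by case=> -[y|y] _ ->; [left | right]; apply: imset_f; rewrite inE.
by case=> /imsetP[y _ ->]; [exists (inl y) | exists (inr y)].
Qed.

End Splits.

Lemma before_embedding (T : finType) (P : sposet T) S1 S2 (T1 T2 : finType)
    (R1 : sposet T1) (R2 : sposet T2) (f : T1 -> T) (g : T2 -> T)
    (c : T1 -> T2 -> bool) (h : porder (sum_rel (le1 R1) (le1 R2) c)) :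
  f @: setT = S1 -> g @: setT = S2 -> before P S1 S2 ->
  embedding R1 P setT f -> embedding R2 P setT g ->
  (forall x y, le1 P (f x) (g y) = c x y) ->
  (forall x y, le1 P (g y) (f x) = false) ->
  sclass (exist _ (mk_dposet h (scat_proof2 R1 R2)) (special_sum _ _) :
            sposet (T1 + T2)%type) = cl P (S1 :|: S2).
Proof.
move=> fS gS b12 [fi f1 f2] [gi g1 g2] fg gf.
have fS1 x : f x \in S1 by rewrite -fS imset_f.
have gS2 y : g y \in S2 by rewrite -gS imset_f.
rewrite -cl_setT -fS -gS -image_case; apply/esym.
have b x y := b12 _ _ (fS1 x) (gS2 y).
apply: cl_embedding; split.
- case=> x [] y _ _; first by move/fi->; rewrite ?inE.
  + by move=> exy; have := b x y; rewrite exy eqxx andbF.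
  + by move=> exy; have := b y x; rewrite exy eqxx andbF.
  + by move/gi->; rewrite ?inE.
- case=> x [] y _ _; rewrite [RHS]le1_mk /=.
  + by rewrite f1 ?inE.
  + by rewrite fg.
  + by rewrite gf.
  + by rewrite g1 ?inE.
- case=> x [] y _ _; rewrite [RHS]le2_mk /=.
  + by rewrite f2 ?inE.
  + by have /andP[-> _] := b x y.
  + exact: (before_le2 b12).
  + by rewrite g2 ?inE.
Qed.

Section SplitClasses.
Variables (T : finType) (P : sposet T).
Implicit Types A I J S : {set T}.

Lemma cl_mulrel S1 S2 :
  mulrel P S1 S2 -> cl P (S1 :|: S2) = mulc (cl P S1) (cl P S2).
Proof.
case=> b12 m12; have [f [fi fS fe]] := cl_subset P S1.
have [g [gi gS ge]] := cl_subset P S2.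
have fS1 x : f x \in S1 by rewrite -fS imset_f.
have gS2 y : g y \in S2 by rewrite -gS imset_f.
have m x y := m12 _ _ (fS1 x) (gS2 y).
apply/esym; apply: (before_embedding (scat_proof1 _ _) fS gS b12 fe ge) => x y.
  by have /andP[/negbTE-> _] := m x y.
by have /andP[_ /negbTE->] := m x y.
Qed.

Lemma below_embedding (T1 : finType) (R1 : sposet T1) (f : T1 -> T) S x :
  f @: setT = S -> embedding R1 P setT f ->
  below_max R1 x <-> below P S (f x).
Proof.
move=> <- [fi f1 f2]; split.
  case/existsP=> g /andP[/forallP gm xg]; exists (f g); last by rewrite f1 ?inE.
  split; first exact: imset_f.
  by move=> _ /imsetP[z _ ->]; rewrite f2 ?inE.
case=> _ [/imsetP[g _ ->] gm]; rewrite f1 ?inE // => xg; apply/existsP; exists g.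
rewrite xg andbT; apply/forallP=> z; rewrite -f2 ?inE //; apply: gm.
exact: imset_f.
Qed.

Lemma cl_nwrel S1 S2 :
  nwrel P S1 S2 -> cl P (S1 :|: S2) = nwc (cl P S1) (cl P S2).
Proof.
case=> b12 m12; have [f [fi fS fe]] := cl_subset P S1.
have [g [gi gS ge]] := cl_subset P S2.
have fS1 x : f x \in S1 by rewrite -fS imset_f.
have gS2 y : g y \in S2 by rewrite -gS imset_f.
have m x y := m12 _ _ (fS1 x) (gS2 y).
apply/esym; apply: (before_embedding (snw_proof _ _) fS gS b12 fe ge) => x y.
  have [h _] := m x y; apply/idP/idP => [/h|xg]; last apply/h.
    by move/(below_embedding _ fS fe).
  exact/(below_embedding _ fS fe).
by have [_ /negbTE] := m x y.
Qed.

(** Converse of [before_embedding]: a subset whose class is a sum of two posets is the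
    union of the images of the two summands. *)
Lemma sum_split A (T1 T2 : finType) (R1 : sposet T1) (R2 : sposet T2)
    (c : T1 -> T2 -> bool) (h : porder (sum_rel (le1 R1) (le1 R2) c)) :
  cl P A = sclass (exist _ (mk_dposet h (scat_proof2 R1 R2)) (special_sum _ _) :
            sposet (T1 + T2)%type) ->
  exists (f : T1 -> T) (g : T2 -> T),
  [/\ (f @: setT) :|: (g @: setT) = A, before P (f @: setT) (g @: setT),
      embedding R1 P setT f, embedding R2 P setT g &
      (forall x y, le1 P (f x) (g y) = c x y) /\
      (forall x y, le1 P (g y) (f x) = false)].
Proof.
move=> eA; have [k [ki kA [_ k1 k2]]] := cl_subset P A.
have := diso_sclass (exist _ (mk_dposet h (scat_proof2 R1 R2)) (special_sum _ _) :
            sposet (T1 + T2)%type).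
rewrite -eA => /disoP[l [lb l1 l2]].
have m1 x y : le1 P (k (l x)) (k (l y)) = sum_rel (le1 R1) (le1 R2) c x y.
  by rewrite k1 ?inE // l1 le1_mk.
have m2 x y : le2 P (k (l x)) (k (l y)) = sum_rel (le2 R1) (le2 R2) (fun _ _ => true) x y.
  by rewrite k2 ?inE // l2 le2_mk.
have kli : injective (k \o l) by apply: inj_comp ki (bij_inj lb).
exists (fun x => k (l (inl x))), (fun x => k (l (inr x))); split.
- rewrite -image_case -kA; apply/setP=> x; apply/imsetP/imsetP.
    by case=> -[y|y] _ ->; [exists (l (inl y)) | exists (l (inr y))].
  case=> i _ ->; case: lb => l' l'K lK; exists (l' i) => //.
  by case e: (l' i) => [y|y]; rewrite -e lK.
- move=> _ _ /imsetP[x _ ->] /imsetP[y _ ->]; rewrite m2 /=.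
  by apply/eqP=> /(@kli (inl x) (inr y)).
- split=> x y _ _; last 2 first; rewrite ?m1 ?m2 //.
  by move/(@kli (inl x) (inl y)) => [].
- split=> x y _ _; last 2 first; rewrite ?m1 ?m2 //.
  by move/(@kli (inr x) (inr y)) => [].
by split=> x y; rewrite m1.
Qed.

Lemma mulc_split A a b : cl P A = mulc a b ->
  exists S1 S2, [/\ S1 :|: S2 = A, mulrel P S1 S2, cl P S1 = a & cl P S2 = b].
Proof.
case/sum_split=> f [g [fgA b12 fe ge [fg gf]]].
exists (f @: setT), (g @: setT); split=> //.
- split=> // _ _ /imsetP[x _ ->] /imsetP[y _ ->].
  by rewrite fg gf.
- by rewrite (cl_embedding fe) sclass_cl.
- by rewrite (cl_embedding ge) sclass_cl.
Qed.

Lemma nwc_split A a b : cl P A = nwc a b ->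
  exists S1 S2, [/\ S1 :|: S2 = A, nwrel P S1 S2, cl P S1 = a & cl P S2 = b].
Proof.
case/sum_split=> f [g [fgA b12 fe ge [fg gf]]].
exists (f @: setT), (g @: setT); split=> //.
- split=> // _ _ /imsetP[x _ ->] /imsetP[y _ ->].
  by rewrite fg gf; split=> //; apply: (below_embedding _ erefl fe).
- by rewrite (cl_embedding fe) sclass_cl.
- by rewrite (cl_embedding ge) sclass_cl.
Qed.

Lemma cl_eq1 A : (cl P A == sempty) = (A == set0).
Proof.
apply/eqP/eqP=> [eA|->].
  apply/eqP; rewrite -cards_eq0 -(scard_cl P) eA /scard /= eq_card0 // => -[].
rewrite /cl /sempty; apply/sclass_eq/disoP.
have v (x : {x : T | x \in set0}) : void by case: x => x; rewrite inE.
exists v; split=> [|x|x].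
- exists (fun z : void => match z with end); last by case.
  by move=> x; case: (v x).
- by case: (v x).
- by case: (v x).
Qed.

End SplitClasses.

Lemma perm_eq_sum (T : eqType) (s t : seq T) :
  (forall F : T -> nat, \sum_(x <- s) F x = \sum_(x <- t) F x) -> perm_eq s t.
Proof.
move=> st; apply/permP=> a; rewrite -!sum1_count [LHS]big_mkcond [RHS]big_mkcond.
exact: st.
Qed.

(** Any two classes occur as consecutive parts of one ambient poset, which is where all
    identities between products are checked. *)
Lemma mulc_ex a b : exists (T : finType) (P : sposet T) (S1 S2 : {set T}),
  [/\ mulrel P S1 S2, cl P S1 = a, cl P S2 = b & mulc a b = cl P (S1 :|: S2)].
Proof.
have [S1 [S2 [eS m e1 e2]]] := mulc_split (sclass_cl (mulc a b)).
exists _, (srep (mulc a b)), S1, S2; split=> //.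
by rewrite eS sclass_cl.
Qed.

Lemma nwc_ex a b : exists (T : finType) (P : sposet T) (S1 S2 : {set T}),
  [/\ nwrel P S1 S2, cl P S1 = a, cl P S2 = b & nwc a b = cl P (S1 :|: S2)].
Proof.
have [S1 [S2 [eS m e1 e2]]] := nwc_split (sclass_cl (nwc a b)).
exists _, (srep (nwc a b)), S1, S2; split=> //.
by rewrite eS sclass_cl.
Qed.

Lemma card_before (T : finType) (P : sposet T) S1 S2 :
  before P S1 S2 -> #|S1 :|: S2| = #|S1| + #|S2|.
Proof. by move=> /before_disjoint d; rewrite cardsU disjoint_setI0 // cards0 subn0. Qed.

Lemma scard_mulc a b : scard (mulc a b) = scard a + scard b.
Proof.
have [T [P [S1 [S2 [[m _] <- <- ->]]]]] := mulc_ex a b.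
by rewrite !scard_cl (card_before m).
Qed.

Lemma scard_nwc a b : scard (nwc a b) = scard a + scard b.
Proof.
have [T [P [S1 [S2 [[m _] <- <- ->]]]]] := nwc_ex a b.
by rewrite !scard_cl (card_before m).
Qed.

Lemma scard_eq0 b : (scard b == 0) = (b == sempty).
Proof. by rewrite -(sclass_cl b) scard_cl cards_eq0 cl_eq1. Qed.

Section SplitAlgebra.
Variables (T : finType) (P : sposet T).
Implicit Types A I J S : {set T}.

Lemma mulrel0l S : mulrel P set0 S.
Proof. by split=> x y; rewrite inE. Qed.

Lemma mulrel0r S : mulrel P S set0.
Proof. by split=> x y _; rewrite inE. Qed.

Lemma nwrel0l S : nwrel P set0 S.
Proof. by split=> x y; rewrite inE. Qed.

Lemma nwrel0r S : nwrel P S set0.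
Proof. by split=> x y _; rewrite inE. Qed.

Lemma mulrelUl S1 S2 S3 :
  mulrel P (S1 :|: S2) S3 <-> mulrel P S1 S3 /\ mulrel P S2 S3.
Proof.
split=> [m|[[b1 m1] [b2 m2]]].
  by split; apply: sub_mulrel m => //; [apply: subsetUl | apply: subsetUr].
by split=> x y; rewrite inE => /orP[|] x12 y3; auto.
Qed.

Lemma mulrelUr S1 S2 S3 :
  mulrel P S1 (S2 :|: S3) <-> mulrel P S1 S2 /\ mulrel P S1 S3.
Proof.
split=> [m|[[b1 m1] [b2 m2]]].
  by split; apply: sub_mulrel m => //; [apply: subsetUl | apply: subsetUr].
by split=> x y x1; rewrite inE => /orP[|] y23; auto.
Qed.

Lemma before_max S1 S2 g : before P S1 S2 -> S2 != set0 ->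
  (g \in S1 :|: S2 /\ forall z, z \in S1 :|: S2 -> le2 P z g) <->
  (g \in S2 /\ forall z, z \in S2 -> le2 P z g).
Proof.
move=> b12 /set0Pn[t t2]; split=> [[]|[g2 gm]].
  rewrite inE => /orP[g1|g2] gm.
    by have := before_le2 b12 g1 t2; rewrite gm // inE t2 orbT.
  by split=> // z z2; apply: gm; rewrite inE z2 orbT.
split=> [|z]; first by rewrite inE g2 orbT.
by rewrite inE => /orP[z1|]; [case/andP: (b12 _ _ z1 g2) | apply: gm].
Qed.

(** A nonempty part at the end contains the greatest element. *)
Lemma belowU S1 S2 x : before P S1 S2 -> S2 != set0 ->
  below P (S1 :|: S2) x <-> below P S2 x.
Proof.
by move=> b12 n2; split=> -[g /(before_max g b12 n2)]; exists g.
Qed.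

(** Associativity of grafting: when [S2] is not empty, the greatest elements of [S2] and
    of [S1 :|: S2] agree, so that elements of [S1] are below the same elements of
    [S3] for both bracketings. *)
Lemma nwrelA S1 S2 S3 :
  nwrel P S1 (S2 :|: S3) -> nwrel P S2 S3 ->
  nwrel P S1 S2 /\ nwrel P (S1 :|: S2) S3.
Proof.
move=> [b1 m1] [b2 m2]; split; split.
- by apply: sub_before b1; rewrite ?subsetUl.
- by move=> x y x1 y2; apply: m1; rewrite // inE y2.
- move=> x y; rewrite inE => /orP[x1|x2] y3; last exact: b2.
  by apply: b1; rewrite // inE y3 orbT.
have b12 : before P S1 S2 by apply: sub_before b1; rewrite ?subsetUl.
move=> x y; rewrite inE => /orP[x1|x2] y3; last first.
  have [h nyx] := m2 _ _ x2 y3; split=> //; rewrite h belowU //.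
  by apply/set0Pn; exists x.
have [|h nyx] := m1 x y x1; first by rewrite inE y3 orbT.
split=> //; rewrite h.
have [->|n2] := eqVneq S2 set0; first by rewrite setU0.
rewrite belowU //; have [g g2 gm] := max_exists P n2.
have [|hg _] := m1 x g x1; first by rewrite inE g2.
split=> [bx|[g' [g'2 g'm] xg']]; first by exists g => //; apply/hg.
by have [|/iffLR hg' _] := m1 x g' x1; [rewrite inE g'2 | apply: hg'].
Qed.

(** [S2] must be nonempty: grafting on a product grafts on the greatest element of its
    last factor. *)
Lemma mul_nwrel S1 S2 S3 : S2 != set0 ->
  mulrel P S1 (S2 :|: S3) -> nwrel P S2 S3 ->
  mulrel P S1 S2 /\ nwrel P (S1 :|: S2) S3.
Proof.
move=> n2 /mulrelUr[[b12 m12] [b13 m13]] [b2 m2]; split=> //; split.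
  by move=> x y; rewrite inE => /orP[x1|x2] y3; [apply: b13 | apply: b2].
move=> x y; rewrite inE => /orP[x1|x2] y3; last first.
  by have [h nyx] := m2 _ _ x2 y3; split=> //; rewrite h belowU.
have /andP[/negbTE-> ->] := m13 _ _ x1 y3; split=> //; split=> //.
rewrite belowU // => -[g [g2 _] xg].
by have /andP[] := m12 _ _ x1 g2; rewrite xg.
Qed.

(** Lower sets of the second order form a chain, which is why two decompositions of the
    same poset are nested. *)
Definition lower A S : Prop :=
  S \subset A /\ forall x y, x \in A -> y \in S -> le2 P x y -> x \in S.

Lemma before_lower S1 S2 : before P S1 S2 -> lower (S1 :|: S2) S1.
Proof.
move=> b12; split=> [|x y]; first exact: subsetUl.
by rewrite inE => /orP[//|x2] y1; rewrite (before_le2 b12).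
Qed.

Lemma lower_subset A S S' : lower A S -> lower A S' -> #|S| <= #|S'| -> S \subset S'.
Proof.
move=> [sA lS] [sA' lS'] cS; apply/subsetP=> x xS; apply/negPn/negP => xS'.
suff: S' \subset S.
  move=> sS'; have: S' \proper S by apply/properP; split=> //; exists x.
  by move/proper_card; rewrite ltnNge cS.
apply/subsetP=> y yS'; have yA := subsetP sA' _ yS'; have xA := subsetP sA _ xS.
have /orP[yx|xy] := sposet_total P y x; first exact: lS yx.
by rewrite (lS' x y) in xS'.
Qed.

(** Two decompositions along the second order have a common refinement, in which [C] is
    the middle part. *)
Lemma lower_cut S1 S2 S1' S2' : before P S1 S2 -> before P S1' S2' ->
  S1 :|: S2 = S1' :|: S2' -> #|S1| <= #|S1'| ->
  exists C, [/\ S1 :|: C = S1', C :|: S2' = S2 & before P S1 C].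
Proof.
move=> b b' eS c.
have s1 : S1 \subset S1'.
  by apply: lower_subset c; [apply: before_lower b | rewrite eS; apply: before_lower].
have d := before_disjoint b; have d' := before_disjoint b'.
have sC : S1' :\: S1 \subset S2.
  apply/subsetP=> x; rewrite inE => /andP[/negbTE n1 x1].
  by have : x \in S1 :|: S2; [rewrite eS inE x1 | rewrite inE n1].
exists (S1' :\: S1); split.
- by rewrite -[RHS](setID S1' S1) (setIidPr s1).
- apply/eqP; rewrite eqEsubset subUset sC /=; apply/andP; split.
    apply/subsetP=> x x2; have: x \in S1 :|: S2 by rewrite eS inE x2 orbT.
    rewrite inE => /orP[/(subsetP s1) x1|//].
    by have /pred0P/(_ x) := d'; rewrite /= x1 x2.
  apply/subsetP=> x x2; rewrite !inE.
  have : x \in S1' :|: S2' by rewrite -eS inE x2 orbT.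
  rewrite inE => /orP[->|->]; last by rewrite orbT.
  case x1: (x \in S1) => //; have /pred0P/(_ x) := d.
  by rewrite /= x1 x2.
- exact: sub_before b.
Qed.

End SplitAlgebra.

Lemma mulcA : associative mulc.
Proof.
move=> a b c; have [T [P [S1 [S' [m1 <- e' ->]]]]] := mulc_ex a (mulc b c).
have [S2 [S3 [eS m2 <- <-]]] := mulc_split e'; rewrite -{}eS in m1 *.
have /mulrelUr[m12 m13] := m1.
by rewrite setUA cl_mulrel ?cl_mulrel //; apply/mulrelUl.
Qed.

Lemma nwcA : associative nwc.
Proof.
move=> a b c; have [T [P [S1 [S' [m1 <- e' ->]]]]] := nwc_ex a (nwc b c).
have [S2 [S3 [eS m2 <- <-]]] := nwc_split e'; rewrite -{}eS in m1 *.
have [m12 m13] := nwrelA m1 m2.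
by rewrite setUA !cl_nwrel.
Qed.

Lemma mulc_nwc a b c : b != sempty -> nwc (mulc a b) c = mulc a (nwc b c).
Proof.
have [T [P [S1 [S' [m1 <- e' ->]]]]] := mulc_ex a (nwc b c).
have [S2 [S3 [eS m2 <- <-]]] := nwc_split e'; rewrite -{}eS in m1 *.
rewrite cl_eq1 => /mul_nwrel/(_ m1 m2)[m12 m13].
by rewrite setUA cl_nwrel ?cl_mulrel.
Qed.

Lemma mulc1l : left_id sempty mulc.
Proof.
move=> a; have e0 : cl (srep a) set0 = sempty by apply/eqP; rewrite cl_eq1.
by have := cl_mulrel (mulrel0l (srep a) setT); rewrite set0U sclass_cl e0.
Qed.

Lemma mulc1r : right_id sempty mulc.
Proof.
move=> a; have e0 : cl (srep a) set0 = sempty by apply/eqP; rewrite cl_eq1.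
by have := cl_mulrel (mulrel0r (srep a) setT); rewrite setU0 sclass_cl e0.
Qed.

Lemma nwc1l : left_id sempty nwc.
Proof.
move=> a; have e0 : cl (srep a) set0 = sempty by apply/eqP; rewrite cl_eq1.
by have := cl_nwrel (nwrel0l (srep a) setT); rewrite set0U sclass_cl e0.
Qed.

Lemma nwc1r : right_id sempty nwc.
Proof.
move=> a; have e0 : cl (srep a) set0 = sempty by apply/eqP; rewrite cl_eq1.
by have := cl_nwrel (nwrel0r (srep a) setT); rewrite setU0 sclass_cl e0.
Qed.

(** With [nwc_eq] and [mulc_nwc_eq], these are the only coincidences between products:
    they come from the common refinement of two decompositions. *)
Lemma mulc_eq a b a' b' : mulc a b = mulc a' b' -> scard a <= scard a' ->
  exists2 c, a' = mulc a c & b = mulc c b'.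
Proof.
have [T [P [S1 [S2 [m <- <- ->]]]]] := mulc_ex a b.
move=> /mulc_split[S1' [S2' [eS m' <- <-]]]; rewrite !scard_cl => c.
have [C [e1 e2 bC]] := lower_cut m.1 m'.1 (esym eS) c.
exists (cl P C); rewrite -?e1 -?e2 cl_mulrel //.
  by apply: sub_mulrel m => //; rewrite -e2 subsetUl.
by apply: sub_mulrel m' => //; rewrite -e1 subsetUr.
Qed.

Lemma nwrel_cut (T : finType) (P : sposet T) S1 C S2 :
  before P S1 C -> nwrel P (S1 :|: C) S2 -> nwrel P C S2.
Proof.
move=> bC [b m]; split=> [|x y xC y2].
  by apply: sub_before b => //; apply: subsetUr.
have [|h ->] := m x y _ y2; first by rewrite inE xC orbT.
by split=> //; rewrite h belowU //; apply/set0Pn; exists x.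
Qed.

Lemma nwc_eq a b a' b' : nwc a b = nwc a' b' -> scard a <= scard a' ->
  exists2 c, a' = nwc a c & b = nwc c b'.
Proof.
have [T [P [S1 [S2 [m <- <- ->]]]]] := nwc_ex a b.
move=> /nwc_split[S1' [S2' [eS m' <- <-]]]; rewrite !scard_cl => c.
have [C [e1 e2 bC]] := lower_cut m.1 m'.1 (esym eS) c.
exists (cl P C); rewrite -?e1 -?e2 cl_nwrel //.
  split=> // x y x1 yC; apply: m.2 => //; rewrite -e2 inE yC //.
by apply: nwrel_cut bC _; rewrite e1.
Qed.

Lemma mulc_nwc_eq a b a' b' : a' != sempty -> b != sempty -> b' != sempty ->
  mulc a b = nwc a' b' ->
  exists c, [/\ c != sempty, a' = mulc a c & b = nwc c b'].
Proof.
have [T [P [S1 [S2 [m <- <- ->]]]]] := mulc_ex a b.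
move=> a'n bn b'n /nwc_split[S1' [S2' [eS m' ea' eb']]].
rewrite -{}ea' -{}eb' !cl_eq1 in a'n bn b'n *.
have [g g1 gm] := max_exists P a'n; have [t t2] := set0Pn _ bn.
have gb : below P S1' g by exists g => //; apply: le1_refl.
(* The greatest element g of the left part of the grafting is below everything
   on its right, whereas elements of S1 and S2 are incomparable; so g is in
   S2, and S1 is the smaller of the lower sets S1 and S1'. *)
have gS2 : g \in S2.
  have : g \in S1 :|: S2 by rewrite -eS inE g1.
  rewrite inE => /orP[gS1|//]; have /andP[ngt ntg] := m.2 _ _ gS1 t2.
  have : t \in S1' :|: S2' by rewrite eS inE t2 orbT.
  rewrite inE => /orP[t1|t2'].
    have /andP[gt nt] := m.1 _ _ gS1 t2.
    by case/negP: nt; apply/eqP/(@le2_anti _ P) => //; apply: gm.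
  by have [/iffRL/(_ gb) gt _] := m'.2 _ _ g1 t2'; rewrite gt in ngt.
have c : #|S1| <= #|S1'|.
  rewrite leqNgt; apply/negP=> /ltnW c.
  have /subsetP s : S1' \subset S1.
    apply: lower_subset c; last exact: before_lower m.1.
    by rewrite -eS; apply: before_lower m'.1.
  have /pred0P/(_ g) := before_disjoint m.1.
  by rewrite /= gS2 s.
have [C [e1 e2 bC]] := lower_cut m.1 m'.1 (esym eS) c.
exists (cl P C); rewrite cl_eq1; split.
- apply: contraTneq g1 => C0; rewrite -e1 C0 setU0; apply/negP=> gS1.
  by have /pred0P/(_ g) := before_disjoint m.1; rewrite /= gS2 gS1.
- by rewrite -e1 cl_mulrel //; apply: sub_mulrel m => //; rewrite -e2 subsetUl.
- by rewrite -e2 cl_nwrel //; apply: nwrel_cut bC _; rewrite e1.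
Qed.

Section CutSums.
Variables (T : finType) (P : sposet T).
Implicit Types A I J S : {set T}.

Lemma big_setU S1 S2 (c : pred {set T}) (F : {set T} -> nat) :
  [disjoint S1 & S2] ->
  \sum_(I : {set T} | (I \subset S1 :|: S2) && c I) F I =
  \sum_(p : {set T} * {set T} |
      [&& p.1 \subset S1, p.2 \subset S2 & c (p.1 :|: p.2)]) F (p.1 :|: p.2).
Proof.
move=> d12; rewrite (reindex_onto (fun p : {set T} * {set T} => p.1 :|: p.2)
  (fun I => (I :&: S1, I :&: S2))) /=; last first.
  by move=> I /andP[sI _]; rewrite -setIUr; apply/setIidPl.
apply: eq_bigl => -[I1 I2] /=; rewrite xpair_eqE.
apply/andP/and3P => [[/andP[sI ->] /andP[/eqP e1 /eqP e2]]|[s1 s2 ->]].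
  by split=> //; [rewrite -e1 | rewrite -e2]; apply: subsetIr.
split; first by rewrite andbT setUSS.
rewrite !setIUl (setIidPl s1) (setIidPl s2); apply/andP; split; apply/eqP.
  rewrite (_ : I2 :&: S1 = set0) ?setU0 //; apply/eqP; rewrite setI_eq0.
  by apply: disjointWl s2 _; rewrite disjoint_sym.
rewrite (_ : I1 :&: S2 = set0) ?set0U //; apply/eqP; rewrite setI_eq0.
exact: disjointWl s1 _.
Qed.

Lemma idealin_sub A I : idealin P A I -> I \subset A.
Proof. by case/andP. Qed.

Lemma topinU S1 S2 I1 I2 : before P S1 S2 -> I1 \subset S1 -> I2 \subset S2 ->
  topin P (S1 :|: S2) (I1 :|: I2) =
  if S2 == set0 then topin P S1 I1 else topin P S2 I2.
Proof.
move=> b12 s1 s2; have [S20|n2] := eqVneq S2 set0.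
  by move: s2; rewrite S20 subset0 => /eqP->; rewrite !setU0.
have [g g2 gm] := max_exists P n2.
have [gU gmU] : g \in S1 :|: S2 /\ forall z, z \in S1 :|: S2 -> le2 P z g.
  exact/(before_max g b12 n2).
rewrite (topE gU gmU) ?setUSS // (topE g2 gm) // inE orbC.
case: (g \in I2) => //=; apply/negP=> /(subsetP s1) g1.
by have /pred0P/(_ g) := before_disjoint b12; rewrite /= g1 g2.
Qed.

Lemma topin0 A : topin P A set0 = false.
Proof. by apply/topinP=> -[g]; rewrite inE. Qed.

Lemma topin_full A : A != set0 -> topin P A A.
Proof. by case/(max_exists P)=> g gA gm; apply/topinP; exists g. Qed.

Lemma idealin_mul S1 S2 I1 I2 : mulrel P S1 S2 ->
  I1 \subset S1 -> I2 \subset S2 ->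
  idealin P (S1 :|: S2) (I1 :|: I2) = idealin P S1 I1 && idealin P S2 I2.
Proof.
move=> [b12 m] s1 s2; have d := before_disjoint b12.
have no x : x \in S1 -> x \in S2 -> false.
  by move=> x1 x2; have /pred0P/(_ x) := d; rewrite /= x1 x2.
apply/idealinP/andP=> [[sI h]|[/idealinP[_ h1] /idealinP[_ h2]]].
  split; apply/idealinP; split=> // x y xI yS xy.
    have := h x y; rewrite !inE xI yS => /(_ isT isT xy)/orP[//|/(subsetP s2)].
    by move/(no _ yS).
  have := h x y; rewrite !inE xI yS !orbT => /(_ isT isT xy)/orP[|//].
  by move/(subsetP s1)/no => /(_ yS).
split; first exact: setUSS.
move=> x y; rewrite !inE => /orP[xI|xI] /orP[yS|yS] xy.
- by rewrite (h1 x).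
- by have /andP[] := m _ _ (subsetP s1 _ xI) yS; rewrite xy.
- by have /andP[_] := m _ _ yS (subsetP s2 _ xI); rewrite xy.
- by rewrite (h2 x) ?orbT.
Qed.

Lemma below_topin S I : idealin P S I -> forall x, x \in I -> below P S x -> topin P S I.
Proof.
case/idealinP=> sI h x xI [g [gS gm] xg]; apply/topinP; exists g => //.
exact: h xg.
Qed.

(** If an ideal of the left part contains its greatest element, the ideal contains
    everything grafted on it. *)
Lemma idealin_nw S1 S2 I1 I2 : nwrel P S1 S2 ->
  I1 \subset S1 -> I2 \subset S2 ->
  idealin P (S1 :|: S2) (I1 :|: I2) =
  [&& idealin P S1 I1, idealin P S2 I2 & topin P S1 I1 ==> (I2 == S2)].
Proof.
move=> [b12 m] s1 s2; have d := before_disjoint b12.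
have no x : x \in S1 -> x \in S2 -> false.
  by move=> x1 x2; have /pred0P/(_ x) := d; rewrite /= x1 x2.
apply/idealinP/and3P=> [[sI h]|[i1 /idealinP[_ h2] ht]].
  split.
  - apply/idealinP; split=> // x y xI yS xy.
    have := h x y; rewrite !inE xI yS => /(_ isT isT xy)/orP[//|/(subsetP s2)].
    by move/(no _ yS).
  - apply/idealinP; split=> // x y xI yS xy.
    have := h x y; rewrite !inE xI yS !orbT => /(_ isT isT xy)/orP[|//].
    by move/(subsetP s1)/no => /(_ yS).
  apply/implyP=> /topinP[g gI gm]; rewrite eqEsubset s2; apply/subsetP=> y yS.
  have gS := subsetP s1 _ gI.
  have gy : le1 P g y.
    by apply/(m _ _ gS yS).1; exists g => //; apply: le1_refl.
  have := h g y; rewrite !inE gI yS !orbT => /(_ isT isT gy)/orP[|//].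
  by move/(subsetP s1)/no/(_ yS).
have /idealinP[_ h1] := i1; split; first exact: setUSS.
move=> x y; rewrite !inE => /orP[xI|xI] /orP[yS|yS] xy.
- by rewrite (h1 x).
- have [/iffLR/(_ xy) bx _] := m _ _ (subsetP s1 _ xI) yS.
  by have := below_topin i1 xI bx; move/implyP: ht => ht /ht/eqP->; rewrite yS orbT.
- by have [_] := m _ _ yS (subsetP s2 _ xI); rewrite xy.
- by rewrite (h2 x) ?orbT.
Qed.

Lemma setDUU S1 S2 I1 I2 : [disjoint S1 & S2] -> I1 \subset S1 -> I2 \subset S2 ->
  (S1 :|: S2) :\: (I1 :|: I2) = (S1 :\: I1) :|: (S2 :\: I2).
Proof.
move=> d /subsetP s1 /subsetP s2; apply/setP=> x; rewrite !inE.
have /implyP := s1 x; have /implyP := s2 x; have /pred0P/(_ x) /= := d.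
by case: (x \in S1); case: (x \in S2); case: (x \in I1); case: (x \in I2).
Qed.

Lemma cutsum_mul S1 S2 s (F : spclass * spclass -> nat) :
  mulrel P S1 S2 -> S2 != set0 ->
  cutsum P s (S1 :|: S2) F =
  \sum_(I1 | idealin P S1 I1) \sum_(I2 | idealin P S2 I2 && (topin P S2 I2 == s))
    F (mulc (cl P (S1 :\: I1)) (cl P (S2 :\: I2)), mulc (cl P I1) (cl P I2)).
Proof.
move=> m n2; have d := before_disjoint m.1.
rewrite pair_big_dep /cutsum.
rewrite (eq_bigl (fun I : {set T} => (I \subset S1 :|: S2) && (idealin P (S1 :|: S2) I
          && (topin P (S1 :|: S2) I == s)))); last first.
  by move=> I; case iI : (idealin _ _ I); rewrite ?andbF //= (idealin_sub iI).
rewrite (big_setU _ _ d); apply: eq_big => [[I1 I2]|[I1 I2] /and3P[/= s1 s2 _]] /=.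
  case s1: (I1 \subset S1); last by rewrite /idealin s1.
  case s2: (I2 \subset S2); last by rewrite /idealin s2 /= andbF.
  by rewrite idealin_mul // (topinU m.1) // (negbTE n2) /= andbA.
by rewrite setDUU // !cl_mulrel //; apply: sub_mulrel m; rewrite ?subsetDl.
Qed.

(** A cut whose right part misses the greatest element of [S1] leaves that element on the
    left, where the grafting survives; on the right no element of [I1] is below it, so the
    parts are independent. *)
Lemma nwrel_topF S1 S2 I1 I2 : nwrel P S1 S2 -> idealin P S1 I1 ->
  I2 \subset S2 -> topin P S1 I1 = false ->
  nwrel P (S1 :\: I1) (S2 :\: I2) /\ mulrel P I1 I2.
Proof.
move=> [b12 m] i1 s2 t1; have s1 := idealin_sub i1; split; split.
- by apply: sub_before b12; apply: subsetDl.
- move=> x y; rewrite !inE => /andP[nxI xS] /andP[_ yS].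
  have [h nyx] := m _ _ xS yS; split=> //; rewrite h.
  have [g gS gm] : exists2 g, g \in S1 & forall z, z \in S1 -> le2 P z g.
    by apply: max_exists; apply/set0Pn; exists x.
  have gI : g \in S1 :\: I1 by rewrite inE gS -(topE gS gm s1) t1.
  split=> [[g' [g'S g'm] xg]|[g' [g'S g'm] xg]].
    exists g'; last by [].
    have -> : g' = g by apply: (@le2_anti _ P); [apply: gm | apply: g'm].
    by split=> // z; rewrite inE => /andP[_]; apply: gm.
  exists g'; last by [].
  have -> : g' = g.
    by apply: (@le2_anti _ P); [apply: gm; case/setDP: g'S | apply: g'm].
  by split.
- exact: sub_before b12.
move=> x y xI yI; have xS := subsetP s1 _ xI; have yS := subsetP s2 _ yI.
have [h ->] := m _ _ xS yS; rewrite andbT; apply/negP=> /h/(below_topin i1 xI).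
by rewrite t1.
Qed.

(** If [I1] contains the greatest element of [S1], it is the place where [S2] stays
    grafted. *)
Lemma nwrel_topT S1 S2 I1 : nwrel P S1 S2 -> idealin P S1 I1 ->
  topin P S1 I1 -> nwrel P I1 S2.
Proof.
move=> [b12 m] i1 /topinP[g gI gm]; have /subsetP s1 := idealin_sub i1; split.
  exact: sub_before (idealin_sub i1) (subxx _) b12.
move=> x y xI yS; have [h ->] := m _ _ (s1 _ xI) yS; split=> //; rewrite h.
split=> -[g' [g'I g'm] xg'].
  exists g; first by split=> // z /s1; apply: gm.
  by have -> // : g = g'; apply: (@le2_anti _ P); [apply: g'm; apply: s1 | apply: gm].
exists g'; last by []; split=> [|z zS]; first exact: s1.
by apply: le2_trans (gm z zS) (g'm _ gI).
Qed.

Lemma cutsum_nw_split S1 S2 s (F : spclass * spclass -> nat) :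
  nwrel P S1 S2 ->
  cutsum P s (S1 :|: S2) F =
  \sum_(p : {set T} * {set T} |
      [&& p.1 \subset S1, p.2 \subset S2 &
         [&& idealin P S1 p.1, idealin P S2 p.2 &
             topin P S1 p.1 ==> (p.2 == S2)]
         && (topin P (S1 :|: S2) (p.1 :|: p.2) == s)])
   F (cl P ((S1 :\: p.1) :|: (S2 :\: p.2)), cl P (p.1 :|: p.2)).
Proof.
move=> m; have d := before_disjoint m.1; rewrite /cutsum.
rewrite (eq_bigl (fun I : {set T} => (I \subset S1 :|: S2) && (idealin P (S1 :|: S2) I
          && (topin P (S1 :|: S2) I == s)))); last first.
  by move=> I; case iI : (idealin _ _ I); rewrite ?andbF //= (idealin_sub iI).
rewrite (big_setU _ _ d); apply: eq_big => [[I1 I2]|[I1 I2] /and3P[/= s1 s2 _]] /=.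
  case s1: (I1 \subset S1) => //; case s2: (I2 \subset S2) => //=.
  by rewrite idealin_nw.
by rewrite setDUU.
Qed.

(** If [I1] contained the greatest element of [S1], all of [S2] would be on the right and
    so would the greatest element of the whole. *)
Lemma cutsumF_nw S1 S2 (F : spclass * spclass -> nat) :
  nwrel P S1 S2 ->
  cutsum P false (S1 :|: S2) F =
  \sum_(I1 | idealin P S1 I1 && (topin P S1 I1 == false))
  \sum_(I2 | idealin P S2 I2 && (topin P S2 I2 == false))
    F (nwc (cl P (S1 :\: I1)) (cl P (S2 :\: I2)), mulc (cl P I1) (cl P I2)).
Proof.
move=> m; rewrite cutsum_nw_split // pair_big_dep.
apply: eq_big => [[I1 I2]|[I1 I2] /and4P[/= s1 s2]] /=.
  case s1: (I1 \subset S1); last by rewrite /idealin s1.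
  case s2: (I2 \subset S2); last by rewrite /idealin s2 /= !andbF.
  rewrite (topinU m.1) //=; case: (idealin P S1 I1) => //=.
  case: (idealin P S2 I2) => /=; last by rewrite andbF.
  have [S20|n2] := eqVneq S2 set0.
    move: s2; rewrite S20 subset0 => /eqP->; rewrite eqxx implybT topin0 /=.
    by rewrite andbT.
  case: (topin P S1 I1) => //=; rewrite ?eqxx //.
  by apply/negP=> /andP[/eqP->]; rewrite topin_full.
case/and3P=> i1 i2; have [S20|n2] := eqVneq S2 set0.
  rewrite (topinU m.1) // S20 eqxx => _ /eqP t1.
  have [m1 m2] := nwrel_topF m i1 s2 t1.
  by rewrite -S20 cl_nwrel // cl_mulrel.
case t1: (topin P S1 I1).
  by move=> /eqP->; rewrite (topinU m.1) // (negbTE n2) topin_full.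
move=> _ _; have [m1 m2] := nwrel_topF m i1 s2 t1.
by rewrite cl_nwrel // cl_mulrel.
Qed.

(** Either the greatest element of [S1] stays on the left, and the cuts are independent,
    or it goes to the right and takes [S2] with it. *)
Lemma cutsumT_nw S1 S2 (F : spclass * spclass -> nat) :
  nwrel P S1 S2 ->
  cutsum P true (S1 :|: S2) F =
  \sum_(I1 | idealin P S1 I1 && (topin P S1 I1 == false))
  \sum_(I2 | idealin P S2 I2 && (topin P S2 I2 == true))
    F (nwc (cl P (S1 :\: I1)) (cl P (S2 :\: I2)), mulc (cl P I1) (cl P I2))
  + \sum_(I1 | idealin P S1 I1 && (topin P S1 I1 == true))
      F (cl P (S1 :\: I1), nwc (cl P I1) (cl P S2)).
Proof.
move=> m; rewrite cutsum_nw_split // pair_big_dep.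
rewrite (bigID (fun p : {set T} * {set T} => topin P S1 p.1)) /= addnC; congr (_ + _).
  apply: eq_big => [[I1 I2]|[I1 I2] /andP[/and4P[/= s1 s2 /and3P[i1 i2 _] _] /negbTE t1]].
    case s1: (I1 \subset S1); last by rewrite /idealin s1.
    case s2: (I2 \subset S2); last by rewrite /idealin s2 /= !andbF.
    rewrite (topinU m.1) //=; case: (idealin P S1 I1) => //=.
    case: (topin P S1 I1) => //=; rewrite ?andbF //= !andbT.
    have [S20|n2] := eqVneq S2 set0 => //.
    by move: s2; rewrite S20 subset0 => /eqP->; rewrite topin0 /= !andbF.
  by have [m1 m2] := nwrel_topF m i1 s2 t1; rewrite cl_nwrel // cl_mulrel.
rewrite (reindex_onto (fun I1 => (I1, S2)) (fun p => p.1)) /=; last first.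
  move=> [I1 I2] /= /andP[/and4P[s1 s2 /and3P[i1 i2 h] _] t1].
  by move: h; rewrite t1 => /eqP->.
apply: eq_big => [I1|I1 /andP[/andP[/and4P[/= s1 s2 /and3P[i1 i2 _] _] t1] _]].
  case s1: (I1 \subset S1); last by rewrite /idealin s1.
  have -> : idealin P S2 S2 by apply/idealinP.
  rewrite (topinU m.1) // !eqxx implybT subxx !andbT !eqb_id /= -andbA.
  case: eqVneq => [S20|n2]; first by rewrite andbb.
  by rewrite topin_full.
by rewrite setDv setU0 (cl_nwrel (nwrel_topT m i1 t1)).
Qed.

Lemma big_supset I (c : pred {set T}) (F : {set T} -> nat) :
  (forall J, c J -> [disjoint I & J]) ->
  \sum_(J | c J) F J = \sum_(I1 : {set T} | (I \subset I1) && c (I1 :\: I)) F (I1 :\: I).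
Proof.
move=> cI; rewrite (reindex_onto (fun I1 : {set T} => I1 :\: I) (fun J => I :|: J)) /=.
  apply: eq_bigl => I1; rewrite andbC; congr (_ && _).
  apply/eqP/idP=> [<-|sI]; first exact: subsetUl.
  by rewrite -[RHS](setID I1 I) (setIidPr sI).
move=> J /cI d; rewrite setDUl setDv set0U; apply/setDidPl.
by rewrite disjoint_sym.
Qed.

End CutSums.

(** * The bialgebra structure of special posets, on lists of cuts *)

(** All the terms of Delta. *)
Definition acuts (b : spclass) : seq (spclass * spclass) :=
  cuts false b ++ cuts true b.

Lemma sum_acuts (T : finType) (P : sposet T) A (F : spclass * spclass -> nat) :
  \sum_(p <- acuts (cl P A)) F p =
  \sum_(I | idealin P A I) F (cl P (A :\: I), cl P I).
Proof.
rewrite /acuts big_cat /= !sum_cuts /cutsum [RHS](bigID (topin P A)) /= addnC.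
congr (_ + _); apply: eq_bigl => I; first by rewrite eqb_id.
by rewrite eqbF_neg.
Qed.

Lemma cuts_mulc s a b : b != sempty ->
  perm_eq (cuts s (mulc a b))
    [seq (mulc p.1 q.1, mulc p.2 q.2) | p <- acuts a, q <- cuts s b].
Proof.
have [T [P [S1 [S2 [m <- <- ->]]]]] := mulc_ex a b; rewrite cl_eq1 => n2.
apply: perm_eq_sum => F; rewrite big_allpairs_dep sum_cuts sum_acuts.
by rewrite cutsum_mul //; apply: eq_bigr => I _; rewrite sum_cuts.
Qed.

Lemma cutsF_nwc a b :
  perm_eq (cuts false (nwc a b))
    [seq (nwc p.1 q.1, mulc p.2 q.2) | p <- cuts false a, q <- cuts false b].
Proof.
have [T [P [S1 [S2 [m <- <- ->]]]]] := nwc_ex a b.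
apply: perm_eq_sum => F; rewrite big_allpairs_dep !sum_cuts cutsumF_nw //.
by apply: eq_bigr => I _; rewrite sum_cuts.
Qed.

Lemma cutsT_nwc a b :
  perm_eq (cuts true (nwc a b))
    ([seq (nwc p.1 q.1, mulc p.2 q.2) | p <- cuts false a, q <- cuts true b]
     ++ [seq (p.1, nwc p.2 b) | p <- cuts true a]).
Proof.
have [T [P [S1 [S2 [m <- <- ->]]]]] := nwc_ex a b.
apply: perm_eq_sum => F; rewrite sum_cuts cutsumT_nw // big_cat /=.
rewrite big_allpairs_dep [X in _ = _ + X]big_map !sum_cuts; congr (_ + _).
by apply: eq_bigr => I _; rewrite sum_cuts.
Qed.

Lemma scard_cuts s b p : p \in cuts s b -> scard p.1 + scard p.2 = scard b.
Proof.
case/mapP=> I _ ->; rewrite !scard_cl setTD addnC cardsC card_ord //.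
Qed.

Section Coassociativity.
Variables (T : finType) (P : sposet T).
Implicit Types I J : {set T}.

(** Cutting twice, in either order, amounts to choosing a chain of two ideals. *)
Lemma idealin_chain I1 I2 : I2 \subset I1 ->
  idealin P setT I2 && idealin P (setT :\: I2) (I1 :\: I2) =
  idealin P setT I1 && idealin P I1 I2.
Proof.
move=> s21; apply/andP/andP=> -[/idealinP[_ h1] /idealinP[sh h2]]; split.
- apply/idealinP; split=> // x y x1 _ xy.
  have [x2|x2] := boolP (x \in I2); first exact/(subsetP s21)/(h1 x).
  have [y2|y2] := boolP (y \in I2); first exact: (subsetP s21).
  by have := h2 x y; rewrite !inE x1 x2 y2 /=; apply.
- by apply/idealinP; split=> // x y x2 y1; apply: h1.
- by apply/idealinP; split=> // x y x2 _ xy; apply: (h2 x) => //; apply: (h1 x); rewrite ?(subsetP s21).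
- apply/idealinP; split=> [|x y]; first by rewrite setSD.
  by rewrite !inE => /andP[x2 x1] /andP[y2 _] xy; rewrite y2 (h1 x).
Qed.

(** Both sides of each coassociativity law are sums over the chains of two ideals; they
    differ by the positions required for the greatest elements, which [topin_chain]
    compares. *)
Lemma sum_chain_left s t (F : spclass * (spclass * spclass) -> nat) :
  \sum_(p <- cuts s (cl P setT)) \sum_(q <- cuts t p.1) F (q.1, (q.2, p.2)) =
  \sum_(p : {set T} * {set T} |
        [&& p.2 \subset p.1, idealin P setT p.1 && idealin P p.1 p.2 &
         (topin P setT p.2 == s) && (topin P (setT :\: p.2) (p.1 :\: p.2) == t)])
     F (cl P (setT :\: p.1), (cl P (p.1 :\: p.2), cl P p.2)).
Proof.
rewrite sum_cuts /cutsum; under eq_bigr => I iI.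
  rewrite sum_cuts /cutsum (@big_supset _ I); last first.
    move=> J /andP[/idealin_sub sJ _].
    by rewrite disjoint_sym disjoints_subset -setTD.
  over.
rewrite pair_big_dep /= (reindex_onto (fun p : {set T} * {set T} => (p.2, p.1))
  (fun p => (p.2, p.1))) /=; last by case.
apply: eq_big => [[I1 I2]|[I1 I2] /andP[/and3P[/= _ s21 _] _]] /=.
  rewrite eqxx andbT; case s21: (I2 \subset I1); last by rewrite andbF.
  rewrite -(idealin_chain s21) /=.
  by case: (idealin P setT I2); case: (topin P setT I2 == s); rewrite ?andbF.
rewrite setDDl; congr (F (cl P (_ :\: _), _)).
by rewrite -{2}(setID I1 I2) (setIidPr s21).
Qed.

Lemma sum_chain_right s t (F : spclass * (spclass * spclass) -> nat) :
  \sum_(p <- cuts s (cl P setT)) \sum_(q <- cuts t p.2) F (p.1, (q.1, q.2)) =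
  \sum_(p : {set T} * {set T} |
        [&& p.2 \subset p.1, idealin P setT p.1 && idealin P p.1 p.2 &
         (topin P setT p.1 == s) && (topin P p.1 p.2 == t)])
     F (cl P (setT :\: p.1), (cl P (p.1 :\: p.2), cl P p.2)).
Proof.
rewrite sum_cuts /cutsum; under eq_bigr => I iI do rewrite sum_cuts /cutsum.
rewrite pair_big_dep /=; apply: eq_bigl => -[I1 I2] /=.
case s21: (I2 \subset I1); last by rewrite /idealin s21 /= andbF.
by case: (idealin P setT I1); case: (topin P setT I1 == s); rewrite ?andbF.
Qed.

Lemma topin_chain I1 I2 : I2 \subset I1 ->
  if topin P setT I2 then topin P I1 I2 && topin P setT I1
  else (topin P (setT :\: I2) (I1 :\: I2) == topin P setT I1) &&
       (topin P setT I1 ==> ~~ topin P I1 I2).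
Proof.
move=> s21; have [T0|nT] := eqVneq (setT : {set T}) set0.
  have no (J : {set T}) : J = set0.
    by apply/setP=> x; have := in_setT x; rewrite T0 inE.
  by rewrite T0 (no I1) (no I2) !(no (_ :\: _)) topin0.
have [g gT gm] := max_exists P nT.
rewrite !(topE gT gm) ?subsetT //; case: ifP => g2.
  have g1 := subsetP s21 _ g2.
  by rewrite g1 andbT (topE g1) // => z _; apply: gm.
have gD : g \in setT :\: I2 by rewrite inE g2.
rewrite (topE gD) ?setSD ?subsetT // => [|z _]; last exact: gm.
rewrite inE g2 eqxx /=; apply/implyP=> g1.
by rewrite (topE g1) ?g2 // => z _; apply: gm.
Qed.

End Coassociativity.

Lemma coassFF b :
  perm_eq [seq (q.1, (q.2, p.2)) | p <- cuts false b, q <- cuts false p.1]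
          [seq (p.1, (q.1, q.2)) | p <- cuts false b, q <- acuts p.2].
Proof.
apply: perm_eq_sum => F; rewrite !big_allpairs_dep -(sclass_cl b).
rewrite sum_chain_left; under [RHS]eq_bigr => p _ do rewrite /acuts big_cat.
rewrite big_split /= !sum_chain_right [LHS](bigID (fun p => topin (srep b) p.1 p.2)) /= addnC.
congr (_ + _); apply: eq_bigl => -[I1 I2] /=; case s21: (I2 \subset I1) => //=.
  case: (idealin (srep b) _ I1 && _) => //=; move: (topin_chain (srep b) s21).
  by case: (topin _ setT I2); case: (topin _ setT I1); case: (topin _ I1 I2);
     case: (topin (srep b) (setT :\: I2) (I1 :\: I2)).
case: (idealin (srep b) _ I1 && _) => //=; move: (topin_chain (srep b) s21).
by case: (topin _ setT I2); case: (topin _ setT I1); case: (topin _ I1 I2);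
   case: (topin (srep b) (setT :\: I2) (I1 :\: I2)).
Qed.

Lemma coassTF b :
  perm_eq [seq (q.1, (q.2, p.2)) | p <- cuts false b, q <- cuts true p.1]
          [seq (p.1, (q.1, q.2)) | p <- cuts true b, q <- cuts false p.2].
Proof.
apply: perm_eq_sum => F; rewrite !big_allpairs_dep -(sclass_cl b).
rewrite sum_chain_left sum_chain_right.
apply: eq_bigl => -[I1 I2] /=; case s21: (I2 \subset I1) => //=.
case: (idealin (srep b) _ I1 && _) => //=; move: (topin_chain (srep b) s21).
by case: (topin _ setT I2); case: (topin _ setT I1); case: (topin _ I1 I2);
   case: (topin (srep b) (setT :\: I2) (I1 :\: I2)).
Qed.

Lemma coassTT b :
  perm_eq [seq (q.1, (q.2, p.2)) | p <- cuts true b, q <- acuts p.1]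
          [seq (p.1, (q.1, q.2)) | p <- cuts true b, q <- cuts true p.2].
Proof.
apply: perm_eq_sum => F; rewrite !big_allpairs_dep -(sclass_cl b).
under eq_bigr => p _ do rewrite /acuts big_cat.
rewrite big_split /= !sum_chain_left sum_chain_right.
rewrite [RHS](bigID (fun p => topin (srep b) (setT :\: p.2) (p.1 :\: p.2))) /= addnC.
congr (_ + _); apply: eq_bigl => -[I1 I2] /=; case s21: (I2 \subset I1) => //=.
  case: (idealin (srep b) _ I1 && _) => //=; move: (topin_chain (srep b) s21).
  by case: (topin _ setT I2); case: (topin _ setT I1); case: (topin _ I1 I2);
     case: (topin (srep b) (setT :\: I2) (I1 :\: I2)).
case: (idealin (srep b) _ I1 && _) => //=; move: (topin_chain (srep b) s21).
by case: (topin _ setT I2); case: (topin _ setT I1); case: (topin _ I1 I2);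
   case: (topin (srep b) (setT :\: I2) (I1 :\: I2)).
Qed.

(** * Closure of the families *)

Section FamilyOn.
Variables (T : finType) (P : sposet T).
Implicit Types A S : {set T}.

Definition heap_on A : Prop :=
  forall x y, x \in A -> y \in A -> le1 P x y -> le2 P x y.

Definition forest_on A : Prop :=
  forall x y z, x \in A -> y \in A -> z \in A -> le1 P x z -> le1 P y z ->
    le1 P x y || le1 P y x.

(** Plane posets without the right order: [plane_right] and [plane_ofP] show that a
    special poset arises from a plane poset iff its orders satisfy these conditions. The
    second one is the transitivity of the right order. *)
Definition plane_on A : Prop :=
  heap_on A /\
  forall x y z, x \in A -> y \in A -> z \in A -> le2 P x y -> le2 P y z ->
    le1 P x z -> le1 P x y || le1 P y z.

(** Avoidance of [N]: it occurs as a double subposet of the plane poset iff it embeds for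
    the first order and the total order, because the total order of both forbidden posets
    is the usual order of their vertices ([le_N]). *)
Definition free_on (N : dposet 'I_4) A : Prop :=
  forall e : 'I_4 -> T, (forall i, e i \in A) ->
    (forall i j, le1 P (e i) (e j) = le1 N i j) ->
    (forall i j, le2 P (e i) (e j) = (i <= j)) -> False.

(** Membership in a family, relative to a subset of the ambient poset; see
    [in_family_cl]. *)
Definition family_on (X : poset_family) A : Prop :=
  match X with
  | SP => True
  | HOP => heap_on A
  | SPP => plane_on A
  | OF => forest_on A
  | HOF => heap_on A /\ forest_on A
  | SWNP => plane_on A /\ free_on N1 A /\ free_on N2 A
  | SPF => forest_on A /\ plane_on A
  end.

Lemma family_on_sub X A S : A \subset S -> family_on X S -> family_on X A.
Proof.
move=> /subsetP sAS.
have h : heap_on S -> heap_on A by move=> hS x y /sAS xS /sAS; apply: hS.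
have f : forest_on S -> forest_on A.
  by move=> fS x y z /sAS xS /sAS yS /sAS; apply: fS.
have p : plane_on S -> plane_on A.
  by case=> /h hA pS; split=> // x y z /sAS xS /sAS yS /sAS; apply: pS.
have n N : free_on N S -> free_on N A.
  by move=> nS e eA; apply: nS => i; apply: sAS.
by case: X => //=; [move=> [/h ? /f ?]|move=> [/p ? [/n ? /n ?]]|move=> [/f ? /p ?]].
Qed.

(** Comparisons with the grafted part are replaced by comparisons with one element of
    [S1], so that closure under grafting follows from the conditions on [S1]. *)
Lemma nw_top S1 S2 x y : nwrel P S1 S2 -> x \in S1 -> y \in S2 ->
  exists g, [/\ g \in S1, forall z, z \in S1 -> le2 P z g,
    forall z t, z \in S1 -> t \in S2 -> le1 P z t = le1 P z g &
    forall z t, z \in S1 -> t \in S2 -> le1 P t z = false].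
Proof.
move=> [b m] x1 y2; have [g g1 gm] : exists2 g, g \in S1 & forall z, z \in S1 -> le2 P z g.
  by apply: max_exists; apply/set0Pn; exists x.
exists g; split=> // z t z1 t2; have [h nle] := m _ _ z1 t2; last exact: negbTE.
apply/idP/idP => [/h[g' [g'1 g'm] zg']|zg]; last by apply/h; exists g.
by have -> : g = g' by apply: (@le2_anti _ P); [apply: g'm | apply: gm].
Qed.

Lemma heap_mul S1 S2 : mulrel P S1 S2 -> heap_on S1 -> heap_on S2 ->
  heap_on (S1 :|: S2).
Proof.
move=> [b m] h1 h2 x y; rewrite !inE => /orP[x1|x2] /orP[y1|y2];
  try by [apply: h1 | apply: h2].
  by have /andP[-> _] := b _ _ x1 y2.
by have /andP[_ /negbTE->] := m _ _ y1 x2.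
Qed.

Lemma heap_nw S1 S2 : nwrel P S1 S2 -> heap_on S1 -> heap_on S2 ->
  heap_on (S1 :|: S2).
Proof.
move=> [b m] h1 h2 x y; rewrite !inE => /orP[x1|x2] /orP[y1|y2];
  try by [apply: h1 | apply: h2].
  by have /andP[-> _] := b _ _ x1 y2.
by have [_ /negbTE->] := m _ _ y1 x2.
Qed.

Lemma forest_mul S1 S2 : mulrel P S1 S2 -> forest_on S1 -> forest_on S2 ->
  forest_on (S1 :|: S2).
Proof.
move=> [b m] h1 h2 x y z.
have no x' y' : x' \in S1 -> y' \in S2 -> le1 P x' y' = false.
  by move=> x1 y2; have /andP[/negbTE-> _] := m _ _ x1 y2.
have on x' y' : x' \in S1 -> y' \in S2 -> le1 P y' x' = false.
  by move=> x1 y2; have /andP[_ /negbTE->] := m _ _ x1 y2.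
rewrite !inE => /orP[x1|x2] /orP[y1|y2] /orP[z1|z2];
  try by [apply: h1 | apply: h2].
- by rewrite (no x z).
- by rewrite (on z y).
- by rewrite (no x z).
- by rewrite (on z x).
- by rewrite (no y z).
- by rewrite (on z x).
Qed.

Lemma forest_nw S1 S2 : nwrel P S1 S2 -> forest_on S1 -> forest_on S2 ->
  forest_on (S1 :|: S2).
Proof.
move=> r h1 h2 x y z; rewrite !inE.
have no x' y' : x' \in S1 -> y' \in S2 -> le1 P y' x' = false.
  by move=> x1 y2; have [_ /negbTE->] := r.2 _ _ x1 y2.
move=> /orP[x1|x2] /orP[y1|y2] /orP[z1|z2];
  try by [apply: h1 | apply: h2].
- have [g [g1 gm E _]] := nw_top r x1 z2; rewrite (E x z) // (E y z) //.
  exact: h1.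
- by rewrite (no z y).
- have [g [g1 gm E _]] := nw_top r x1 z2; rewrite (E x z) // (E x y) // => ->.
  by [].
- by rewrite (no z x).
- have [g [g1 gm E _]] := nw_top r y1 z2; rewrite (E y z) // (E y x) // => _ ->.
  by rewrite orbT.
- by rewrite (no z x).
Qed.

Lemma plane_mul S1 S2 : mulrel P S1 S2 -> plane_on S1 -> plane_on S2 ->
  plane_on (S1 :|: S2).
Proof.
move=> r [h1 p1] [h2 p2]; split; first exact: heap_mul.
have [b m] := r.
have no x' y' : x' \in S1 -> y' \in S2 -> le1 P x' y' = false.
  by move=> x1 y2; have /andP[/negbTE-> _] := m _ _ x1 y2.
have on x' y' : x' \in S1 -> y' \in S2 -> le1 P y' x' = false.
  by move=> x1 y2; have /andP[_ /negbTE->] := m _ _ x1 y2.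
move=> x y z; rewrite !inE => /orP[x1|x2] /orP[y1|y2] /orP[z1|z2];
  try by [apply: p1 | apply: p2].
- by rewrite (no x z).
- by rewrite (before_le2 b z1 y2).
- by rewrite (no x z).
- by rewrite (before_le2 b y1 x2).
- by rewrite (before_le2 b y1 x2).
- by rewrite (before_le2 b z1 y2).
Qed.

Lemma plane_nw S1 S2 : nwrel P S1 S2 -> plane_on S1 -> plane_on S2 ->
  plane_on (S1 :|: S2).
Proof.
move=> r [h1 p1] [h2 p2]; split; first exact: heap_nw.
have b := r.1.
move=> x y z; rewrite !inE => /orP[x1|x2] /orP[y1|y2] /orP[z1|z2];
  try by [apply: p1 | apply: p2].
- have [g [g1 gm E _]] := nw_top r x1 z2; rewrite (E x z) // (E y z) // => xy _.
  by apply: p1 => //; apply: gm.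
- by rewrite (before_le2 b z1 y2).
- have [g [g1 gm E _]] := nw_top r x1 z2; rewrite (E x z) // (E x y) // => _ _ ->.
  by [].
- by rewrite (before_le2 b y1 x2).
- by rewrite (before_le2 b y1 x2).
- by rewrite (before_le2 b z1 y2).
Qed.

Let o0 : 'I_4 := @Ordinal 4 0 isT.
Let o1 : 'I_4 := @Ordinal 4 1 isT.
Let o2 : 'I_4 := @Ordinal 4 2 isT.
Let o3 : 'I_4 := @Ordinal 4 3 isT.

Lemma all_ord4 (Q : 'I_4 -> Prop) : Q o0 -> Q o1 -> Q o2 -> Q o3 -> forall i, Q i.
Proof.
move=> q0 q1 q2 q3 [[|[|[|[|k]]]] hk] //.
- by rewrite (_ : Ordinal hk = o0) //; apply: val_inj.
- by rewrite (_ : Ordinal hk = o1) //; apply: val_inj.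
- by rewrite (_ : Ordinal hk = o2) //; apply: val_inj.
- by rewrite (_ : Ordinal hk = o3) //; apply: val_inj.
Qed.

Lemma before_initial S1 S2 (e : 'I_4 -> T) : before P S1 S2 ->
  (forall i, e i \in S1 :|: S2) -> (forall i j, le2 P (e i) (e j) = (i <= j)) ->
  forall i j : 'I_4, e j \in S1 -> i <= j -> e i \in S1.
Proof.
move=> b eS e2 i j j1 ij; have := eS i; rewrite inE => /orP[//|i2].
by have := before_le2 b j1 i2; rewrite e2 ij.
Qed.

(** The comparability graph of a forbidden poset is connected, so that the poset fits in
    one factor. *)
Lemma free_mul N S1 S2 : N = N1 \/ N = N2 -> mulrel P S1 S2 ->
  free_on N S1 -> free_on N S2 -> free_on N (S1 :|: S2).
Proof.
move=> hN [b m] f1 f2 e eS e1 e2.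
have in12 i : (e i \in S2) = (e i \notin S1).
  have /pred0P/(_ (e i)) /= := before_disjoint b; have := eS i; rewrite inE.
  by case: (e i \in S1); case: (e i \in S2).
have same i j : le1 N i j -> (e i \in S1) = (e j \in S1).
  rewrite -e1 => ij; apply/idP/idP=> [i1|j1]; apply/negPn/negP; rewrite -in12.
    by move=> j2; have /andP[] := m _ _ i1 j2; rewrite ij.
  by move=> i2; have /andP[_] := m _ _ j1 i2; rewrite ij.
have all_same i : (e i \in S1) = (e o0 \in S1).
  case: hN => eN; rewrite {}eN in same; move: i.
    have s1 := same o0 o1; have s2 := same o0 o3; have s3 := same o2 o3.
    rewrite !le1_mk in s1 s2 s3; apply: all_ord4 => //.
    - by rewrite s1.
    - by rewrite s3 // s2.
    - by rewrite s2.
  have s1 := same o0 o2; have s2 := same o1 o2; have s3 := same o1 o3.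
  rewrite !le1_mk in s1 s2 s3; apply: all_ord4 => //.
  - by rewrite s2 // s1.
  - by rewrite s1.
  - by rewrite -s3 // s2 // s1.
case i1: (e o0 \in S1).
  by apply: (f1 e) => // i; rewrite all_same.
by apply: (f2 e) => // i; rewrite in12 all_same i1.
Qed.

(** The vertices of [S1] form an initial segment of the forbidden poset. If this segment
    is proper and nonempty, the vertices on the right have the same predecessors on the
    left, which forces the segment to be the first three vertices. *)
Lemma free_nw N S1 S2 : N = N1 \/ N = N2 -> nwrel P S1 S2 -> heap_on S1 ->
  free_on N S1 -> free_on N S2 -> free_on N (S1 :|: S2).
Proof.
move=> hN r h1 f1 f2 e eS e1 e2; have b := r.1.
have in12 i : (e i \in S2) = (e i \notin S1).
  have /pred0P/(_ (e i)) /= := before_disjoint b; have := eS i; rewrite inE.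
  by case: (e i \in S1); case: (e i \in S2).
have ini := before_initial b eS e2.
have [i3|i3] := boolP (e o3 \in S1).
  by apply: (f1 e) => // i; apply: ini i3 _; rewrite -ltnS.
have [i0|i0] := boolP (e o0 \in S1); last first.
  apply: (f2 e) => // i; rewrite in12; apply: contra i0 => i1.
  exact: ini i1 _.
rewrite -in12 in i3; have [g [g1 gm E _]] := nw_top r i0 i3.
have E' i j j' : e i \in S1 -> e j \in S2 -> e j' \in S2 -> le1 N i j = le1 N i j'.
  by move=> i1 j2 j'2; rewrite -!e1 (E _ _ i1 j2) (E _ _ i1 j'2).
(* The vertices 0, 1 and 2 are on the left and 3 is on the right; replacing 3 by
   the greatest element g of the left part gives a forbidden poset inside S1. *)
have i2 : e o2 \in S1.
  apply/negPn; rewrite -in12; apply/negP=> i2; have := E' o0 o2 o3 i0 i2 i3.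
  by case: hN => ->; rewrite !le1_mk.
have i1 : e o1 \in S1 by apply: ini i2 _.
have n2g : e o2 != g.
  apply/eqP=> eg; have := E _ _ i2 i3; rewrite {2}eg le1_refl e1.
  have := E _ _ i0 i3; rewrite -eg !e1.
  by case: hN => ->; rewrite !le1_mk.
have lt3 i : i != o3 -> (e i \in S1) /\ (le2 P g (e i) = false).
  move=> n3; have i2' : i <= 2.
    by move: i n3 => [[|[|[|[|k]]]] hk] //; rewrite -val_eqE.
  have j1 : e i \in S1 by apply: ini i2 _.
  split=> //; apply/negP=> gi; case/eqP: n2g; apply: (@le2_anti _ P); first exact: gm.
  by apply: le2_trans gi _; rewrite e2.
pose e' i := if i == o3 then g else e i.
have e'E i : i != o3 -> e' i = e i by rewrite /e' => /negbTE->.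
have e'3 : e' o3 = g by rewrite /e' eqxx.
apply: (f1 e') => [i|i j|i j].
- by rewrite /e'; case: eqVneq => // /lt3[].
- have [->|ni] := eqVneq i o3; have [->|nj] := eqVneq j o3; rewrite ?e'3 ?e'E //.
  + by rewrite -e1 !le1_refl.
  + have [j1 gj] := lt3 _ nj.
    have -> : le1 P g (e j) = false.
      by apply/negP=> /(h1 _ _ g1 j1); rewrite gj.
    by have [_] := r.2 _ _ j1 i3; rewrite -e1 => /negbTE.
  + by have [i1' _] := lt3 _ ni; rewrite -(E _ _ i1' i3) e1.
- have [->|ni] := eqVneq i o3; have [->|nj] := eqVneq j o3; rewrite ?e'3 ?e'E //.
  + by rewrite le2_refl leqnn.
  + have [_ ->] := lt3 _ nj; apply/esym/negbTE; rewrite -ltnNge.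
    by move: j nj => [[|[|[|[|k]]]] hk] //; rewrite -val_eqE.
  + by have [i1' _] := lt3 _ ni; rewrite gm // -ltnS ltn_ord.
Qed.

Lemma family_on_mul X S1 S2 : mulrel P S1 S2 -> family_on X S1 -> family_on X S2 ->
  family_on X (S1 :|: S2).
Proof.
move=> r; have hm := heap_mul r; have fm := forest_mul r; have pm := plane_mul r.
have n1 := free_mul (or_introl (erefl N1)) r.
have n2 := free_mul (or_intror (erefl N2)) r.
case: X => //=.
- by move=> [? ?] [? ?]; auto.
- by move=> [? [? ?]] [? [? ?]]; auto.
- by move=> [? ?] [? ?]; auto.
Qed.

Lemma family_on_nw X S1 S2 : nwrel P S1 S2 -> family_on X S1 -> family_on X S2 ->
  family_on X (S1 :|: S2).
Proof.
move=> r; have hm := heap_nw r; have fm := forest_nw r; have pm := plane_nw r.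
have n1 := free_nw (or_introl (erefl N1)) r.
have n2 := free_nw (or_intror (erefl N2)) r.
case: X => //=.
- by move=> [? ?] [? ?]; auto.
- move=> [p1 [? ?]] [? [? ?]]; split; first by auto.
  by have [h1 _] := p1; split; [apply: n1 | apply: n2].
- by move=> [? ?] [? ?]; auto.
Qed.

End FamilyOn.

Section FamilyOnTransfer.
Variables (T U : finType) (R : sposet T) (P : sposet U) (f : T -> U).
Hypothesis fe : embedding R P setT f.

Let f1 x y : le1 P (f x) (f y) = le1 R x y.
Proof. by case: fe => _ h _; rewrite h ?inE. Qed.

Let f2 x y : le2 P (f x) (f y) = le2 R x y.
Proof. by case: fe => _ _ h; rewrite h ?inE. Qed.

Lemma family_on_embedding X : family_on R X setT <-> family_on P X (f @: setT).
Proof.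
have fT x : f x \in f @: setT by apply: imset_f.
have h : heap_on R setT <-> heap_on P (f @: setT).
  split=> [hR _ _ /imsetP[x _ ->] /imsetP[y _ ->]|hP x y _ _].
    by rewrite f1 f2; apply: hR.
  by rewrite -f1 -f2; apply: hP.
have o : forest_on R setT <-> forest_on P (f @: setT).
  split=> [hR _ _ _ /imsetP[x _ ->] /imsetP[y _ ->] /imsetP[z _ ->]|hP x y z _ _ _].
    by rewrite !f1; apply: hR.
  by rewrite -!f1; apply: hP.
have p : plane_on R setT <-> plane_on P (f @: setT).
  split=> -[/h hh pp]; split=> //.
    move=> _ _ _ /imsetP[x _ ->] /imsetP[y _ ->] /imsetP[z _ ->].
    by rewrite !f1 !f2; apply: pp.
  by move=> x y z _ _ _; rewrite -!f1 -!f2; apply: pp.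
have n N : free_on R N setT <-> free_on P N (f @: setT).
  split=> hN e eA e1 e2.
    have ex i : exists x, f x == e i.
      by have /imsetP[x _ ->] := eA i; exists x.
    apply: (hN (fun i => xchoose (ex i))) => [//|i j|i j].
      by rewrite -f1 !(eqP (xchooseP (ex _))).
    by rewrite -f2 !(eqP (xchooseP (ex _))).
  by apply: (hN (f \o e)) => [i|i j|i j] /=; rewrite ?fT ?f1 ?f2.
case: X => //=; first by split=> -[/h ? /o ?].
- by split=> -[/p ? [/n ? /n ?]].
- by split=> -[/o ? /p ?].
Qed.

End FamilyOnTransfer.

Section PlaneRepresentation.
Variables (T : finType) (P : sposet T).

(** The only possible right order of a plane poset from which [P] arises. *)
Definition right_of (x y : T) : bool := (x == y) || (le2 P x y && ~~ le1 P x y).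

(** A plane poset is determined by its first order and its total order. *)
Lemma arises_right Q : plane Q -> arises_from P Q ->
  le1 P =2 le1 Q /\ le2 Q =2 right_of.
Proof.
move=> /forallP pQ /forallP aQ.
have a1 x y : le1 P x y = le1 Q x y.
  by have /forallP/(_ y)/andP[/eqP] := aQ x.
have a2 x y : le2 P x y = le1 Q x y || le2 Q x y.
  by have /forallP/(_ y)/andP[_ /eqP] := aQ x.
split=> [//|x y]; rewrite /right_of; have [->|nxy] := eqVneq x y.
  by have [_ /porderP[r _ _]] := dposetP Q; rewrite r.
have /forallP/(_ y)/implyP/(_ nxy)/eqP := pQ x.
by rewrite a2 a1; case: (le1 Q x y) => //=; case: (le2 Q x y).
Qed.

Lemma plane_right Q : plane Q -> arises_from P Q -> plane_on P setT.
Proof.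
move=> pQ aQ; have [a1 a2] := arises_right pQ aQ; split=> [x y _ _ xy|].
  have /forallP/(_ x)/forallP/(_ y)/andP[_ /eqP->] := aQ.
  by rewrite -a1 xy.
move=> x y z _ _ _ xy yz xz; have [_ /porderP[_ _ tr]] := dposetP Q.
apply/negPn; rewrite negb_or; apply/negP=> /andP[nxy nyz].
have : le2 Q x z by apply: (tr y); rewrite a2 /right_of ?xy ?yz ?nxy ?nyz orbT.
rewrite a2 /right_of xz andbF orbF => /eqP exz; rewrite -exz in yz.
by rewrite (le2_anti xy yz) le1_refl in nxy.
Qed.

Hypothesis pP : plane_on P setT.

Lemma right_porder : porder right_of.
Proof.
have [hP tP] := pP; apply/porderP; split=> [x|x y|y x z]; rewrite /right_of.
- by rewrite eqxx.
- case: eqVneq => //= nxy.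
  by move=> /andP[/andP[xy _] /andP[yx _]]; apply: le2_anti yx.
case: eqVneq => [->//|nxy] /= /andP[xy nxy1].
case: eqVneq => [<-|nyz] /=; first by rewrite xy nxy1 orbT.
move=> /andP[yz nyz1]; rewrite (le2_trans xy yz); apply/orP; right=> /=.
apply/negP=> xz; have := tP x y z; rewrite !inE => /(_ isT isT isT xy yz xz).
by rewrite (negbTE nxy1) (negbTE nyz1).
Qed.

Definition plane_of : dposet T := mk_dposet (proj1 (dposetP P)) right_porder.

Lemma plane_ofP : plane plane_of && arises_from P plane_of.
Proof.
have [hP _] := pP; apply/andP; split.
  apply/forallP=> x; apply/forallP=> y; apply/implyP=> nxy.
  rewrite !le1_mk !le2_mk /right_of (negbTE nxy) [y == x]eq_sym (negbTE nxy) /=.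
  have l z t : le1 P z t -> le2 P z t by apply: hP; rewrite inE.
  have := sposet_total P x y; have := l x y; have := l y x.
  have : ~~ (le2 P x y && le2 P y x).
    by apply: contra nxy => /andP[xy yx]; apply/eqP/(le2_anti xy yx).
  case: (le1 P x y); case: (le1 P y x); case: (le2 P x y); case: (le2 P y x) => //=;
    by move=> _ h h'; first [have := h isT | have := h' isT].
apply/forallP=> x; apply/forallP=> y; rewrite le1_mk le2_mk eqxx /= /right_of.
case xy: (le1 P x y); first by rewrite hP ?inE.
rewrite andbT /=; case: (eqVneq x y) xy => [->|_ _] /=; last by [].
by rewrite le1_refl.
Qed.

End PlaneRepresentation.

Lemma dsub_imset (T U : finType) (Q : dposet T) (N : dposet U) (e : U -> T) :
  injective e -> (forall i j, le1 Q (e i) (e j) = le1 N i j) ->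
  (forall i j, le2 Q (e i) (e j) = le2 N i j) ->
  diso (dsub Q (e @: setT)) N.
Proof.
move=> ei e1 e2; apply/diso_sym/disoP.
have eT i : e i \in e @: setT by apply: imset_f.
exists (fun i => exist _ (e i) (eT i)); split=> [|i j|i j].
- apply: inj_card_bij => [i j [/ei]//|].
  by rewrite card_sig (eq_card (B := e @: setT)) // card_imset // cardsT.
- by rewrite le1_mk /= e1.
- by rewrite le2_mk /= e2.
Qed.

Lemma le_N N : N = N1 \/ N = N2 ->
  forall i j, (le1 N i j || le2 N i j) = (i <= j) /\
              le2 N i j = (i == j) || ((i <= j) && ~~ le1 N i j).
Proof.
by case=> -> [[|[|[|[|?]]]] hi] // [[|[|[|[|?]]]] hj] //; rewrite !le1_mk !le2_mk.
Qed.

Lemma without_N_free (T : finType) (P : sposet T) Q : plane Q -> arises_from P Q ->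
  without_N Q <-> free_on P N1 setT /\ free_on P N2 setT.
Proof.
move=> pQ aQ; have [a1 a2] := arises_right pQ aQ.
have a3 x y : le2 P x y = le1 Q x y || le2 Q x y.
  by have /forallP/(_ x)/forallP/(_ y)/andP[_ /eqP] := aQ.
have emb N (e : 'I_4 -> T) : N = N1 \/ N = N2 ->
  (forall i j, le1 P (e i) (e j) = le1 N i j) ->
  (forall i j, le2 P (e i) (e j) = (i <= j)) -> diso (dsub Q (e @: setT)) N.
  move=> hN e1 e2; have ei : injective e.
    move=> i j eij; apply/val_inj/eqP; rewrite eqn_leq -!e2 eij !e2 leqnn //.
  apply: dsub_imset => // i j; first by rewrite -a1.
  by rewrite a2 /right_of e1 e2 (inj_eq ei) (le_N hN i j).2.
have bme N (A : {set T}) : N = N1 \/ N = N2 -> diso (dsub Q A) N -> ~ free_on P N setT.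
  move=> hN /diso_sym/disoP[f [_ f1 f2]] /(_ (fun i => val (f i))); apply=> // i j.
    by rewrite a1 -f1 le1_mk.
  by rewrite a3 -(le_N hN i j).1 -f1 -f2 le1_mk le2_mk.
have l1 : N1 = N1 \/ N1 = N2 by left.
have l2 : N2 = N1 \/ N2 = N2 by right.
split=> [/existsPn nA|[n1 n2]].
  split=> e _ e1 e2; have := nA (e @: setT); rewrite negb_or => /andP[].
    by rewrite (emb N1 e l1).
  by rewrite (emb N2 e l2).
apply/existsPn=> A; rewrite negb_or; apply/andP; split; apply/negP.
  by move/(bme _ _ l1).
by move/(bme _ _ l2).
Qed.

Lemma from_planeP b : from_plane b <-> plane_on (srep b) setT.
Proof.
split=> [/existsP[Q /andP[pQ aQ]]|pP]; first exact: plane_right aQ.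
by apply/existsP; exists (plane_of pP); apply: plane_ofP.
Qed.

Lemma heap_orderedP b : heap_ordered (srep b) <-> heap_on (srep b) setT.
Proof.
split=> [/forallP h x y _ _|h]; first by have /forallP/(_ y)/implyP := h x.
by apply/forallP=> x; apply/forallP=> y; apply/implyP; apply: h.
Qed.

Lemma rooted_forestP b : rooted_forest (srep b) <-> forest_on (srep b) setT.
Proof.
split=> [/forallP h x y z _ _ _ xz yz|h].
  by have /forallP/(_ y)/forallP/(_ z)/implyP := h x; apply; rewrite xz.
apply/forallP=> x; apply/forallP=> y; apply/forallP=> z; apply/implyP.
by case/andP; apply: h.
Qed.

Lemma in_familyP X b : in_family X b <-> family_on (srep b) X setT.
Proof.
have h := heap_orderedP b; have o := rooted_forestP b; have p := from_planeP b.
case: X => //=.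
- by split=> [/andP[/h ? /o ?]|[/h-> /o->]].
- split=> [/existsP[Q /and3P[pQ nQ aQ]]|[pP nP]].
    split; first exact: plane_right aQ.
    exact/(without_N_free pQ aQ).
  apply/existsP; exists (plane_of pP); have /andP[pQ aQ] := plane_ofP pP.
  by rewrite pQ aQ andbT; apply/(without_N_free pQ aQ).
- by split=> [/andP[/o ? /p ?]|[/o-> /p->]].
Qed.

Lemma in_family_cl X (T : finType) (P : sposet T) A :
  in_family X (cl P A) <-> family_on P X A.
Proof.
have [f [_ fA fe]] := cl_subset P A.
rewrite -[in X in _ <-> X]fA; split=> [/in_familyP/(family_on_embedding fe)//|].
by move/(family_on_embedding fe)/in_familyP.
Qed.

Lemma in_family1 X : in_family X sempty.
Proof.
have T0 : (setT : {set 'I_(scard sempty)}) = set0.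
  by apply/eqP; rewrite -cards_eq0 cardsT card_ord scard_eq0.
apply/in_familyP; rewrite T0.
have h : heap_on (srep sempty) set0 by move=> x; rewrite inE.
have o : forest_on (srep sempty) set0 by move=> x; rewrite inE.
have p : plane_on (srep sempty) set0 by split=> // x; rewrite inE.
have n N : free_on (srep sempty) N set0.
  by move=> e /(_ ord0); rewrite inE.
by case: X.
Qed.

Lemma in_family_mul X a b : in_family X a -> in_family X b -> in_family X (mulc a b).
Proof.
have [T [P [S1 [S2 [r <- <- ->]]]]] := mulc_ex a b.
by move=> /in_family_cl g1 /in_family_cl g2; apply/in_family_cl/family_on_mul.
Qed.

Lemma in_family_nw X a b : in_family X a -> in_family X b -> in_family X (nwc a b).
Proof.
have [T [P [S1 [S2 [r <- <- ->]]]]] := nwc_ex a b.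
by move=> /in_family_cl g1 /in_family_cl g2; apply/in_family_cl/family_on_nw.
Qed.

Lemma in_family_sub X (T : finType) (P : sposet T) (A B : {set T}) :
  A \subset B -> in_family X (cl P B) -> in_family X (cl P A).
Proof. by move=> AB /in_family_cl gB; apply/in_family_cl/(family_on_sub AB). Qed.

Definition proper_cut (B : eqType) (e : B) (p : B * B) : bool :=
  (p.1 != e) && (p.2 != e).

(** The trivial ideals are the empty one and the whole poset, and only the latter contains
    the greatest element. *)
Lemma cuts_proper s b : b != sempty ->
  perm_eq (cuts s b)
    ((if s then (sempty, b) else (b, sempty)) ::
       filter (proper_cut sempty) (cuts s b)).
Proof.
move=> nb; apply: perm_eq_sum => F; rewrite big_cons big_filter.
have T0 : (setT : {set 'I_(scard b)}) != set0 by rewrite -(cl_eq1 (srep b)) sclass_cl.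
have e0 : cl (srep b) set0 = sempty by apply/eqP; rewrite cl_eq1.
rewrite /cuts !big_map !big_enum /= [X in _ = _ + X]big_enum_cond /=.
pose J0 : {set 'I_(scard b)} := if s then setT else set0.
have J0top : topin (srep b) setT J0 = s.
  by rewrite /J0; case: (s); rewrite ?topin_full ?topin0.
rewrite (bigD1 J0) /=; last first.
  rewrite inE J0top eqxx andbT; apply/idealinP; split=> [|x y].
    exact: subsetT.
  by rewrite /J0; case: (s); rewrite ?inE.
congr (F _ + _).
  by rewrite /J0; case: (s); rewrite ?setDv ?setD0 sclass_cl e0.
apply: eq_bigl => J; rewrite inE /proper_cut /= !cl_eq1; case iJ: idealin => //=.
have [->|nJ] := eqVneq J set0.
  by rewrite topin0 andbF; rewrite /J0; case: (s); rewrite ?eqxx ?andbF.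
rewrite setD_eq0 subTset.
have [->|nT] := eqVneq J setT.
  rewrite topin_full // /= andbF /J0; case: (s); rewrite ?eqxx //.
by case tJ : (topin _ _ J == s) => //=; rewrite /J0; case: (s); rewrite ?nJ ?nT.
Qed.

Lemma cuts1 s : cuts s sempty = if s then [::] else [:: (sempty, sempty)].
Proof.
have T0 : (setT : {set 'I_(scard sempty)}) = set0.
  by apply/eqP; rewrite -cards_eq0 cardsT card_ord scard_eq0.
have E (J : {set 'I_(scard sempty)}) : J = set0.
  by apply/eqP; rewrite -subset0 -T0 subsetT.
have e0 : cl (srep sempty) set0 = sempty by apply/eqP; rewrite cl_eq1.
rewrite /cuts; case: s.
  rewrite (_ : enum _ = [::]) //; apply: size0nil; rewrite -cardE eq_card0 // => J.
  by rewrite inE (E J) topin0 andbF.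
have : perm_eq (enum [pred J : {set 'I_(scard sempty)} | idealin (srep sempty) setT J
    && (topin (srep sempty) setT J == false)]) [:: set0].
  apply: uniq_perm; rewrite ?enum_uniq // => J; rewrite mem_enum !inE (E J) eqxx.
  by rewrite topin0 andbT; apply/idealinP; split=> [|x y]; rewrite ?sub0set ?inE.
by move=> h; rewrite (perm_small_eq _ h) // /map [_ :\: _]E e0.
Qed.

(** * Abstract bialgebras of cuts *)

(** The properties of special posets used below, in a form inherited by every family.
    [cb_dec] decides which elements are proper products, since indecomposable elements
    must form a choice type. *)
Record cut_bialgebra := CutBialgebra {
  cb_sort :> choiceType;
  cb_deg : cb_sort -> nat;
  cb_one : cb_sort;
  cb_mul : cb_sort -> cb_sort -> cb_sort;
  cb_nw : cb_sort -> cb_sort -> cb_sort;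
  cb_cuts : bool -> cb_sort -> seq (cb_sort * cb_sort);
  cb_deg_eq0 : forall b, (cb_deg b == 0) = (b == cb_one);
  cb_degM : forall a b, cb_deg (cb_mul a b) = cb_deg a + cb_deg b;
  cb_degW : forall a b, cb_deg (cb_nw a b) = cb_deg a + cb_deg b;
  cb_mulA : associative cb_mul;
  cb_mul1b : left_id cb_one cb_mul;
  cb_mulb1 : right_id cb_one cb_mul;
  cb_nwA : associative cb_nw;
  cb_nw1b : left_id cb_one cb_nw;
  cb_nwb1 : right_id cb_one cb_nw;
  cb_mul_nw : forall a b c, b != cb_one ->
    cb_nw (cb_mul a b) c = cb_mul a (cb_nw b c);
  cb_deg_cuts : forall s b p, p \in cb_cuts s b ->
    cb_deg p.1 + cb_deg p.2 = cb_deg b;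
  cb_cuts1 : forall s,
    cb_cuts s cb_one = if s then [::] else [:: (cb_one, cb_one)];
  cb_cuts_proper : forall s b, b != cb_one ->
    perm_eq (cb_cuts s b) ((if s then (cb_one, b) else (b, cb_one)) ::
       filter (proper_cut cb_one) (cb_cuts s b));
  cb_cutsM : forall s a b, b != cb_one ->
    perm_eq (cb_cuts s (cb_mul a b))
      [seq (cb_mul p.1 q.1, cb_mul p.2 q.2)
         | p <- cb_cuts false a ++ cb_cuts true a, q <- cb_cuts s b];
  cb_cutsFW : forall a b,
    perm_eq (cb_cuts false (cb_nw a b))
      [seq (cb_nw p.1 q.1, cb_mul p.2 q.2)
         | p <- cb_cuts false a, q <- cb_cuts false b];
  cb_cutsTW : forall a b,
    perm_eq (cb_cuts true (cb_nw a b))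
      ([seq (cb_nw p.1 q.1, cb_mul p.2 q.2)
          | p <- cb_cuts false a, q <- cb_cuts true b]
       ++ [seq (p.1, cb_nw p.2 b) | p <- cb_cuts true a]);
  cb_coassFF : forall b,
    perm_eq
      [seq (q.1, (q.2, p.2)) | p <- cb_cuts false b, q <- cb_cuts false p.1]
      [seq (p.1, (q.1, q.2)) | p <- cb_cuts false b,
         q <- cb_cuts false p.2 ++ cb_cuts true p.2];
  cb_coassTF : forall b,
    perm_eq
      [seq (q.1, (q.2, p.2)) | p <- cb_cuts false b, q <- cb_cuts true p.1]
      [seq (p.1, (q.1, q.2)) | p <- cb_cuts true b, q <- cb_cuts false p.2];
  cb_coassTT : forall b,
    perm_eq
      [seq (q.1, (q.2, p.2)) | p <- cb_cuts true b,
         q <- cb_cuts false p.1 ++ cb_cuts true p.1]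
      [seq (p.1, (q.1, q.2)) | p <- cb_cuts true b, q <- cb_cuts true p.2];
  cb_mul_eq : forall a b a' b', cb_mul a b = cb_mul a' b' ->
    cb_deg a <= cb_deg a' -> exists2 c, a' = cb_mul a c & b = cb_mul c b';
  cb_nw_eq : forall a b a' b', cb_nw a b = cb_nw a' b' ->
    cb_deg a <= cb_deg a' -> exists2 c, a' = cb_nw a c & b = cb_nw c b';
  cb_mul_nw_eq : forall a b a' b',
    a' != cb_one -> b != cb_one -> b' != cb_one -> cb_mul a b = cb_nw a' b' ->
    exists c, [/\ c != cb_one, a' = cb_mul a c & b = cb_nw c b'];
  cb_dec : pred cb_sort;
  cb_decP : forall b, cb_dec b <-> exists a c,
    [/\ a != cb_one, c != cb_one & b = cb_mul a c \/ b = cb_nw a c]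
}.

Arguments cb_one {_}.

(** The factors of a decomposition are found among the subsets of the representative. *)
Definition decomposable (b : spclass) : bool :=
  [exists S : {set 'I_(scard b)}, [&& S != set0, ~: S != set0 &
     (b == mulc (cl (srep b) S) (cl (srep b) (~: S))) ||
     (b == nwc (cl (srep b) S) (cl (srep b) (~: S)))]].

Lemma before_setC (T : finType) (P : sposet T) S1 S2 :
  before P S1 S2 -> S1 :|: S2 = setT -> S2 = ~: S1.
Proof.
move=> /before_disjoint d /setP eT; apply/setP=> x; rewrite inE.
have := eT x; have /pred0P/(_ x) /= := d; rewrite !inE.
by case: (x \in S1); case: (x \in S2).
Qed.

Lemma decomposableP b : decomposable b <->
  exists a c, [/\ a != sempty, c != sempty & b = mulc a c \/ b = nwc a c].
Proof.
split=> [/existsP[S /and3P[S0 S1 h]]|[a [c [na nc h]]]].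
  exists (cl (srep b) S), (cl (srep b) (~: S)); rewrite !cl_eq1; split=> //.
  by case/orP: h => /eqP; [left | right].
have [S1 [S2 [eS bS e1 e2]]] : exists S1 S2,
    [/\ S1 :|: S2 = setT, before (srep b) S1 S2, cl (srep b) S1 = a & cl (srep b) S2 = c].
  case: h => h; have := sclass_cl b; rewrite [RHS]h.
    by case/mulc_split=> S1 [S2 [? [? _] ? ?]]; exists S1, S2.
  by case/nwc_split=> S1 [S2 [? [? _] ? ?]]; exists S1, S2.
apply/existsP; exists S1; rewrite -(before_setC bS eS).
rewrite -(cl_eq1 (srep b)) -(cl_eq1 (srep b) S2) e1 e2 na nc /=.
by apply/orP; case: h => h; [left | right]; apply/eqP.
Qed.

Definition special_posets : cut_bialgebra :=
  @CutBialgebra spclass scard sempty mulc nwc cuts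
    scard_eq0 scard_mulc scard_nwc mulcA mulc1l mulc1r nwcA nwc1l nwc1r mulc_nwc
    scard_cuts cuts1 cuts_proper cuts_mulc cutsF_nwc cutsT_nwc
    coassFF coassTF coassTT mulc_eq nwc_eq mulc_nwc_eq decomposable decomposableP.

(** * Restriction to a family *)

Section Restriction.
Variables (C : cut_bialgebra) (q : pred C).
Hypothesis q1 : q cb_one.
Hypothesis qM : forall a b, q a -> q b -> q (cb_mul a b).
Hypothesis qW : forall a b, q a -> q b -> q (cb_nw a b).
Hypothesis q_cuts : forall s b p, p \in cb_cuts s b -> q b -> q p.1 /\ q p.2.
Hypothesis q_div : forall a b, q (cb_mul a b) -> q a /\ q b.
Hypothesis q_divw : forall a b, q (cb_nw a b) -> q a /\ q b.

Local Notation F := {b : C | q b}.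

Definition f_one : F := exist (fun b => q b) cb_one q1.
Definition f_mul (a b : F) : F := exist (fun b => q b) _ (qM (valP a) (valP b)).
Definition f_nw (a b : F) : F := exist (fun b => q b) _ (qW (valP a) (valP b)).
Definition f_val (p : F * F) : C * C := (val p.1, val p.2).
Definition f_cuts (s : bool) (b : F) : seq (F * F) :=
  [seq (insubd f_one p.1, insubd f_one p.2) | p <- cb_cuts s (val b)].

Lemma f_val_inj : injective f_val.
Proof. by case=> [x y] [x' y'] [/val_inj-> /val_inj->]. Qed.

Lemma val_f_cuts s b : map f_val (f_cuts s b) = cb_cuts s (val b).
Proof.
rewrite -map_comp map_id_in // => -[x y] /q_cuts/(_ (valP b))[/= qx qy].
by rewrite /f_val /= !insubdK.
Qed.

Lemma f_neq1 (b : F) : (b != f_one) = (val b != cb_one).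
Proof. by []. Qed.

(** Identities between lists of cuts are proved in the restricted type by applying the
    injective map [v] to both sides. *)
Lemma val_allpairs (R : eqType) (R' : eqType) (v : R -> R')
    (f : F * F -> F * F -> R)
    (f' : C * C -> C * C -> R')
    (s : seq (F * F)) (t : F * F -> seq (F * F))
    (t' : C * C -> seq (C * C)) :
  (forall p r, v (f p r) = f' (f_val p) (f_val r)) ->
  (forall p, map f_val (t p) = t' (f_val p)) ->
  map v [seq f p r | p <- s, r <- t p] =
  [seq f' p r | p <- map f_val s, r <- t' p].
Proof.
move=> vf vt; rewrite map_allpairs allpairs_mapl.
under [RHS]eq_allpairsr => p do rewrite -vt.
rewrite allpairs_mapr; exact: eq_allpairs.
Qed.

Definition f_val3 (p : F * (F * F)) : C * (C * C) :=
  (val p.1, f_val p.2).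

Lemma f_val3_inj : injective f_val3.
Proof.
by case=> [x [y z]] [x' [y' z']] [/val_inj-> /val_inj-> /val_inj->].
Qed.

Lemma f_mul_eq a b a' b' : f_mul a b = f_mul a' b' ->
  cb_deg (val a) <= cb_deg (val a') -> exists2 c, a' = f_mul a c & b = f_mul c b'.
Proof.
move=> /(congr1 val)/cb_mul_eq h /h[c e1 e2].
have [_ qc] : q (val a) /\ q c by apply: q_div; rewrite -e1; apply: valP.
by exists (exist (fun b => q b) c qc); apply: val_inj.
Qed.

Lemma f_nw_eq a b a' b' : f_nw a b = f_nw a' b' ->
  cb_deg (val a) <= cb_deg (val a') -> exists2 c, a' = f_nw a c & b = f_nw c b'.
Proof.
move=> /(congr1 val)/cb_nw_eq h /h[c e1 e2].
have [_ qc] : q (val a) /\ q c by apply: q_divw; rewrite -e1; apply: valP.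
by exists (exist (fun b => q b) c qc); apply: val_inj.
Qed.

Lemma f_mul_nw_eq a b a' b' : a' != f_one -> b != f_one -> b' != f_one ->
  f_mul a b = f_nw a' b' ->
  exists c, [/\ c != f_one, a' = f_mul a c & b = f_nw c b'].
Proof.
move=> na' nb nb' /(congr1 val)/cb_mul_nw_eq h; have [//|//|//|c [nc e1 e2]] := h.
have [_ qc] : q (val a) /\ q c by apply: q_div; rewrite -e1; apply: valP.
by exists (exist (fun b => q b) c qc); split; rewrite ?f_neq1 //; apply: val_inj.
Qed.

Lemma val_cat_f_cuts b :
  map f_val (f_cuts false b ++ f_cuts true b) = cb_cuts false (val b) ++ cb_cuts true (val b).
Proof. by rewrite map_cat !val_f_cuts. Qed.

Lemma f_decP (b : F) : cb_dec (val b) <->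
  exists a c, [/\ a != f_one, c != f_one & b = f_mul a c \/ b = f_nw a c].
Proof.
split=> [/cb_decP[a [c [na nc h]]]|[a [c [na nc h]]]]; last first.
  apply/cb_decP; exists (val a), (val c); split=> //.
  by case: h => ->; [left | right].
have [qa qc] : q a /\ q c.
  by case: h => h; [apply: q_div | apply: q_divw]; rewrite -h; apply: valP.
exists (exist (fun b => q b) a qa), (exist (fun b => q b) c qc); split=> //.
by case: h => h; [left | right]; apply: val_inj.
Qed.

Definition restricted : cut_bialgebra.
Proof.
refine (@CutBialgebra F (fun b => cb_deg (val b)) f_one f_mul f_nw f_cuts
  _ _ _ _ _ _ _ _ _ _ _ _ _ _ _ _ _ _ _ f_mul_eq f_nw_eq f_mul_nw_eq
  (fun b => cb_dec (val b)) f_decP).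
- by move=> b; apply: cb_deg_eq0.
- by move=> a b; apply: cb_degM.
- by move=> a b; apply: cb_degW.
- by move=> a b c; apply/val_inj/cb_mulA.
- by move=> a; apply/val_inj/cb_mul1b.
- by move=> a; apply/val_inj/cb_mulb1.
- by move=> a b c; apply/val_inj/cb_nwA.
- by move=> a; apply/val_inj/cb_nw1b.
- by move=> a; apply/val_inj/cb_nwb1.
- by move=> a b c nb; apply/val_inj/cb_mul_nw.
- move=> s b p /(map_f f_val); rewrite val_f_cuts; exact: cb_deg_cuts.
- move=> s; apply: (inj_map f_val_inj); rewrite val_f_cuts cb_cuts1.
  by case: s.
- move=> s b nb; apply: (perm_map_inj f_val_inj).
  by have := cb_cuts_proper s nb; rewrite -val_f_cuts filter_map; case: s.
- move=> s a b nb; apply: (perm_map_inj f_val_inj).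
  rewrite (@val_allpairs _ _ _ _ (fun p q => (cb_mul p.1 q.1, cb_mul p.2 q.2)) _ _
    (fun=> cb_cuts s (val b))) => // [|p]; last exact: val_f_cuts.
  by rewrite val_cat_f_cuts val_f_cuts cb_cutsM.
- move=> a b; apply: (perm_map_inj f_val_inj).
  rewrite (@val_allpairs _ _ _ _ (fun p q => (cb_nw p.1 q.1, cb_mul p.2 q.2)) _ _
    (fun=> cb_cuts false (val b))) => // [|p]; last exact: val_f_cuts.
  by rewrite !val_f_cuts cb_cutsFW.
- move=> a b; apply: (perm_map_inj f_val_inj); rewrite map_cat.
  rewrite (@val_allpairs _ _ _ _ (fun p q => (cb_nw p.1 q.1, cb_mul p.2 q.2)) _ _
    (fun=> cb_cuts true (val b))) => // [|p]; last exact: val_f_cuts.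
  have -> : map f_val [seq (p.1, f_nw p.2 b) | p <- f_cuts true a]
     = [seq (p.1, cb_nw p.2 (val b)) | p <- map f_val (f_cuts true a)].
    by rewrite -!map_comp.
  by rewrite !val_f_cuts; apply: cb_cutsTW.
- move=> b; apply: (perm_map_inj f_val3_inj).
  rewrite (@val_allpairs _ _ _ _ (fun p q => (q.1, (q.2, p.2))) _ _
    (fun p => cb_cuts false p.1)) => // [|p]; last exact: val_f_cuts.
  rewrite (@val_allpairs _ _ _ _ (fun p q => (p.1, (q.1, q.2))) _ _
    (fun p => cb_cuts false p.2 ++ cb_cuts true p.2)) => // [|p]; last exact: val_cat_f_cuts.
  by rewrite !val_f_cuts cb_coassFF.
- move=> b; apply: (perm_map_inj f_val3_inj).
  rewrite (@val_allpairs _ _ _ _ (fun p q => (q.1, (q.2, p.2))) _ _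
    (fun p => cb_cuts true p.1)) => // [|p]; last exact: val_f_cuts.
  rewrite (@val_allpairs _ _ _ _ (fun p q => (p.1, (q.1, q.2))) _ _
    (fun p => cb_cuts false p.2)) => // [|p]; last exact: val_f_cuts.
  by rewrite !val_f_cuts cb_coassTF.
- move=> b; apply: (perm_map_inj f_val3_inj).
  rewrite (@val_allpairs _ _ _ _ (fun p q => (q.1, (q.2, p.2))) _ _
    (fun p => cb_cuts false p.1 ++ cb_cuts true p.1)) => // [|p]; last exact: val_cat_f_cuts.
  rewrite (@val_allpairs _ _ _ _ (fun p q => (p.1, (q.1, q.2))) _ _
    (fun p => cb_cuts true p.2)) => // [|p]; last exact: val_f_cuts.
  by rewrite !val_f_cuts cb_coassTT.
Defined.

End Restriction.

(** * Reduced cuts *)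

Lemma perm_eq_sumE (T : eqType) (s t : seq T) : perm_eq s t ->
  forall G : T -> nat, \sum_(x <- s) G x = \sum_(x <- t) G x.
Proof. by move=> st G; apply: perm_big. Qed.

Section ReducedCuts.
Variable C : cut_bialgebra.
Local Notation one := (@cb_one C).
Local Notation mul := (@cb_mul C).
Local Notation nw := (@cb_nw C).

Definition rcuts (s : bool) (b : C) : seq (C * C) := filter (proper_cut one) (cb_cuts s b).

Lemma sum_rcuts s b (G : C * C -> nat) : b != one ->
  \sum_(p <- cb_cuts s b) G p =
  G (if s then (one, b) else (b, one)) + \sum_(p <- rcuts s b) G p.
Proof. by move=> nb; rewrite (perm_big _ (cb_cuts_proper s nb)) big_cons. Qed.

(** Weights that vanish on triples with a trivial part: under them a sum over double cuts
    is a sum over reduced double cuts, because the cuts of [one] are trivial. *)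
Let proper3 (G : C * (C * C) -> nat) x :=
  if (x.1 != one) && proper_cut one x.2 then G x else 0.

Lemma sum_nested_left s t b G :
  \sum_(p <- cb_cuts s b) \sum_(q <- cb_cuts t p.1) proper3 G (q.1, (q.2, p.2)) =
  \sum_(p <- rcuts s b) \sum_(q <- rcuts t p.1) G (q.1, (q.2, p.2)).
Proof.
rewrite big_filter [RHS]big_mkcond; apply: eq_bigr => p _.
rewrite /proper_cut; case: eqVneq => [->|n1] /=.
  by rewrite cb_cuts1; case: (t); rewrite ?big_nil // big_seq1 /proper3 /= eqxx.
case: eqVneq => [->|n2] /=.
  by apply: big1 => q _; rewrite /proper3 /proper_cut /= eqxx !andbF.
rewrite big_filter [RHS]big_mkcond; apply: eq_bigr => q _.
by rewrite /proper3 /proper_cut /= n2 andbT.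
Qed.

Lemma sum_nested_right s t b G :
  \sum_(p <- cb_cuts s b) \sum_(q <- cb_cuts t p.2) proper3 G (p.1, (q.1, q.2)) =
  \sum_(p <- rcuts s b) \sum_(q <- rcuts t p.2) G (p.1, q).
Proof.
rewrite big_filter [RHS]big_mkcond; apply: eq_bigr => p _.
rewrite /proper_cut; case: eqVneq => [->|n1] /=.
  by apply: big1 => q _; rewrite /proper3 /= eqxx.
case: eqVneq => [->|n2] /=.
  by rewrite cb_cuts1; case: (t); rewrite ?big_nil // big_seq1 /proper3 /proper_cut /= eqxx andbF.
rewrite big_filter [RHS]big_mkcond; apply: eq_bigr => q _.
by rewrite /proper3 n1 /=; case: q.
Qed.

Lemma rcuts_coassFF b :
  perm_eq [seq (q.1, (q.2, p.2)) | p <- rcuts false b, q <- rcuts false p.1]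
    [seq (p.1, q) | p <- rcuts false b, q <- rcuts false p.2 ++ rcuts true p.2].
Proof.
apply: perm_eq_sum => G; have := perm_eq_sumE (cb_coassFF b) (proper3 G).
rewrite !big_allpairs_dep sum_nested_left => ->.
under eq_bigr do rewrite big_cat /=.
under [RHS]eq_bigr do rewrite big_cat /=.
by rewrite !big_split /= !sum_nested_right.
Qed.

Lemma rcuts_coassTF b :
  perm_eq [seq (q.1, (q.2, p.2)) | p <- rcuts false b, q <- rcuts true p.1]
    [seq (p.1, q) | p <- rcuts true b, q <- rcuts false p.2].
Proof.
apply: perm_eq_sum => G; have := perm_eq_sumE (cb_coassTF b) (proper3 G).
by rewrite !big_allpairs_dep sum_nested_left sum_nested_right.
Qed.

Lemma rcuts_coassTT b :
  perm_eq [seq (q.1, (q.2, p.2)) | p <- rcuts true b,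
             q <- rcuts false p.1 ++ rcuts true p.1]
    [seq (p.1, q) | p <- rcuts true b, q <- rcuts true p.2].
Proof.
apply: perm_eq_sum => G; have := perm_eq_sumE (cb_coassTT b) (proper3 G).
rewrite !big_allpairs_dep sum_nested_right => <-.
under eq_bigr do rewrite big_cat /=.
under [RHS]eq_bigr do rewrite big_cat /=.
by rewrite !big_split /= !sum_nested_left.
Qed.

Section Products.
Variables a b : C.
Hypotheses (na : a != one) (nb : b != one).

Lemma cb_mul_neq1 : mul a b != one.
Proof. by rewrite -cb_deg_eq0 cb_degM addn_eq0 !cb_deg_eq0 negb_and na. Qed.

Lemma cb_nw_neq1 : nw a b != one.
Proof. by rewrite -cb_deg_eq0 cb_degW addn_eq0 !cb_deg_eq0 negb_and na. Qed.

Let rt := rcuts false a ++ rcuts true a.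

(** Isolating the trivial cuts of both factors makes the terms of the Dup-Dend axioms
    appear. *)
Lemma sum_mul_cuts s G :
  \sum_(p <- cb_cuts s (mul a b)) G p =
  \sum_(p <- (a, one) :: (one, a) :: rt)
    \sum_(q <- (if s then (one, b) else (b, one)) :: rcuts s b)
      G (mul p.1 q.1, mul p.2 q.2).
Proof.
rewrite (perm_big _ (cb_cutsM s a nb)) big_allpairs_dep big_cat /=.
rewrite (sum_rcuts false _ na) (sum_rcuts true _ na).
rewrite big_cons [X in _ = _ + X]big_cons big_cat /= addnACA -addnA.
have E (H : C * C -> nat) : \sum_(q <- cb_cuts s b) H q =
    \sum_(q <- (if s then (one, b) else (b, one)) :: rcuts s b) H q.
  by rewrite sum_rcuts // big_cons.
by rewrite !E; do 3!congr (_ + _); apply: eq_bigr => p _; rewrite E.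
Qed.

Lemma sum_cons_right (s t : seq (C * C)) (q0 : C * C) (H : C * C -> C * C -> nat) :
  \sum_(p <- s) \sum_(q <- q0 :: t) H p q =
  \sum_(p <- s) H p q0 + \sum_(p <- s) \sum_(q <- t) H p q.
Proof. by rewrite -big_split; apply: eq_bigr => p _; rewrite big_cons. Qed.

Lemma rcutsF_mul : perm_eq (rcuts false (mul a b))
  ((b, a) :: [seq (p.1, mul a p.2) | p <- rcuts false b]
     ++ [seq (mul a p.1, p.2) | p <- rcuts false b]
     ++ [seq (mul p.1 b, p.2) | p <- rt]
     ++ [seq (mul p.1 q.1, mul p.2 q.2) | p <- rt, q <- rcuts false b]).
Proof.
apply: perm_eq_sum => G; apply: (@addnI (G (mul a b, one))).
rewrite -(sum_rcuts false _ cb_mul_neq1) sum_mul_cuts sum_cons_right.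
rewrite !big_cons !big_cat big_allpairs_dep !big_map /= !cb_mul1b !cb_mulb1.
have -> : \sum_(q <- rcuts false b) G (mul one q.1, mul a q.2) =
  \sum_(q <- rcuts false b) G (q.1, mul a q.2).
  by apply: eq_bigr => q _; rewrite cb_mul1b.
have -> : \sum_(q <- rcuts false b) G (mul a q.1, mul one q.2) =
  \sum_(q <- rcuts false b) G (mul a q.1, q.2).
  by apply: eq_bigr => q _; rewrite cb_mul1b.
have E s : \sum_(p <- rcuts s a) G (mul p.1 b, mul p.2 one) =
  \sum_(p <- rcuts s a) G (mul p.1 b, p.2).
  by apply: eq_bigr => p _; rewrite cb_mulb1.
rewrite /rt !big_cat /= !E.
lia.
Qed.

Lemma rcutsT_mul : perm_eq (rcuts true (mul a b))
  ((a, b) :: [seq (mul a p.1, p.2) | p <- rcuts true b]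
     ++ [seq (p.1, mul a p.2) | p <- rcuts true b]
     ++ [seq (p.1, mul p.2 b) | p <- rt]
     ++ [seq (mul p.1 q.1, mul p.2 q.2) | p <- rt, q <- rcuts true b]).
Proof.
apply: perm_eq_sum => G; apply: (@addnI (G (one, mul a b))).
rewrite -(sum_rcuts true _ cb_mul_neq1) sum_mul_cuts sum_cons_right.
rewrite !big_cons !big_cat big_allpairs_dep !big_map /= !cb_mul1b !cb_mulb1.
have -> : \sum_(q <- rcuts true b) G (mul one q.1, mul a q.2) =
  \sum_(q <- rcuts true b) G (q.1, mul a q.2).
  by apply: eq_bigr => q _; rewrite cb_mul1b.
have -> : \sum_(q <- rcuts true b) G (mul a q.1, mul one q.2) =
  \sum_(q <- rcuts true b) G (mul a q.1, q.2).
  by apply: eq_bigr => q _; rewrite cb_mul1b.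
have E s : \sum_(p <- rcuts s a) G (mul p.1 one, mul p.2 b) =
  \sum_(p <- rcuts s a) G (p.1, mul p.2 b).
  by apply: eq_bigr => p _; rewrite cb_mulb1.
rewrite /rt !big_cat /= !E.
lia.
Qed.

Lemma sum_nw_cuts s (H : C * C -> C * C -> nat) :
  \sum_(p <- cb_cuts false a) \sum_(q <- cb_cuts s b) H p q =
  \sum_(p <- (a, one) :: rcuts false a)
    \sum_(q <- (if s then (one, b) else (b, one)) :: rcuts s b) H p q.
Proof.
rewrite sum_rcuts // big_cons !sum_rcuts // big_cons; congr (_ + _).
by apply: eq_bigr => p _; rewrite sum_rcuts // big_cons.
Qed.

Lemma rcutsF_nw : perm_eq (rcuts false (nw a b))
  ([seq (nw a p.1, p.2) | p <- rcuts false b]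
     ++ [seq (nw p.1 b, p.2) | p <- rcuts false a]
     ++ [seq (nw p.1 q.1, mul p.2 q.2) | p <- rcuts false a, q <- rcuts false b]).
Proof.
apply: perm_eq_sum => G; apply: (@addnI (G (nw a b, one))).
rewrite -(sum_rcuts false _ cb_nw_neq1) (perm_eq_sumE (cb_cutsFW a b)) big_allpairs_dep.
rewrite sum_nw_cuts sum_cons_right !big_cons !big_cat big_allpairs_dep !big_map /= cb_mulb1.
have -> : \sum_(q <- rcuts false b) G (nw a q.1, mul one q.2) =
  \sum_(q <- rcuts false b) G (nw a q.1, q.2).
  by apply: eq_bigr => q _; rewrite cb_mul1b.
have -> : \sum_(p <- rcuts false a) G (nw p.1 b, mul p.2 one) =
  \sum_(p <- rcuts false a) G (nw p.1 b, p.2).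
  by apply: eq_bigr => p _; rewrite cb_mulb1.
lia.
Qed.

Lemma rcutsT_nw : perm_eq (rcuts true (nw a b))
  ((a, b) :: [seq (nw a p.1, p.2) | p <- rcuts true b]
     ++ [seq (p.1, nw p.2 b) | p <- rcuts true a]
     ++ [seq (p.1, mul p.2 b) | p <- rcuts false a]
     ++ [seq (nw p.1 q.1, mul p.2 q.2) | p <- rcuts false a, q <- rcuts true b]).
Proof.
apply: perm_eq_sum => G; apply: (@addnI (G (one, nw a b))).
rewrite -(sum_rcuts true _ cb_nw_neq1) (perm_eq_sumE (cb_cutsTW a b)) big_cat big_allpairs_dep.
rewrite sum_nw_cuts sum_cons_right big_map sum_rcuts //.
rewrite !big_cons !big_cat big_allpairs_dep !big_map /= !cb_nwb1 cb_mul1b.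
have -> : \sum_(q <- rcuts true b) G (nw a q.1, mul one q.2) =
  \sum_(q <- rcuts true b) G (nw a q.1, q.2).
  by apply: eq_bigr => q _; rewrite cb_mul1b.
have -> : \sum_(p <- rcuts false a) G (nw p.1 one, mul p.2 b) =
  \sum_(p <- rcuts false a) G (p.1, mul p.2 b).
  by apply: eq_bigr => p _; rewrite cb_nwb1.
lia.
Qed.

End Products.
End ReducedCuts.

Local Open Scope ring_scope.

(** * Spaces with a basis *)

Section LinearExtension.
Variable K : fieldType.
Implicit Types A B C D : choiceType.

Lemma malgZU B (c : K) (b : B) : << c *g b >> = c *: << b >>.
Proof. by apply/malgP=> k; rewrite mcoeffZ !mcoeffU mulrnAr mulr1. Qed.

Lemma malg_sum B (x : {malg K[B]}) : x = \sum_(b <- msupp x) x@_b *: << b >>.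
Proof.
by rewrite {1}[x]monalgE; apply: eq_bigr => b _; rewrite malgZU.
Qed.

(** Sums over any finite set containing the support, which makes additivity visible. *)
Lemma lextEw B (V : lmodType K) (f : B -> V) (x : {malg K[B]}) (d : {fset B}) :
  (msupp x `<=` d)%fset -> lext f x = \sum_(b <- d) x@_b *: f b.
Proof.
move=> sxd; apply: big_fset_incl => // b _ /mcoeff_outdom->.
by rewrite scale0r.
Qed.

Lemma lext_linear B (V : lmodType K) (f : B -> V) : linear (lext f).
Proof.
move=> c x y; pose d := (msupp x `|` msupp y)%fset.
have sx : (msupp x `<=` d)%fset by apply: fsubsetUl.
have sy : (msupp y `<=` d)%fset by apply: fsubsetUr.
have sz : (msupp (c *: x + y) `<=` d)%fset.
  apply: fsubset_trans (msuppD_le _ _) _; apply: fsetSU.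
  exact: msuppZ_le.
rewrite (lextEw _ sz) (lextEw _ sx) (lextEw _ sy) scaler_sumr -big_split /=.
apply: eq_bigr => b _; rewrite mcoeffD mcoeffZ scalerDl scalerA //.
Qed.

HB.instance Definition _ B (V : lmodType K) (f : B -> V) :=
  GRing.isLinear.Build K {malg K[B]} V *:%R (lext f) (lext_linear f).

Lemma lextU B (V : lmodType K) (f : B -> V) b : lext f << b >> = f b.
Proof. by rewrite (lextEw _ msuppU_le) big_seq_fset1 mcoeffUU scale1r. Qed.

Lemma eq_lext B (V : lmodType K) (f g : B -> V) : f =1 g -> lext f =1 lext g.
Proof. by move=> fg x; apply: eq_bigr => b _; rewrite fg. Qed.

Lemma eq_in_lext B (V : lmodType K) (f g : B -> V) x :
  {in msupp x, f =1 g} -> lext f x = lext g x.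
Proof. by move=> fg; apply: eq_big_seq => b /fg->. Qed.

Lemma linear_comb B (V : lmodType K) (f : {malg K[B]} -> V) :
  linear f -> f =1 lext (fun b => f << b >>).
Proof.
move=> fl x; pose F : {linear {malg K[B]} -> V} :=
  HB.pack f (GRing.isLinear.Build K {malg K[B]} V *:%R f fl).
rewrite {1}[x]malg_sum -[f]/(F : _ -> _) linear_sum.
by apply: eq_bigr => b _; rewrite linearZ.
Qed.

Lemma linear_eq B (V : lmodType K) (f g : {malg K[B]} -> V) :
  linear f -> linear g -> (forall b, f << b >> = g << b >>) -> f =1 g.
Proof.
move=> fl gl fg x; rewrite (linear_comb fl) (linear_comb gl).
exact: eq_lext.
Qed.

Lemma bextE A B (V : lmodType K) (f : A -> B -> V) x y :
  bext f x y = lext (fun a => lext (f a) y) x.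
Proof.
apply: eq_bigr => a _; rewrite scaler_sumr; apply: eq_bigr => b _.
by rewrite scalerA.
Qed.

Lemma bext_linearr A B (V : lmodType K) (f : A -> B -> V) x :
  linear (bext f x).
Proof.
move=> c y z; rewrite !bextE scaler_sumr -big_split; apply: eq_bigr => a _ /=.
by rewrite linearP scalerDr !scalerA mulrC.
Qed.

HB.instance Definition _ A B (V : lmodType K) (f : A -> B -> V) x :=
  GRing.isLinear.Build K {malg K[B]} V *:%R (bext f x) (bext_linearr f x).

Lemma bextPl A B (V : lmodType K) (f : A -> B -> V) c x y z :
  bext f (c *: x + y) z = c *: bext f x z + bext f y z.
Proof. by rewrite !bextE linearP. Qed.

Lemma bextUl A B (V : lmodType K) (f : A -> B -> V) a y :
  bext f << a >> y = lext (f a) y.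
Proof. by rewrite bextE lextU. Qed.

Lemma bextU A B (V : lmodType K) (f : A -> B -> V) a b :
  bext f << a >> << b >> = f a b.
Proof. by rewrite bextUl lextU. Qed.

Lemma bilinear_eq A B (V : lmodType K)
    (F G : {malg K[A]} -> {malg K[B]} -> V) :
  (forall x, linear (F x)) -> (forall y, linear (F^~ y)) ->
  (forall x, linear (G x)) -> (forall y, linear (G^~ y)) ->
  (forall a b, F << a >> << b >> = G << a >> << b >>) -> F =2 G.
Proof.
move=> Fr Fl Gr Gl FG x y; apply: (linear_eq (Fl y) (Gl y)) => a.
exact: (linear_eq (Fr _) (Gr _)).
Qed.

Lemma bext_suml A B (V : lmodType K) (f : A -> B -> V) (I : Type) (s : seq I)
    (F : I -> {malg K[A]}) y :
  bext f (\sum_(i <- s) F i) y = \sum_(i <- s) bext f (F i) y.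
Proof. by rewrite bextE linear_sum; apply: eq_bigr => i _; rewrite bextE. Qed.

Lemma bextBl A B (V : lmodType K) (f : A -> B -> V) x y z :
  bext f (x - y) z = bext f x z - bext f y z.
Proof. by rewrite !bextE linearB. Qed.

Lemma linear_combo (V W : lmodType K) (f g : V -> W) c :
  linear f -> linear g -> linear (fun u => c *: f u + g u).
Proof.
move=> fl gl k x y; rewrite fl gl !scalerDr !scalerA (mulrC k c).
by rewrite addrACA.
Qed.

(** * Tensors *)

Lemma tensU A B (a : A) (b : B) : tens << a >> << b >> = << (a, b) >> :> {malg K[_]}.
Proof. exact: bextU. Qed.

HB.instance Definition _ A B (x : {malg K[A]}) :=
  GRing.isLinear.Build K {malg K[B]} {malg K[(A * B)%type]} *:%R (tens x)
    (bext_linearr _ x).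

Lemma tensPl A B c (x y : {malg K[A]}) (z : {malg K[B]}) :
  tens (c *: x + y) z = c *: tens x z + tens y z.
Proof. exact: bextPl. Qed.

Lemma mcoeff_tens A B (x : {malg K[A]}) (y : {malg K[B]}) p :
  (tens x y)@_p = x@_p.1 * y@_p.2.
Proof.
apply: (bilinear_eq (F := fun x y => ((tens x y)@_p : K^o))
  (G := fun x y => (x@_p.1 * y@_p.2 : K^o))).
- by move=> u c v w; rewrite linearP mcoeffD mcoeffZ.
- by move=> u c v w; rewrite tensPl mcoeffD mcoeffZ.
- by move=> u c v w; rewrite mcoeffD mcoeffZ mulrDr mulrCA.
- by move=> u c v w; rewrite mcoeffD mcoeffZ mulrDl -mulrA.
move=> a b; rewrite tensU !mcoeffU; case: p => a' b' /=.
by rewrite xpair_eqE; do 2!case: eqP; rewrite /= ?mulr1 ?mulr0 ?mul0r.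
Qed.

HB.instance Definition _ A B C D (f : {malg K[A]} -> {malg K[C]})
    (g : {malg K[B]} -> {malg K[D]}) :=
  GRing.isLinear.Build K {malg K[(A * B)%type]} {malg K[(C * D)%type]} *:%R
    (tmap f g) (lext_linear _).

Lemma tmapU A B C D (f : {malg K[A]} -> {malg K[C]})
    (g : {malg K[B]} -> {malg K[D]}) p :
  tmap f g << p >> = tens (f << p.1 >>) (g << p.2 >>).
Proof. exact: lextU. Qed.

Lemma tmap_tens A B C D (f : {malg K[A]} -> {malg K[C]})
    (g : {malg K[B]} -> {malg K[D]}) x y :
  linear f -> linear g -> tmap f g (tens x y) = tens (f x) (g y).
Proof.
move=> fl gl; apply: (bilinear_eq (F := fun x y => tmap f g (tens x y))
   (G := fun x y => tens (f x) (g y))) => [u c v w|u c v w|u c v w|u c v w|a b].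
- by rewrite !linearP.
- by rewrite tensPl linearP.
- by rewrite gl linearP.
- by rewrite fl tensPl.
- by rewrite tensU tmapU.
Qed.

Lemma tmapPl A B C D (f f1 f2 : {malg K[A]} -> {malg K[C]})
    (g : {malg K[B]} -> {malg K[D]}) (c : K) u :
  (forall a, f << a >> = c *: f1 << a >> + f2 << a >>) ->
  tmap f g u = c *: tmap f1 g u + tmap f2 g u.
Proof.
move=> fE; apply: (linear_eq (f := tmap f g)
  (g := fun u => c *: tmap f1 g u + tmap f2 g u)).
- exact: linearP.
- by apply: linear_combo; apply: linearP.
- by move=> p; rewrite !tmapU fE tensPl.
Qed.

Lemma tmapPr A B C D (f : {malg K[A]} -> {malg K[C]})
    (g g1 g2 : {malg K[B]} -> {malg K[D]}) (c : K) u :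
  (forall a, g << a >> = c *: g1 << a >> + g2 << a >>) ->
  tmap f g u = c *: tmap f g1 u + tmap f g2 u.
Proof.
move=> gE; apply: (linear_eq (f := tmap f g)
  (g := fun u => c *: tmap f g1 u + tmap f g2 u)).
- exact: linearP.
- by apply: linear_combo; apply: linearP.
- by move=> p; rewrite !tmapU gE linearP.
Qed.

(** * Formal sums of lists *)

(** The coproduct of a basis element is the formal sum of its list of cuts; permutations
    of lists become equalities ([perm_lsum]). *)
Definition lsum B (s : seq B) : {malg K[B]} := \sum_(b <- s) << b >>.

Lemma lsum_cat B (s t : seq B) : lsum (s ++ t) = lsum s + lsum t.
Proof. exact: big_cat. Qed.

Lemma lsum_cons B b (s : seq B) : lsum (b :: s) = << b >> + lsum s.
Proof. exact: big_cons. Qed.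

Lemma perm_lsum B (s t : seq B) : perm_eq s t -> lsum s = lsum t.
Proof. exact: perm_big. Qed.

Lemma lext_lsum B (V : lmodType K) (f : B -> V) s :
  lext f (lsum s) = \sum_(b <- s) f b.
Proof. by rewrite linear_sum; apply: eq_bigr => b _; rewrite /= lextU. Qed.

Lemma lsum_map A B (h : A -> B) s :
  lsum (map h s) = \sum_(a <- s) << h a >>.
Proof. exact: big_map. Qed.

Lemma lsum_allpairs A B C (h : A -> B -> C) (s : seq A) (t : A -> seq B) :
  lsum [seq h a b | a <- s, b <- t a] = \sum_(a <- s) \sum_(b <- t a) << h a b >>.
Proof. by rewrite /lsum big_allpairs_dep. Qed.

Lemma msupp_lsum B (s : seq B) b : b \in msupp (lsum s) -> b \in s.
Proof.
apply: contraTT => bs; rewrite -mcoeff_eq0 raddf_sum big1_seq //= => a as_.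
by rewrite mcoeffU; case: eqP => // eab; rewrite -eab as_ in bs.
Qed.

(** The span of the basis elements that satisfy [p]. *)
Definition supported B (p : pred B) (x : {malg K[B]}) : Prop :=
  forall b, b \in msupp x -> p b.

Lemma supported0 B (p : pred B) : supported p 0.
Proof. by move=> b; rewrite msupp0. Qed.

Lemma supportedP B (p : pred B) c x y :
  supported p x -> supported p y -> supported p (c *: x + y).
Proof.
move=> px py b /(fsubsetP (msuppD_le _ _)); rewrite in_fsetU.
by case/orP=> [/(fsubsetP (msuppZ_le _ _))/px|/py].
Qed.

Lemma supportedD B (p : pred B) x y :
  supported p x -> supported p y -> supported p (x + y).
Proof. by move=> px py; rewrite -[x]scale1r; apply: supportedP. Qed.

Lemma supportedZ B (p : pred B) c x : supported p x -> supported p (c *: x).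
Proof.
by move=> px; rewrite -[_ *: x]addr0; apply/supportedP/supported0.
Qed.

Lemma supportedB B (p : pred B) x y :
  supported p x -> supported p y -> supported p (x - y).
Proof.
move=> px py; rewrite addrC -scaleN1r; exact: supportedP.
Qed.

Lemma supported_sum B (p : pred B) (I : eqType) (s : seq I) (F : I -> {malg K[B]}) :
  (forall i, i \in s -> supported p (F i)) -> supported p (\sum_(i <- s) F i).
Proof.
move=> pF; rewrite big_seq; apply: big_ind => //; first exact: supported0.
exact: supportedD.
Qed.

Lemma supportedU B (p : pred B) b : p b -> supported p << b >>.
Proof. by move=> pb c /(fsubsetP msuppU_le); rewrite in_fset1 => /eqP->. Qed.

Lemma supported_lsum B (p : pred B) s : all p s -> supported p (lsum s).
Proof. by move=> /allP ps b /msupp_lsum/ps. Qed.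

Lemma sub_supported B (p q : pred B) x :
  (forall b, p b -> q b) -> supported p x -> supported q x.
Proof. by move=> pq px b /px/pq. Qed.

Lemma supported_lext B C (p : pred B) (q : pred C) (f : B -> {malg K[C]}) x :
  (forall b, p b -> supported q (f b)) -> supported p x ->
  supported q (lext f x).
Proof.
by move=> fq px; apply: supported_sum => b /px/fq; apply: supportedZ.
Qed.

Lemma supported_bext A B C (p : pred A) (q : pred B) (r : pred C)
    (f : A -> B -> {malg K[C]}) x y :
  (forall a b, p a -> q b -> supported r (f a b)) ->
  supported p x -> supported q y -> supported r (bext f x y).
Proof.
move=> fr px qy; rewrite bextE; apply: supported_lext px => a pa.
by apply: supported_lext qy => b; apply: fr.
Qed.

Lemma supported_eq0 B (p : pred B) x b : supported p x -> ~~ p b -> x@_b = 0.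
Proof. by move=> px npb; apply/mcoeff_outdom/(contra _ npb)/px. Qed.

Lemma lext_ind B (V : lmodType K) (P : V -> Prop) (f : B -> V) x :
  P 0 -> (forall c u v, P u -> P v -> P (c *: u + v)) ->
  (forall b, b \in msupp x -> P (f b)) -> P (lext f x).
Proof.
move=> P0 PD Pf; rewrite /lext big_seq; apply: (big_ind P) => //.
  by move=> u v Pu Pv; rewrite -[u]scale1r; apply: PD.
by move=> b bx; rewrite -[_ *: _]addr0; apply: PD => //; apply: Pf.
Qed.

Lemma lext_id B (x : {malg K[B]}) : lext (fun b => << b >>) x = x.
Proof. by rewrite {2}[x]malg_sum. Qed.

End LinearExtension.

Section Bilinear.
Variables (K : fieldType) (B C D : choiceType).
Local Notation V := {malg K[B]}.
Local Notation W := {malg K[C]}.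

(** Both sides of each compatibility axiom are bilinear, which reduces the axioms to
    basis elements. *)
Definition bilin (U : lmodType K) (F : V -> V -> U) : Prop :=
  (forall x, linear (F x)) /\ (forall y, linear (F^~ y)).

Lemma bilin_eq (U : lmodType K) (F G : V -> V -> U) : bilin F -> bilin G ->
  (forall a b, F << a >> << b >> = G << a >> << b >>) -> F =2 G.
Proof. by move=> [F1 F2] [G1 G2]; apply: bilinear_eq. Qed.

Lemma bilin_swap (U : lmodType K) (F : V -> V -> U) :
  bilin F -> bilin (fun x y => F y x).
Proof. by case. Qed.

Lemma bilinD (U : lmodType K) (F G : V -> V -> U) :
  bilin F -> bilin G -> bilin (fun x y => F x y + G x y).
Proof.
move=> [F1 F2] [G1 G2]; split=> [x|y] c u v /=.
  by rewrite F1 G1 scalerDr addrACA.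
by rewrite F2 G2 scalerDr addrACA.
Qed.

Lemma bilin_lin (U : lmodType K) (F : V -> V -> W) (L : W -> U) :
  bilin F -> linear L -> bilin (fun x y => L (F x y)).
Proof.
by move=> [F1 F2] Ll; split=> [x|y] c u v; rewrite ?F1 ?F2 Ll.
Qed.

Lemma bilin_bext (U : lmodType K) (f : B -> B -> U) : bilin (bext f).
Proof. by split=> [x|y] c u v; [apply: linearP | apply: bextPl]. Qed.

End Bilinear.

Section BilinearTensors.
Variables (K : fieldType) (B : choiceType).
Local Notation V := {malg K[B]}.
Local Notation V2 := {malg K[(B * B)%type]}.
Local Notation id := (fun x : V => x).
Variables (M : V -> V -> V) (L : V -> V2).
Hypotheses (Mb : bilin M) (Ll : linear L).

Lemma bilin_tens : bilin (fun x y : V => tens x y).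
Proof. exact: bilin_bext. Qed.

Lemma bilin_tmapl : bilin (fun x y : V => tmap (M x) id (L y)).
Proof.
case: Mb => M1 M2; split=> [x|y] c u v /=; first by rewrite Ll linearP.
by apply: tmapPl => a; apply: M2.
Qed.

Lemma bilin_tmapr : bilin (fun x y : V => tmap id (M x) (L y)).
Proof.
case: Mb => M1 M2; split=> [x|y] c u v /=; first by rewrite Ll linearP.
by apply: tmapPr => a; apply: M2.
Qed.

Lemma bilin_tmap2 (m m' : V -> V -> V) (L' : V -> V2) : linear L' ->
  bilin (fun x y : V => tmap2 m m' (L x) (L' y)).
Proof.
move=> L'l; split=> [x|y] c u v /=; first by rewrite L'l; apply: bext_linearr.
by rewrite Ll; apply: bextPl.
Qed.

End BilinearTensors.

Lemma tmap_lsum (K : fieldType) (A B C D : choiceType)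
    (f : {malg K[A]} -> {malg K[C]}) (g : {malg K[B]} -> {malg K[D]})
    (h : A -> C) (k : B -> D) s :
  (forall a, f << a >> = << h a >>) -> (forall b, g << b >> = << k b >>) ->
  tmap f g (lsum K s) = lsum K [seq (h p.1, k p.2) | p <- s].
Proof.
move=> fh gk; rewrite linear_sum lsum_map; apply: eq_bigr => p _ /=.
by rewrite tmapU fh gk tensU.
Qed.

Section LsumTensors.
Variables (K : fieldType) (B : choiceType).
Local Notation V := {malg K[B]}.

Lemma tmapl_lsum (f : V -> {malg K[(B * B)%type]}) (c : B -> seq (B * B)) s :
  (forall b, f << b >> = lsum K (c b)) ->
  tassoc (tmap f (fun x : V => x) (lsum K s)) =
  lsum K [seq (q.1, (q.2, p.2)) | p <- s, q <- c p.1].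
Proof.
move=> fc; rewrite [tmap _ _ _]linear_sum lsum_allpairs /tassoc linear_sum.
apply: eq_bigr => p _ /=; rewrite tmapU fc /tens bextE lext_lsum linear_sum.
by apply: eq_bigr => q _ /=; rewrite !lextU.
Qed.

Lemma tmapr_lsum (f : V -> {malg K[(B * B)%type]}) (c : B -> seq (B * B)) s :
  (forall b, f << b >> = lsum K (c b)) ->
  tmap (fun x : V => x) f (lsum K s) =
  lsum K [seq (p.1, q) | p <- s, q <- c p.2].
Proof.
move=> fc; rewrite linear_sum lsum_allpairs; apply: eq_bigr => p _ /=.
by rewrite tmapU fc /tens bextUl lext_lsum.
Qed.

Lemma tmap2_lsum (m m' : B -> B -> B) s t :
  tmap2 (bext (fun a b => << m a b >> : V)) (bext (fun a b => << m' a b >>))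
    (lsum K s) (lsum K t)
  = lsum K [seq (m p.1 q.1, m' p.2 q.2) | p <- s, q <- t].
Proof.
rewrite lsum_allpairs /tmap2 bext_suml; apply: eq_bigr => p _.
rewrite bextUl lext_lsum; apply: eq_bigr => q _.
by rewrite !bextU tensU.
Qed.

End LsumTensors.

(** * The bialgebra of a cut bialgebra *)

Section CutAlgebra.
Variables (K : fieldType) (D : cut_bialgebra).
Local Notation A := {malg K[D]}.
Local Notation A2 := {malg K[(D * D)%type]}.
Local Notation deg := (@cb_deg D).
Local Notation "1" := (@cb_one D) : cb_scope.
Local Notation one := (@cb_one D).
Local Notation mul := (@cb_mul D).
Local Notation nw := (@cb_nw D).

Definition acb (b : D) : seq (D * D) := cb_cuts false b ++ cb_cuts true b.

Definition cmul : A -> A -> A := bext (fun a b => << mul a b >>).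
Definition cnw : A -> A -> A := bext (fun a b => << nw a b >>).
(** Here [crho] is rho, [clam] is lambda and [cdel] is Delta, on formal combinations. *)
Definition crho : A -> A2 := lext (fun b => lsum K (cb_cuts false b)).
Definition clam : A -> A2 := lext (fun b => lsum K (cb_cuts true b)).
Definition cdel : A -> A2 := lext (fun b => lsum K (acb b)).

HB.instance Definition _ x := GRing.isLinear.Build K A A *:%R (cmul x) (bext_linearr _ x).
HB.instance Definition _ x := GRing.isLinear.Build K A A *:%R (cnw x) (bext_linearr _ x).
HB.instance Definition _ := GRing.isLinear.Build K A A2 *:%R crho (lext_linear _).
HB.instance Definition _ := GRing.isLinear.Build K A A2 *:%R clam (lext_linear _).
HB.instance Definition _ := GRing.isLinear.Build K A A2 *:%R cdel (lext_linear _).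

Lemma cdelE x : cdel x = crho x + clam x.
Proof.
apply: (linear_eq (f := cdel) (g := fun x => crho x + clam x)) => [|c u v|b].
- exact: linearP.
- by rewrite !linearP scalerDr addrACA.
- by rewrite /cdel /crho /clam !lextU /acb lsum_cat.
Qed.

Lemma crhoU b : crho << b >> = lsum K (cb_cuts false b).
Proof. exact: lextU. Qed.
Lemma cdelU b : cdel << b >> = lsum K (acb b).
Proof. exact: lextU. Qed.

Lemma cmulPl c x y z : cmul (c *: x + y) z = c *: cmul x z + cmul y z.
Proof. exact: bextPl. Qed.
Lemma cnwPl c x y z : cnw (c *: x + y) z = c *: cnw x z + cnw y z.
Proof. exact: bextPl. Qed.

Lemma cmulU a b : cmul << a >> << b >> = << mul a b >>.
Proof. exact: bextU. Qed.
Lemma cnwU a b : cnw << a >> << b >> = << nw a b >>.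
Proof. exact: bextU. Qed.

Lemma trilinear_eq (B : choiceType) (V : lmodType K)
    (F G : {malg K[B]} -> {malg K[B]} -> {malg K[B]} -> V) :
  (forall x y, linear (F x y)) -> (forall x z, linear (fun y => F x y z)) ->
  (forall y z, linear (fun x => F x y z)) ->
  (forall x y, linear (G x y)) -> (forall x z, linear (fun y => G x y z)) ->
  (forall y z, linear (fun x => G x y z)) ->
  (forall a b c, F << a >> << b >> << c >> = G << a >> << b >> << c >>) ->
  forall x y z, F x y z = G x y z.
Proof.
move=> F3 F2 F1 G3 G2 G1 FG x y z.
apply: (linear_eq (F1 y z) (G1 y z)) => a.
apply: (bilinear_eq (F := F << a >>) (G := G << a >>)) => //.
Qed.

Lemma cmulA x y z : cmul x (cmul y z) = cmul (cmul x y) z.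
Proof.
apply: (trilinear_eq (F := fun x y z => cmul x (cmul y z))
  (G := fun x y z => cmul (cmul x y) z)) => [u v c w t|u v c w t|u v c w t|u v c w t|u v c w t|u v c w t|a b c];
  rewrite ?cmulPl ?linearP ?cmulPl //.
by rewrite !cmulU cb_mulA.
Qed.

Lemma cmul1l x : cmul << one >> x = x.
Proof.
rewrite /cmul bextUl -[RHS]lext_id; apply: eq_lext => b.
by rewrite cb_mul1b.
Qed.

(** * Products of tensors *)

Section Star.
Variables m m' : D -> D -> D.

(** For products [m] and [m'], the product of tensors that uses [m] on the left and [m'] on
    the right. With the grafting on the left and the product on the right, it makes rho a
    morphism for the grafting ([crho_nw]). *)
Definition star : A2 -> A2 -> A2 :=
  bext (fun p q => << (m p.1 q.1, m' p.2 q.2) >>).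

HB.instance Definition _ u := GRing.isLinear.Build K A2 A2 *:%R (star u) (bext_linearr _ u).

Lemma starPl c u v w : star (c *: u + v) w = c *: star u w + star v w.
Proof. exact: bextPl. Qed.

Lemma starU p q : star << p >> << q >> = << (m p.1 q.1, m' p.2 q.2) >>.
Proof. exact: bextU. Qed.

Lemma star_lsum s t : star (lsum K s) (lsum K t) =
  lsum K [seq (m p.1 q.1, m' p.2 q.2) | p <- s, q <- t].
Proof.
rewrite lsum_allpairs /star bext_suml; apply: eq_bigr => p _.
by rewrite bextUl lext_lsum.
Qed.

Lemma starA : associative m -> associative m' -> associative star.
Proof.
move=> mA m'A.
apply: (trilinear_eq (F := fun x y z => star x (star y z))
  (G := fun x y z => star (star x y) z)) => [u v c w t|u v c w t|u v c w t|u v c w t|u v c w t|u v c w t|a b c];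
  rewrite ?starPl ?linearP ?starPl //.
by rewrite !starU mA m'A.
Qed.

End Star.

Local Notation MM := (star mul mul).
Local Notation WM := (star nw mul).
Local Notation id := (fun x : A => x).

Definition nonunit (b : D) : bool := b != one.

Lemma crho_nw x y : crho (cnw x y) = WM (crho x) (crho y).
Proof.
apply: (bilinear_eq (F := fun x y => crho (cnw x y)) (G := fun x y => WM (crho x) (crho y)))
  => [u c v w|u c v w|u c v w|u c v w|a b]; rewrite ?cnwPl ?linearP ?starPl //.
by rewrite cnwU /crho !lextU star_lsum; apply/perm_lsum/cb_cutsFW.
Qed.

Lemma clam_nw x y :
  clam (cnw x y) = WM (crho x) (clam y) + tmap id (cnw^~ y) (clam x).
Proof.
apply: (bilinear_eq (F := fun x y => clam (cnw x y))
   (G := fun x y => WM (crho x) (clam y) + tmap id (cnw^~ y) (clam x)))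
  => [u c v w|u c v w|u c v w|u c v w|a b]; rewrite ?cnwPl ?linearP ?starPl //.
- rewrite (@tmapPr _ _ _ _ _ id (cnw^~ (c *: v + w)) (cnw^~ v) (cnw^~ w) c); last first.
    by move=> z; rewrite linearP.
  by rewrite /= scalerDr addrACA.
- by rewrite /= scalerDr addrACA.
rewrite cnwU /crho /clam !lextU star_lsum (perm_lsum _ (cb_cutsTW a b)) lsum_cat.
congr (_ + _); rewrite lsum_map linear_sum; apply: eq_bigr => p _ /=.
by rewrite tmapU cnwU tensU.
Qed.

Section NonUnit.
Variable y : A.
Hypothesis ny : supported nonunit y.

(** [cb_cutsM] may fail when the right factor is the unit, whose cut is in rho only, so that
    the laws of [crho_mul] and [clam_mul] hold on combinations of nonunits. *)
Lemma linear_nonunit (V : lmodType K) (f g : A -> V) : linear f -> linear g ->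
  (forall b, b != one -> f << b >> = g << b >>) -> f y = g y.
Proof.
move=> fl gl fg; rewrite (linear_comb fl) (linear_comb gl) /lext.
by apply: eq_big_seq => b /ny nb; rewrite fg.
Qed.

Lemma crho_mul x : crho (cmul x y) = MM (cdel x) (crho y).
Proof.
apply: (linear_nonunit (f := fun y => crho (cmul x y))
  (g := fun y => MM (cdel x) (crho y))) => [c u v|c u v|b nb].
- by rewrite !linearP.
- by rewrite !linearP.
apply: (linear_eq (f := fun x => crho (cmul x << b >>))
  (g := fun x => MM (cdel x) (crho << b >>))) => [c u v|c u v|a].
- by rewrite cmulPl linearP.
- by rewrite linearP starPl.
by rewrite cmulU /crho /cdel !lextU star_lsum; apply/perm_lsum/cb_cutsM.
Qed.

Lemma clam_mul x : clam (cmul x y) = MM (cdel x) (clam y).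
Proof.
apply: (linear_nonunit (f := fun y => clam (cmul x y))
  (g := fun y => MM (cdel x) (clam y))) => [c u v|c u v|b nb].
- by rewrite !linearP.
- by rewrite !linearP.
apply: (linear_eq (f := fun x => clam (cmul x << b >>))
  (g := fun x => MM (cdel x) (clam << b >>))) => [c u v|c u v|a].
- by rewrite cmulPl linearP.
- by rewrite linearP starPl.
by rewrite cmulU /clam /cdel !lextU star_lsum; apply/perm_lsum/cb_cutsM.
Qed.

End NonUnit.

Lemma acb1 : acb one = [:: (one, one)].
Proof. by rewrite /acb !cb_cuts1. Qed.

Lemma cdel_mul x y : cdel (cmul x y) = MM (cdel x) (cdel y).
Proof.
apply: (bilinear_eq (F := fun x y => cdel (cmul x y)) (G := fun x y => MM (cdel x) (cdel y)))
  => [u c v w|u c v w|u c v w|u c v w|a b]; rewrite ?cmulPl ?linearP ?starPl //.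
have [->|nb] := eqVneq b one.
  rewrite cmulU cb_mulb1 /cdel !lextU acb1 star_lsum /lsum big_allpairs_dep.
  by apply: eq_bigr => -[p q] _; rewrite big_seq1 /= !cb_mulb1.
have nb' : supported nonunit (<< b >> : A) by apply: supportedU.
by rewrite !(cdelE (cmul _ _)) (crho_mul nb') (clam_mul nb') -linearD -cdelE.
Qed.

(** * Primitive elements *)

(** Primitive for both halves, which is stronger than being primitive for Delta. *)
Definition primitive (v : A) : Prop :=
  crho v = tens v << one >> /\ clam v = tens << one >> v.

Lemma star_right v w : MM w (tens v << one >>) = tmap (cmul^~ v) id w.
Proof.
apply: (linear_eq (f := fun w => MM w (tens v << one >>))
  (g := tmap (cmul^~ v) id)) => [c u w'|c u w'|p]; rewrite ?starPl ?linearP //.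
rewrite tmapU; apply: (linear_eq (f := fun v => MM << p >> (tens v << one >>))
  (g := fun v => tens (cmul << p.1 >> v) << p.2 >>)) => [c x y|c x y|b].
- by rewrite tensPl linearP.
- by rewrite linearP tensPl.
by rewrite tensU starU cmulU tensU cb_mulb1.
Qed.

Lemma star_left v w : MM w (tens << one >> v) = tmap id (cmul^~ v) w.
Proof.
apply: (linear_eq (f := fun w => MM w (tens << one >> v))
  (g := tmap id (cmul^~ v))) => [c u w'|c u w'|p]; rewrite ?starPl ?linearP //.
rewrite tmapU; apply: (linear_eq (f := fun v => MM << p >> (tens << one >> v))
  (g := fun v => tens << p.1 >> (cmul << p.2 >> v))) => [c x y|c x y|b].
- by rewrite !linearP.
- by rewrite !linearP.
by rewrite tensU starU cmulU tensU cb_mulb1.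
Qed.

Lemma star_tmap v u w :
  WM u (tmap id (cmul^~ v) w) = tmap id (cmul^~ v) (WM u w).
Proof.
apply: (bilinear_eq (F := fun u w => WM u (tmap id (cmul^~ v) w))
  (G := fun u w => tmap id (cmul^~ v) (WM u w)))
  => [x c y z|x c y z|x c y z|x c y z|p q]; rewrite ?starPl ?linearP //= ?starPl ?linearP //.
rewrite starU !tmapU /=.
apply: (linear_eq (f := fun v => WM << p >> (tens << q.1 >> (cmul << q.2 >> v)))
  (g := fun v => tens << nw p.1 q.1 >> (cmul << mul p.2 q.2 >> v))) => [c x y|c x y|b].
- by rewrite !linearP.
- by rewrite !linearP.
by rewrite !cmulU !tensU starU /= cb_mulA.
Qed.

(** The coproduct of a tree with root [v]: either the whole tree is on the right, or the
    root stays on the left and the forest [y] of its subtrees is cut. *)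
Lemma cdel_graft v y : primitive v ->
  cdel (cnw v y) = tens << one >> (cnw v y) + tmap (cnw v) id (cdel y).
Proof.
case=> rv lv; rewrite cdelE crho_nw clam_nw rv lv tmap_tens //; last first.
  by move=> c a b; rewrite cnwPl.
rewrite addrA [RHS]addrC; congr (_ + _); rewrite -linearD -cdelE.
apply: (linear_eq (f := fun w => WM (tens v << one >>) w)
  (g := tmap (cnw v) id)) => [c u w'|c u w'|p]; rewrite ?starPl ?linearP //.
rewrite tmapU; apply: (linear_eq (f := fun v => WM (tens v << one >>) << p >>)
  (g := fun v => tens (cnw v << p.1 >>) << p.2 >>)) => [c a b|c a b|b].
- by rewrite tensPl starPl.
- by rewrite cnwPl tensPl.
by rewrite tensU starU cnwU tensU cb_mul1b.
Qed.

End CutAlgebra.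

(** * Slices of the two half coproducts *)

Section Rigidity.
Variables (K : fieldType) (D : cut_bialgebra).
Local Notation A := {malg K[D]}.
Local Notation A2 := {malg K[(D * D)%type]}.
Local Notation deg := (@cb_deg D).
Local Notation one := (@cb_one D).
Local Notation mul := (@cb_mul D).
Local Notation nw := (@cb_nw D).
Local Notation MM := (star (K := K) mul mul).
Local Notation WM := (star (K := K) nw mul).
Local Notation id := (fun x : A => x).

Lemma deg1 : deg one = 0%N.
Proof. by apply/eqP; rewrite cb_deg_eq0. Qed.

Lemma deg_gt0 b : (0 < deg b)%N = (b != one).
Proof. by rewrite lt0n cb_deg_eq0. Qed.

Lemma cutsT_right (b : D) p : p \in cb_cuts true b -> p.2 != one.
Proof.
have [->|nb] := eqVneq b one; first by rewrite cb_cuts1.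
rewrite (perm_mem (cb_cuts_proper true nb)) inE => /orP[/eqP->//|].
by rewrite mem_filter => /andP[/andP[]].
Qed.

Lemma cutsF_left (b : D) p : b != one -> p \in cb_cuts false b -> p.1 != one.
Proof.
move=> nb; rewrite (perm_mem (cb_cuts_proper false nb)) inE => /orP[/eqP->//|].
by rewrite mem_filter => /andP[/andP[]].
Qed.

Lemma deg_acb (b : D) p : p \in acb b -> (deg p.1 + deg p.2 = deg b)%N.
Proof. by rewrite mem_cat => /orP[] /cb_deg_cuts. Qed.

Definition ofdeg n : pred D := fun b => deg b == n.
Definition ofdeg2 n : pred (D * D) := fun p => (deg p.1 + deg p.2 == n)%N.

Lemma supported_crho n x : supported (ofdeg n) x -> supported (ofdeg2 n) (crho x : A2).
Proof.
apply: supported_lext => b /eqP <-; apply: supported_lsum; apply/allP=> p pb.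
by apply/eqP/(cb_deg_cuts pb).
Qed.

Lemma supported_clam n x : supported (ofdeg n) x -> supported (ofdeg2 n) (clam x : A2).
Proof.
apply: supported_lext => b /eqP <-; apply: supported_lsum; apply/allP=> p pb.
by apply/eqP/(cb_deg_cuts pb).
Qed.

Lemma supported_cdel n x : supported (ofdeg n) x -> supported (ofdeg2 n) (cdel x : A2).
Proof.
apply: supported_lext => b /eqP <-; apply: supported_lsum; apply/allP=> p pb.
by apply/eqP/(deg_acb pb).
Qed.

Lemma supported_star (m m' : D -> D -> D) (i j : nat) u v :
  (forall a b, deg (m a b) = deg a + deg b)%N ->
  (forall a b, deg (m' a b) = deg a + deg b)%N ->
  supported (ofdeg2 i) u -> supported (ofdeg2 j) v ->
  supported (ofdeg2 (i + j)%N) (star (K := K) m m' u v).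
Proof.
move=> hm hm'; apply: supported_bext => p q /eqP <- /eqP <-; apply: supportedU.
by apply/eqP; rewrite /= hm hm' addnACA.
Qed.

(** Coefficient extraction: [sl1 x] applied to a tensor is the right factor of [x], and
    [sl2 y] is the left factor of [y]. *)
Definition sl1 (x : D) : A2 -> A :=
  lext (fun p => if p.1 == x then << p.2 >> else 0).
Definition sl2 (y : D) : A2 -> A :=
  lext (fun p => if p.2 == y then << p.1 >> else 0).

HB.instance Definition _ x :=
  GRing.isLinear.Build K A2 A *:%R (sl1 x) (lext_linear _).
HB.instance Definition _ y :=
  GRing.isLinear.Build K A2 A *:%R (sl2 y) (lext_linear _).

Lemma sl2_lsum y s :
  sl2 y (lsum K s) = \sum_(p <- s) if p.2 == y then << p.1 >> else 0.
Proof. exact: lext_lsum. Qed.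

Lemma mcoeff_sl1 x u z : (sl1 x u)@_z = u@_(x, z).
Proof.
apply: (linear_eq (f := fun u => (sl1 x u)@_z : K^o) (g := fun u => u@_(x, z) : K^o)).
- by move=> c v w; rewrite linearP mcoeffD mcoeffZ.
- by move=> c v w; rewrite mcoeffD mcoeffZ.
move=> [p q]; rewrite /sl1 lextU mcoeffU xpair_eqE /=.
by case: eqP => _ /=; rewrite ?mcoeffU ?mcoeff0.
Qed.

Lemma mcoeff_sl2 y u z : (sl2 y u)@_z = u@_(z, y).
Proof.
apply: (linear_eq (f := fun u => (sl2 y u)@_z : K^o) (g := fun u => u@_(z, y) : K^o)).
- by move=> c v w; rewrite linearP mcoeffD mcoeffZ.
- by move=> c v w; rewrite mcoeffD mcoeffZ.
move=> [p q]; rewrite /sl2 lextU mcoeffU xpair_eqE /= andbC.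
by case: eqP => _ /=; rewrite ?mcoeffU ?mcoeff0.
Qed.

Lemma supported_sl1 x n u : supported (ofdeg2 n) u ->
  supported (fun b => deg x + deg b == n)%N (sl1 x u).
Proof.
move=> hu b; rewrite -mcoeff_neq0 mcoeff_sl1 mcoeff_neq0 => /hu; exact.
Qed.

Lemma supported_sl2 y n u : supported (ofdeg2 n) u ->
  supported (fun b => deg b + deg y == n)%N (sl2 y u).
Proof.
move=> hu b; rewrite -mcoeff_neq0 mcoeff_sl2 mcoeff_neq0 => /hu; exact.
Qed.

Lemma linear_0 (V W : lmodType K) (g : V -> W) : linear g -> g 0 = 0.
Proof.
by move=> gl; have := gl (-1) 0 0; rewrite scaler0 addr0 scaleN1r addNr.
Qed.

Lemma linear_Z (V W : lmodType K) (g : V -> W) c x : linear g -> g (c *: x) = c *: g x.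
Proof.
by move=> gl; have := gl c x 0; rewrite !addr0 (linear_0 gl) addr0.
Qed.

Lemma sl1_tens x a (z : A) : sl1 x (tens << a >> z) = if a == x then z else 0.
Proof.
apply/malgP=> w; rewrite mcoeff_sl1 mcoeff_tens mcoeffU /=.
by case: eqP => _; rewrite ?mul1r // mul0r mcoeff0.
Qed.

Lemma sl2_tens y a (z : A) : sl2 y (tens z << a >>) = if a == y then z else 0.
Proof.
apply/malgP=> w; rewrite mcoeff_sl2 mcoeff_tens mcoeffU /=.
by case: eqP => _; rewrite ?mulr1 // mulr0 mcoeff0.
Qed.

Lemma sl1_tmap x (g : A -> A) u : linear g -> sl1 x (tmap id g u) = g (sl1 x u).
Proof.
move=> gl; apply: (linear_eq (f := fun u => sl1 x (tmap id g u))
  (g := fun u => g (sl1 x u))) => [c v w|c v w|p].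
- by rewrite !linearP.
- by rewrite linearP gl.
rewrite tmapU sl1_tens /sl1 lextU; case: eqP => // _.
by rewrite linear_0.
Qed.

Lemma sl2_tmap y (g : A -> A) u : linear g -> sl2 y (tmap g id u) = g (sl2 y u).
Proof.
move=> gl; apply: (linear_eq (f := fun u => sl2 y (tmap g id u))
  (g := fun u => g (sl2 y u))) => [c v w|c v w|p].
- by rewrite !linearP.
- by rewrite linearP gl.
rewrite tmapU sl2_tens /sl2 lextU; case: eqP => // _.
by rewrite linear_0.
Qed.

(** The slices of lambda on the left and of rho on the right. They commute ([Lx_Ry]), and
    composites of slices of the same half are combinations of slices of that half
    ([Lx_Lx], [Ry_Ry]): these are the three coassociativity laws. *)
Definition Lx x : A -> A := fun a => sl1 x (clam a).
Definition Ry y : A -> A := fun a => sl2 y (crho a).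

Lemma Lx_linear x : linear (Lx x).
Proof. by move=> c a b; rewrite /Lx !linearP. Qed.
Lemma Ry_linear y : linear (Ry y).
Proof. by move=> c a b; rewrite /Ry !linearP. Qed.

HB.instance Definition _ x := GRing.isLinear.Build K A A *:%R (Lx x) (Lx_linear x).
HB.instance Definition _ y := GRing.isLinear.Build K A A *:%R (Ry y) (Ry_linear y).

Lemma LxE x a : Lx x a = sl1 x (clam a). Proof. by []. Qed.
Lemma RyE y a : Ry y a = sl2 y (crho a). Proof. by []. Qed.

Lemma LxU x b : Lx x << b >> = \sum_(p <- cb_cuts true b) if p.1 == x then << p.2 >> else 0.
Proof. by rewrite /Lx /clam lextU /sl1 lext_lsum. Qed.
Lemma RyU y b : Ry y << b >> = \sum_(p <- cb_cuts false b) if p.2 == y then << p.1 >> else 0.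
Proof. by rewrite /Ry /crho lextU /sl2 lext_lsum. Qed.

Lemma linear_if (V W : lmodType K) (g : V -> W) (b : bool) x : linear g ->
  g (if b then x else 0) = if b then g x else 0.
Proof. by move=> gl; case: b => //; apply: linear_0. Qed.

Lemma sum_if (I : Type) (V : nmodType) (b : bool) (s : seq I) (F : I -> V) :
  (if b then \sum_(i <- s) F i else 0) = \sum_(i <- s) if b then F i else 0.
Proof. by case: b => //; rewrite big1. Qed.

Lemma Lx_Ry x y a : Lx x (Ry y a) = Ry y (Lx x a).
Proof.
apply: (linear_eq (f := fun a => Lx x (Ry y a)) (g := fun a => Ry y (Lx x a)))
  => [c u v|c u v|b]; try by rewrite !linearP.
pose G (t : D * (D * D)) : A :=
  if t.2.2 == y then if t.1 == x then << t.2.1 >> else 0 else 0.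
transitivity (\sum_(t <- [seq (q.1, (q.2, p.2)) | p <- cb_cuts false b, q <- cb_cuts true p.1]) G t).
  rewrite big_allpairs_dep RyU linear_sum; apply: eq_bigr => p _.
  rewrite linear_if; last exact: linearP.
  by rewrite /= LxU sum_if.
rewrite (perm_big _ (cb_coassTF b)) big_allpairs_dep LxU linear_sum.
apply: eq_bigr => p _; rewrite linear_if; last exact: linearP.
rewrite /= RyU sum_if; apply: eq_bigr => q _; rewrite /G /=.
by do 2?case: ifP.
Qed.

(** Extract [x] and [x'] from the coproduct of the left factor. *)
Definition contract1 x x' : A2 -> A := lext (fun p => \sum_(q <- acb p.1)
  if q.1 == x then if q.2 == x' then << p.2 >> else 0 else 0).
Definition contract2 y y' : A2 -> A := lext (fun p => \sum_(q <- acb p.2)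
  if q.2 == y then if q.1 == y' then << p.1 >> else 0 else 0).

Lemma Lx_Lx x x' a : Lx x' (Lx x a) = contract1 x x' (clam a).
Proof.
apply: (linear_eq (f := fun a => Lx x' (Lx x a)) (g := fun a => contract1 x x' (clam a)))
  => [c u v|c u v|b]; try by rewrite /contract1 !linearP.
pose G (t : D * (D * D)) : A :=
  if t.1 == x then if t.2.1 == x' then << t.2.2 >> else 0 else 0.
transitivity (\sum_(t <- [seq (p.1, (q.1, q.2)) | p <- cb_cuts true b, q <- cb_cuts true p.2]) G t).
  rewrite big_allpairs_dep LxU linear_sum; apply: eq_bigr => p _.
  rewrite linear_if; last exact: linearP.
  by rewrite /= LxU sum_if.
rewrite -(perm_big _ (cb_coassTT b)) big_allpairs_dep /clam lextU /contract1 lext_lsum.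
by [].
Qed.

Lemma Ry_Ry y y' a : Ry y' (Ry y a) = contract2 y y' (crho a).
Proof.
apply: (linear_eq (f := fun a => Ry y' (Ry y a)) (g := fun a => contract2 y y' (crho a)))
  => [c u v|c u v|b]; try by rewrite /contract2 !linearP.
pose G (t : D * (D * D)) : A :=
  if t.2.2 == y then if t.2.1 == y' then << t.1 >> else 0 else 0.
transitivity (\sum_(t <- [seq (q.1, (q.2, p.2)) | p <- cb_cuts false b, q <- cb_cuts false p.1]) G t).
  rewrite big_allpairs_dep RyU linear_sum; apply: eq_bigr => p _.
  rewrite linear_if; last exact: linearP.
  by rewrite /= RyU sum_if.
rewrite (perm_big _ (cb_coassFF b)) big_allpairs_dep /crho lextU /contract2 lext_lsum.
by [].
Qed.

Lemma contract1_tmap x x' (g : A -> A) u : linear g ->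
  g (contract1 x x' u) = contract1 x x' (tmap id g u).
Proof.
move=> gl; apply: (linear_eq (f := fun u => g (contract1 x x' u))
  (g := fun u => contract1 x x' (tmap id g u))) => [c v w|c v w|p].
- by rewrite /contract1 linearP gl.
- by rewrite /contract1 !linearP.
have ct z : contract1 x x' (tens << p.1 >> z) =
    \sum_(q <- acb p.1) if q.1 == x then if q.2 == x' then z else 0 else 0.
  apply: (linear_eq (f := fun z => contract1 x x' (tens << p.1 >> z)) (g := fun z => \sum_(q <- acb p.1)
     if q.1 == x then if q.2 == x' then z else 0 else 0)) => [c v w|c v w|b].
  - by rewrite /contract1 !linearP.
  - rewrite scaler_sumr -big_split; apply: eq_bigr => q _ /=.
    by do 2?case: ifP => _; rewrite ?scaler0 ?addr0.
  - by rewrite tensU /contract1 lextU.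
rewrite tmapU ct /contract1 lextU.
pose gL : {linear A -> A} := HB.pack g (GRing.isLinear.Build K A A *:%R g gl).
rewrite -[g]/(gL : A -> A) linear_sum; apply: eq_bigr => q _.
by rewrite !linear_if //; apply: linearP.
Qed.

Lemma contract2_tmap y y' (g : A -> A) u : linear g ->
  g (contract2 y y' u) = contract2 y y' (tmap g id u).
Proof.
move=> gl; apply: (linear_eq (f := fun u => g (contract2 y y' u))
  (g := fun u => contract2 y y' (tmap g id u))) => [c v w|c v w|p].
- by rewrite /contract2 linearP gl.
- by rewrite /contract2 !linearP.
have ct z : contract2 y y' (tens z << p.2 >>) =
    \sum_(q <- acb p.2) if q.2 == y then if q.1 == y' then z else 0 else 0.
  apply: (linear_eq (f := fun z => contract2 y y' (tens z << p.2 >>)) (g := fun z => \sum_(q <- acb p.2)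
     if q.2 == y then if q.1 == y' then z else 0 else 0)) => [c v w|c v w|b].
  - by rewrite /contract2 tensPl !linearP.
  - rewrite scaler_sumr -big_split; apply: eq_bigr => q _ /=.
    by do 2?case: ifP => _; rewrite ?scaler0 ?addr0.
  - by rewrite tensU /contract2 lextU.
rewrite tmapU ct /contract2 lextU.
pose gL : {linear A -> A} := HB.pack g (GRing.isLinear.Build K A A *:%R g gl).
rewrite -[g]/(gL : A -> A) linear_sum; apply: eq_bigr => q _.
by rewrite !linear_if //; apply: linearP.
Qed.

(** The size of [a], which decreases in the rigidity argument: for combinations
    of nonunits, [m = 0] means that [a] is primitive. *)
Definition slices_le m (a : A) : Prop :=
  forall x y, (m < deg x + deg y)%N -> Ry y (Lx x a) = 0.

Lemma contract_eq0 m x x' (u : A2) : (forall p, p \in msupp u -> deg p.1 <= m)%N ->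
  (m < deg x + deg x')%N -> contract1 x x' u = 0.
Proof.
move=> um mx; rewrite /contract1 /lext big1_seq //= => p /um pm.
rewrite big1_seq ?scaler0 //= => q /deg_acb qp.
case: eqP => // e1; case: eqP => // e2; move: mx.
by rewrite -e1 -e2 qp ltnNge pm.
Qed.

Lemma contract2_eq0 m y y' (u : A2) : (forall p, p \in msupp u -> deg p.2 <= m)%N ->
  (m < deg y + deg y')%N -> contract2 y y' u = 0.
Proof.
move=> um my; rewrite /contract2 /lext big1_seq //= => p /um pm.
rewrite big1_seq ?scaler0 //= => q /deg_acb qp.
case: eqP => // e1; case: eqP => // e2; move: my.
by rewrite -e1 -e2 addnC qp ltnNge pm.
Qed.

Lemma nonunit_Lx x a : supported (@nonunit D) (Lx x a).
Proof.
apply: (lext_ind (P := fun u => supported (@nonunit D) (sl1 x u))).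
- by rewrite linear0; apply: supported0.
- by move=> c u v hu hv; rewrite linearP; apply: supportedP.
move=> b _; rewrite /sl1 lext_lsum; apply: supported_sum => p pb.
by case: eqP => _; [apply/supportedU/(cutsT_right pb) | apply: supported0].
Qed.

Lemma nonunit_Ry y a : supported (@nonunit D) a -> supported (@nonunit D) (Ry y a).
Proof.
move=> na; apply: (lext_ind (P := fun u => supported (@nonunit D) (sl2 y u))).
- by rewrite linear0; apply: supported0.
- by move=> c u v hu hv; rewrite linearP; apply: supportedP.
move=> b /na nb; rewrite /sl2 lext_lsum; apply: supported_sum => p pb.
by case: eqP => _; [apply/supportedU/(cutsF_left nb pb) | apply: supported0].
Qed.

Lemma Lx1 a : supported (@nonunit D) a -> Lx one a = a.
Proof.
move=> na; apply: (linear_nonunit na (f := Lx one) (g := id)) => [||b nb].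
- exact: linearP.
- by [].
rewrite LxU (perm_big _ (cb_cuts_proper true nb)) big_cons eqxx big_filter big1 /= ?addr0 //.
by move=> p /andP[/negbTE->].
Qed.

Lemma Ry1 a : supported (@nonunit D) a -> Ry one a = a.
Proof.
move=> na; apply: (linear_nonunit na (f := Ry one) (g := id)) => [||b nb].
- exact: linearP.
- by [].
rewrite RyU (perm_big _ (cb_cuts_proper false nb)) big_cons eqxx big_filter big1 /= ?addr0 //.
by move=> p /andP[_ /negbTE->].
Qed.

Lemma primitive_slices v : supported (@nonunit D) v ->
  (forall x, x != one -> Lx x v = 0) -> (forall y, y != one -> Ry y v = 0) ->
  primitive v.
Proof.
move=> nv hL hR; split; apply/malgP=> -[a b].
  rewrite -mcoeff_sl2 -/(Ry b v) mcoeff_tens mcoeffU /= eq_sym.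
  have [->|nb] := eqVneq; first by rewrite Ry1 // mulr1.
  by rewrite hR // mcoeff0 mulr0.
rewrite -mcoeff_sl1 -/(Lx a v) mcoeff_tens mcoeffU /= eq_sym.
have [->|nb] := eqVneq; first by rewrite Lx1 // mul1r.
by rewrite hL // mcoeff0 mul0r.
Qed.

(** A further slice of [Ry y (Lx x a)] by [x'] is a combination of slices of [a] of total
    degree [m] plus the degree of [x'], by [Lx_Lx]; these vanish unless [x'] is the unit,
    and similarly on the right. *)
Lemma primitive_top m a x y : supported (@nonunit D) a -> slices_le m a ->
  (deg x + deg y)%N = m -> primitive (Ry y (Lx x a)).
Proof.
move=> na am xy; apply: primitive_slices => [|x' nx|y' ny].
- exact/nonunit_Ry/nonunit_Lx.
- rewrite Lx_Ry Lx_Lx (contract1_tmap _ _ _ (Ry_linear y)).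
  apply: (@contract_eq0 (m - deg y)) => [p|]; last first.
    by rewrite -xy; have := deg_gt0 x'; rewrite nx; lia.
  case: p => X z; rewrite -mcoeff_neq0 -mcoeff_sl1 (sl1_tmap _ _ (Ry_linear y)).
  rewrite -/(Lx X a) leqNgt => hz; apply/negP=> /= h; move: hz.
  by rewrite am ?mcoeff0 ?eqxx //; lia.
rewrite -Lx_Ry -Lx_Ry Ry_Ry (contract2_tmap _ _ _ (Lx_linear x)).
apply: (@contract2_eq0 (m - deg x)) => [p|]; last first.
  by rewrite -xy; have := deg_gt0 y'; rewrite ny; lia.
case: p => z Y; rewrite -mcoeff_neq0 -mcoeff_sl2 (sl2_tmap _ _ (Lx_linear x)).
rewrite -/(Ry Y a) Lx_Ry leqNgt => hz; apply/negP=> /= h; move: hz.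
by rewrite am ?mcoeff0 ?eqxx //; lia.
Qed.

End Rigidity.

(** * Leading terms of grafted elements *)

Section LeadingTerms.
#[local] Opaque tmap tens star clam crho cdel sl1 sl2 cmul cnw Lx Ry.
Variables (K : fieldType) (D : cut_bialgebra).
Local Notation A := {malg K[D]}.
Local Notation A2 := {malg K[(D * D)%type]}.
Local Notation deg := (@cb_deg D).
Local Notation one := (@cb_one D).
Local Notation mul := (@cb_mul D).
Local Notation nw := (@cb_nw D).
Local Notation MM := (star (K := K) mul mul).
Local Notation WM := (star (K := K) nw mul).
Local Notation id := (fun x : A => x).
Local Notation cmul := (@cmul K D).
Local Notation cnw := (@cnw K D).

(** The top slices of [X nw (Y v)] for [v] primitive have the coefficients of this tensor;
    see [graft_slices]. *)
Definition tau (p : D * D) : A2 := WM (crho << p.1 >>) (cdel << p.2 >>).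

Definition tau_span N (u : A2) : Prop :=
  exists2 c : A2, supported (@ofdeg2 D N) c & u = lext tau c.

Lemma tau_spanP N c u v : tau_span N u -> tau_span N v -> tau_span N (c *: u + v).
Proof.
move=> [x hx ->] [y hy ->]; exists (c *: x + y); first exact: supportedP.
by rewrite linearP.
Qed.

Lemma tau_span0 N : tau_span N 0.
Proof. by exists 0; [apply: supported0 | rewrite linear0]. Qed.

Lemma tau_spanB N u v : tau_span N u -> tau_span N v -> tau_span N (u - v).
Proof. by move=> hu hv; rewrite addrC -scaleN1r; apply: tau_spanP. Qed.

Lemma tau_span_lsum N s : (forall p, p \in s -> tau_span N << p >>) ->
  tau_span N (lsum K s).
Proof.
move=> hs; rewrite /lsum big_seq; apply: (big_ind (tau_span N)) => //.
  exact: tau_span0.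
by move=> u v hu hv; rewrite -[u]scale1r; apply: tau_spanP.
Qed.

Lemma tau_span_star N z u : tau_span N u ->
  tau_span (deg z + N)%N (WM (crho << z >>) u).
Proof.
case=> c hc ->; exists (lext (fun p => << (nw z p.1, p.2) >>) c).
  apply: supported_lext hc => p /eqP hp; apply: supportedU.
  by rewrite /ofdeg2 /= cb_degW -addnA hp.
apply: (linear_eq (f := fun c => WM (crho << z >>) (lext tau c))
  (g := fun c => lext tau (lext (fun p => << (nw z p.1, p.2) >>) c)))
  => [k x y|k x y|p]; try by rewrite !linearP.
rewrite !lextU /tau /= -cnwU crho_nw starA //; [exact: cb_nwA | exact: cb_mulA].
Qed.

(** Induction on the total degree, and then on the degree of the left factor. If [a] is
    not the unit, then [1 (x) c] is in the span by induction, the product by [rho(a)]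
    stays in the span, and it is [a (x) c] plus terms with a smaller left factor. If [a]
    is the unit, Delta(c) is in the span and is [1 (x) c] plus terms with a nonunit left
    factor, already treated. *)
Lemma tau_surj N p : (deg p.1 + deg p.2)%N = N -> tau_span N << p >>.
Proof.
elim/ltn_ind: N p => N IHN.
have nonunit_case a c : a != one -> (deg a + deg c)%N = N -> tau_span N << (a, c) >>.
  have [k ak] := ubnP (deg a); elim: k a c ak => // k IHk a c; rewrite ltnS => ak na eN.
  have cN : (deg c < N)%N by rewrite -eN -[ltnLHS]add0n ltn_add2r deg_gt0.
  have hc : tau_span (deg c) << (one, c) >> by apply: IHN; rewrite //= deg1.
  have := tau_span_star a hc; rewrite eN.
  rewrite crhoU.
  have -> : << (one, c) >> = lsum K [:: (one, c)] :> A2 by rewrite /lsum big_seq1.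
  rewrite star_lsum (perm_lsum _ (perm_allpairs _ (cb_cuts_proper false na) (perm_refl _))).
  rewrite /= lsum_cons cb_nwb1 cb_mul1b => h.
  rewrite -[<< _ >>](addrK (lsum K (flatten [seq [:: (nw q.1 one, mul q.2 c)]
     | q <- filter (proper_cut one) (cb_cuts false a)]))).
  apply: tau_spanB; first exact: h.
  apply: tau_span_lsum => p /flattenP[t /mapP[[u w] hq ->]]; rewrite inE => /eqP ->.
  move: hq; rewrite mem_filter => /andP[/andP[/= nu nw'] /cb_deg_cuts /= hq].
  rewrite -deg_gt0 in nw'; apply: IHk; rewrite cb_nwb1 //=; first by lia.
  by rewrite cb_degM; lia.
case=> a c /= eN; have [ea|na] := eqVneq a one; last exact: nonunit_case.
rewrite {}ea deg1 add0n in eN *.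
have hD : tau_span N (cdel << c >>).
  exists << (one, c) >>; first by apply: supportedU; apply/eqP; rewrite /= deg1.
  rewrite lextU /tau /= crhoU cb_cuts1 cdelU star_lsum.
  congr lsum; rewrite /= cats0 -[LHS]map_id; apply: eq_map => -[x y] /=.
  by rewrite cb_nw1b cb_mul1b.
have [ec|nc] := eqVneq c one.
  by move: hD; rewrite ec cdelU acb1 /lsum big_seq1.
move: hD; rewrite cdelU /acb lsum_cat (perm_lsum _ (cb_cuts_proper true nc)) lsum_cons.
rewrite addrC -addrA => h.
rewrite -[<< _ >>](addrK (lsum K (filter (proper_cut one) (cb_cuts true c))
   + lsum K (cb_cuts false c))).
apply: tau_spanB; first exact: h.
rewrite -lsum_cat; apply: tau_span_lsum => -[x y]; rewrite mem_cat => /orP[|hp].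
  rewrite mem_filter => /andP[/andP[nx _] /cb_deg_cuts hp].
  by apply: nonunit_case; rewrite // -eN.
apply: nonunit_case; first exact: cutsF_left hp.
by rewrite -eN; apply: cb_deg_cuts hp.
Qed.

Lemma cdel_left b y : (deg b <= deg y)%N ->
  sl2 y (cdel << b >>) = if b == y then << one >> else 0 :> A.
Proof.
move=> hb; rewrite cdelU sl2_lsum.
have [->|nb] := eqVneq b one.
  by rewrite acb1 big_seq1.
rewrite /acb big_cat /= [X in X + _]big1_seq; last first.
  move=> p /= hp; case: eqP => // ep; have := cutsF_left nb hp.
  by rewrite -deg_gt0; have := cb_deg_cuts hp; rewrite ep; lia.
rewrite add0r (perm_big _ (cb_cuts_proper true nb)) big_cons /= big1_seq ?addr0 //.
move=> p /=; rewrite mem_filter => /andP[/andP[np1 _] /cb_deg_cuts hp].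
case: eqP => // ep; move: np1; rewrite -deg_gt0.
by move: hp; rewrite ep; lia.
Qed.

Lemma sl2_cdel h y n : supported (@ofdeg D n) h -> (n <= deg y)%N ->
  sl2 y (cdel h) = h@_y *: << one >> :> A.
Proof.
move=> hh ny.
have lin : linear (fun h : A => h@_y *: << one >> : A).
  by move=> c u v; rewrite mcoeffD mcoeffZ scalerDl scalerA.
rewrite (linear_comb lin).
have lin2 : linear (fun h : A => sl2 y (cdel h)) by move=> c u v; rewrite !linearP.
rewrite (linear_comb lin2); apply: eq_in_lext => b /hh /eqP bn.
rewrite cdel_left ?bn // mcoeffU; case: eqP => _; last by rewrite scale0r.
by rewrite scale1r.
Qed.

Lemma sl1D x (u w : A2) : sl1 x (u + w) = sl1 x u + sl1 x w.
Proof. exact: linearD. Qed.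

Lemma RyD y (u w : A) : Ry y (u + w) = Ry y u + Ry y w.
Proof. exact: linearD. Qed.

Lemma LxD x (u w : A) : Lx x (u + w) = Lx x u + Lx x w.
Proof. exact: linearD. Qed.

Lemma LxB x (u w : A) : Lx x (u - w) = Lx x u - Lx x w.
Proof. exact: linearB. Qed.

Lemma RyB y (u w : A) : Ry y (u - w) = Ry y u - Ry y w.
Proof. exact: linearB. Qed.

Section Lead.
Variables (v : A) (d : nat).
Hypothesis pv : primitive v.
Hypothesis dv : supported (@ofdeg D d) v.
Hypothesis d0 : (0 < d)%N.

Let nv : supported (@nonunit D) v.
Proof. by move=> b /dv /eqP bd; rewrite /nonunit -deg_gt0 bd. Qed.

Lemma cmul_linear_l (w : A) : linear (fun x : A => cmul x w).
Proof. by move=> c x y; rewrite cmulPl. Qed.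

Lemma cnw_linear_l (w : A) : linear (fun x : A => cnw x w).
Proof. by move=> c x y; rewrite cnwPl. Qed.

Definition graft (p : D * D) : A := cnw << p.1 >> (cmul << p.2 >> v).

Lemma crho_prim h : crho (cmul h v) = tmap (cmul^~ v) id (cdel h).
Proof. by rewrite (crho_mul nv) pv.1 star_right. Qed.

Lemma clam_prim h : clam (cmul h v) = tmap id (cmul^~ v) (cdel h).
Proof. by rewrite (clam_mul nv) pv.2 star_left. Qed.

Lemma clam_graft p : clam (graft p) =
  tmap id (cmul^~ v) (tau p) + tmap id (cnw^~ (cmul << p.2 >> v)) (clam << p.1 >>).
Proof. by rewrite clam_nw clam_prim star_tmap. Qed.

Definition low (e k : nat) : pred (D * D) :=
  fun p => (deg p.1 + deg p.2 == e)%N && (k <= deg p.1)%N.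

Lemma supported_star_low e k e' k' u w : supported (low e k) u ->
  supported (low e' k') w -> supported (low (e + e')%N (k + k')%N) (WM u w).
Proof.
apply: supported_bext => p q /andP[/eqP pe pk] /andP[/eqP qe qk].
by apply: supportedU; rewrite /low /= cb_degW cb_degM; apply/andP; split; lia.
Qed.

Lemma sl2_low e k u y : supported (low e k) u -> (e < k + deg y)%N -> sl2 y u = 0 :> A.
Proof.
move=> hu he; apply/malgP=> z; rewrite mcoeff0 mcoeff_sl2.
apply: (supported_eq0 hu); rewrite /low /=; lia.
Qed.

(** Lambda of [X nw (Y v)] has two parts. In the first one [v] is on the right and comes
    with [tau]. In the second one the greatest element of [X] is on the right, and the
    degrees are then too small for a slice of this size. *)
Lemma graft_slices p x y : (deg p.1 + deg p.2 <= deg x + deg y)%N ->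
  Ry y (Lx x (graft p)) = (tau p)@_(x, y) *: v.
Proof.
case: p => X Y hxy; have eg := clam_graft (X, Y); rewrite /= in eg; rewrite LxE eg sl1D RyD.
rewrite -> (sl1_tmap x (tau (X, Y)) (cmul_linear_l v)).
rewrite -> (sl1_tmap x (clam << X >>) (cnw_linear_l (cmul << Y >> v))).
have htau : supported (@ofdeg2 D (deg X + deg Y)%N) (tau (X, Y)).
  apply: supported_star; [exact: cb_degW | exact: cb_degM | |].
    by apply/supported_crho/supportedU/eqP.
  by apply/supported_cdel/supportedU/eqP.
(* What remains of X is nonempty and its greatest element stays on the left of rho,
   as does v; so the left factors have degree at least 1 + d. *)
have -> : Ry y (cnw (sl1 x (clam << X >>)) (cmul << Y >> v)) = 0.
  have hX : supported (@ofdeg2 D (deg X)) (clam << X >> : A2).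
    by apply/supported_clam/supportedU/eqP.
  have [hle|hlt] := leqP (deg x) (deg X); last first.
    have -> : sl1 x (clam << X >>) = 0 :> A.
      apply/malgP=> z; rewrite mcoeff0; apply: (supported_eq0 (supported_sl1 hX)).
      by apply/eqP; lia.
    by rewrite (linear_0 (cnw_linear_l _)) linear0.
  rewrite RyE crho_nw crho_prim.
  apply: (@sl2_low ((deg X - deg x) + (deg Y + d))%N (1 + d)%N); last by rewrite /= in hxy; lia.
  apply: supported_star_low.
    have hL : supported (fun b => nonunit b && (deg x + deg b == deg X)%N)
         (sl1 x (clam << X >>) : A).
      move=> b hb; apply/andP; split; first exact: (nonunit_Lx hb).
      exact: (supported_sl1 hX hb).
    apply: supported_lext hL => b /andP[nb /eqP hb]; apply: supported_lsum.
    apply/allP=> q hq; rewrite /low deg_gt0 (cutsF_left nb hq) andbT.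
    by rewrite (cb_deg_cuts hq); apply/eqP; lia.
  apply: supported_lext; last by apply: (@supported_cdel _ _ (deg Y)); apply/supportedU/eqP.
  move=> q /eqP hq; apply: (@supported_bext _ _ _ _ (fun a => deg a == deg q.1 + d)%N (pred1 q.2)).
  - by move=> a b /eqP ha /eqP ->; apply: supportedU; rewrite /low /= ha; apply/andP; split; lia.
  - apply: (@supported_bext _ _ _ _ (pred1 q.1) (@ofdeg D d)) => //.
      by move=> a b /eqP -> /eqP hb; apply: supportedU; rewrite cb_degM hb.
    by apply: supportedU; rewrite /= eqxx.
  - by apply: supportedU; rewrite /= eqxx.
rewrite addr0 RyE crho_prim (sl2_tmap _ _ (cmul_linear_l v)).
have hs : supported (@ofdeg D (deg X + deg Y - deg x)%N) (sl1 x (tau (X, Y))).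
  by apply: sub_supported (supported_sl1 htau) => b; rewrite /ofdeg; lia.
rewrite (sl2_cdel hs); last by rewrite /= in hxy; lia.
by rewrite (linear_Z _ _ (cmul_linear_l v)) cmul1l mcoeff_sl1.
Qed.

Definition dec_of n : pred D := fun b => cb_dec b && (deg b == n).

Lemma dec_graft p : (0 < deg p.1 + deg p.2)%N ->
  supported (dec_of (deg p.1 + deg p.2 + d)%N) (graft p).
Proof.
case: p => X Y hp; rewrite /graft /=.
have nn b : ofdeg d b -> b != one by move/eqP=> bd; rewrite -deg_gt0 bd.
apply: (@supported_bext _ _ _ _ (pred1 X) (fun b => (b != one) && (deg b == deg Y + d)%N
   && ((Y != one) ==> cb_dec b))).
- move=> a b /eqP -> /andP[/andP[nb /eqP bd] hb]; apply: supportedU; rewrite /dec_of.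
  rewrite cb_degW bd addnA eqxx andbT.
  have [eX|nX] := eqVneq X one.
    move: hp; rewrite eX /= deg1 add0n deg_gt0 => nY; rewrite cb_nw1b.
    by move: hb; rewrite nY.
  by apply/cb_decP; exists X, b; split=> //; right.
- by apply: supportedU; rewrite /= eqxx.
apply: (@supported_bext _ _ _ _ (pred1 Y) (@ofdeg D d)) => //; last first.
  by apply: supportedU; rewrite /= eqxx.
move=> a b /eqP -> hb; apply: supportedU; have nb := nn _ hb.
rewrite cb_degM (eqP hb) eqxx andbT -deg_gt0 cb_degM (eqP hb) addn_gt0 d0 orbT /=.
by apply/implyP=> nY; apply/cb_decP; exists Y, b; split=> //; left.
Qed.

(** A decomposable element whose only top slice is the one at [p0], where it is [v]. *)
Lemma lead_exists m p0 : (0 < m)%N -> (deg p0.1 + deg p0.2)%N = m ->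
  exists2 b : A, supported (dec_of (m + d)%N) b &
    forall x y, (m <= deg x + deg y)%N ->
      Ry y (Lx x b) = if (x, y) == p0 then v else 0.
Proof.
move=> m0 /tau_surj [c hc ec].
exists (lext graft c).
  apply: supported_lext hc => p /eqP hp; rewrite -hp; apply: dec_graft.
  by rewrite hp.
move=> x y xy.
suff -> : Ry y (Lx x (lext graft c)) = (lext tau c)@_(x, y) *: v.
  by rewrite -ec mcoeffU eq_sym; case: eqP => _; rewrite ?scale1r ?scale0r.
have lin1 : linear (fun c => Ry y (Lx x (lext graft c))).
  by move=> k s t; rewrite !linearP.
have lin2 : linear (fun c => (lext tau c)@_(x, y) *: v).
  by move=> k s t; rewrite linearP mcoeffD mcoeffZ scalerDl scalerA.
rewrite (linear_comb lin1) (linear_comb lin2); apply: eq_in_lext => p /hc /eqP hp.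
by rewrite !lextU graft_slices // hp.
Qed.

End Lead.

(** * Primitive elements modulo decomposable ones *)

Lemma dec_of_deg n (a : A) : supported (dec_of n) a -> supported (@ofdeg D n) a.
Proof. by apply: sub_supported => b /andP[]. Qed.

Lemma lead_exists_list n m (a : A) (s : seq (D * D)) : (0 < m < n)%N -> uniq s ->
  supported (@ofdeg D n) a -> slices_le m a ->
  (forall p, p \in s -> (deg p.1 + deg p.2)%N = m) ->
  exists2 b : A, supported (dec_of n) b &
    forall x y, (m <= deg x + deg y)%N ->
      Ry y (Lx x b) = if (x, y) \in s then Ry y (Lx x a) else 0.
Proof.
move=> /andP[m0 mn] us na am; elim: s us => [|p s IHs] /=.
  by exists 0; [apply: supported0 | move=> x y _; rewrite !linear0].
move=> /andP[ps us] hs.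
have [|b hb eb] := IHs us; first by move=> q qs; apply: hs; rewrite inE qs orbT.
have hp := hs p (mem_head _ _).
have nua : supported (@nonunit D) a.
  by move=> c /na /eqP hc; rewrite /nonunit -deg_gt0 hc; lia.
have pv := primitive_top nua am hp.
have dv : supported (@ofdeg D (n - m)%N) (Ry p.2 (Lx p.1 a)).
  have h1 : supported (@ofdeg D (n - deg p.1)%N) (Lx p.1 a).
    apply: sub_supported (supported_sl1 (supported_clam na)) => c.
    by rewrite /ofdeg; lia.
  apply: sub_supported (supported_sl2 (supported_crho h1)) => c.
  by rewrite /ofdeg; lia.
have [|b' hb' eb'] := lead_exists pv dv _ m0 hp; first by rewrite subn_gt0.
exists (b + b').
  by apply: supportedD => //; move: hb'; rewrite subnKC // ltnW.
move=> x y xy; rewrite -> LxD, RyD, (eb _ _ xy), (eb' _ _ xy); rewrite inE.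
case: eqVneq => [exy|nxy] /=; last by rewrite addr0.
by rewrite exy (negbTE ps) add0r -exy.
Qed.

(** Correct all the top slices of [a]; only finitely many are nonzero. *)
Lemma rigidity_step n m (a : A) : (0 < m < n)%N ->
  supported (@ofdeg D n) a -> slices_le m a ->
  exists2 b : A, supported (dec_of n) b & slices_le m.-1 (a - b).
Proof.
move=> mn na am.
(* Outside this list the top slices vanish, because x does not occur on the left
   of lambda or y does not occur on the right of rho. *)
pose s := undup [seq p <- [seq (p.1, q.2) | p <- msupp (clam a), q <- msupp (crho a)]
                   | deg p.1 + deg p.2 == m]%N.
have [|b hb eb] := @lead_exists_list n m a s mn (undup_uniq _) na am.
  by move=> p; rewrite mem_undup mem_filter => /andP[/eqP].
exists b => // x y xy; have xy' : (m <= deg x + deg y)%N by lia.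
rewrite -> LxB, RyB, (eb _ _ xy').
have [//|xys] := boolP ((x, y) \in s); first by rewrite subrr.
rewrite subr0; have [/eqP hxy|nxy] := boolP (deg x + deg y == m)%N; last first.
  by apply: am; lia.
move: xys; rewrite mem_undup mem_filter /= hxy eqxx /= => /allpairsP h.
have [hx|nx] := boolP (x \in [seq p.1 | p <- msupp (clam a)]); last first.
  rewrite (_ : Lx x a = 0) ?linear0 //; apply/malgP=> z.
  rewrite mcoeff_sl1 mcoeff0; apply/mcoeff_outdom; apply: contra nx => hz.
  by apply/mapP; exists (x, z).
have [hy|ny] := boolP (y \in [seq p.2 | p <- msupp (crho a)]); last first.
  rewrite -Lx_Ry (_ : Ry y a = 0) ?linear0 //; apply/malgP=> z.
  rewrite mcoeff_sl2 mcoeff0; apply/mcoeff_outdom; apply: contra ny => hz.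
  by apply/mapP; exists (z, y).
case: h; case/mapP: hx => p hp ->; case/mapP: hy => q hq ->.
by exists (p, q).
Qed.

(** The slices of [a] have no component on the unit, so they vanish in total degree more
    than [n - 1]; [rigidity_step] is applied until total degree [0] is reached. *)
Theorem primitive_projection n (a : A) : (0 < n)%N -> supported (@ofdeg D n) a ->
  exists2 b : A, supported (dec_of n) b & primitive (a - b).
Proof.
move=> n0 na.
have nonu (z : A) : supported (@ofdeg D n) z -> supported (@nonunit D) z.
  by move=> hz c /hz /eqP hc; rewrite /nonunit -deg_gt0 hc.
have top (z : A) : supported (@ofdeg D n) z -> slices_le n.-1 z.
  move=> hz x y xy; apply/malgP=> c; rewrite mcoeff0; apply/mcoeff_outdom/negP=> hc.
  have := nonunit_Ry (nonunit_Lx (a := z)) hc; rewrite /nonunit -deg_gt0.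
  have h1 : supported (@ofdeg D (n - deg x)%N) (Lx x z).
    apply: sub_supported (supported_sl1 (supported_clam hz)) => e.
    by rewrite /ofdeg; lia.
  have := supported_sl2 (supported_crho h1) hc; lia.
have reach k : (k < n)%N ->
  exists2 b : A, supported (dec_of n) b & slices_le (n.-1 - k)%N (a - b).
  elim: k => [|k IHk] kn.
    exists 0; first exact: supported0.
    by rewrite subn0 subr0; apply: top.
  have [b hb hs] := IHk (ltnW kn).
  have hab : supported (@ofdeg D n) (a - b) by apply/supportedB/dec_of_deg.
  have [|b' hb' hs'] := rigidity_step _ hab hs; first by lia.
  exists (b + b'); first exact: supportedD.
  by rewrite opprD addrA subnS.
have [|b hb hs] := reach n.-1; first by rewrite prednK.
exists b => //; have hab : supported (@nonunit D) (a - b) by apply/nonu/supportedB/dec_of_deg.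
move: hs; rewrite subnn => hs; apply: primitive_slices => // [x|y] nx.
  rewrite -(Ry1 (nonunit_Lx (x := x) (a := a - b))); apply: hs.
  by rewrite deg1 addn0 deg_gt0.
by rewrite -(Lx1 hab); apply: hs; rewrite deg1 add0n deg_gt0.
Qed.

End LeadingTerms.

Local Close Scope ring_scope.

(** * The coproduct of plane forests *)

Section ForestInduction.
Variables (D : Type) (Q : pforest D -> Prop).
Hypothesis Q0 : Q [::].
Hypothesis Qcons : forall d s F, Q s -> Q F -> Q (PNode d s :: F).

(** Forests are binary: a nonempty one is a root, the forest of its subtrees and the
    remaining forest. *)
Lemma pforest_ind F : Q F.
Proof.
pose tree_ind := fix tree_ind (t : ptree D) : forall F, Q F -> Q (t :: F) :=
  let: PNode d s := t in fun F hF =>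
  Qcons d ((fix go s := match s return Q s with
            | [::] => Q0 | u :: s' => tree_ind u s' (go s') end) s) hF.
by elim: F => //= t F; apply: tree_ind.
Qed.

End ForestInduction.

Section Sublists.
Variable (T : eqType).
Implicit Types (s L : seq T).

Fixpoint sublists s : seq (seq T) :=
  if s is x :: s' then map (cons x) (sublists s') ++ sublists s' else [:: [::]].

Lemma mem_sublists s L : (L \in sublists s) = subseq L s.
Proof.
elim: s L => [|x s IHs] L; first by rewrite inE subseq0.
rewrite /= mem_cat IHs; case: L => [|y L] /=.
  by rewrite sub0seq orbT.
have [->|nyx] := eqVneq y x.
  rewrite mem_map ?IHs; last by move=> ? ? [].
  by apply/orP/idP=> [[//|]|->]; [apply/subseq_trans/subseq_cons | left].
suff /negbTE-> : y :: L \notin map (cons x) (sublists s) by [].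
by apply/mapP=> -[L' _ [eyx]]; rewrite eyx eqxx in nyx.
Qed.

Lemma sublists_uniq s : uniq s -> uniq (sublists s).
Proof.
elim: s => //= x s IHs /andP[xs us]; rewrite cat_uniq IHs // andbT.
rewrite map_inj_uniq ?IHs //=; last by move=> ? ? [].
apply/hasPn=> L; rewrite mem_sublists => Ls; apply/mapP=> -[L' _ eL].
by case/negP: xs; apply: (mem_subseq Ls); rewrite eL mem_head.
Qed.

End Sublists.

Section SublistSums.
Variables (T U : eqType) (V : nmodType).
Local Open Scope ring_scope.

Lemma big_sublists_cat (s1 s2 : seq T) (G : seq T -> V) :
  \sum_(L <- sublists (s1 ++ s2)) G L =
  \sum_(L1 <- sublists s1) \sum_(L2 <- sublists s2) G (L1 ++ L2).
Proof.
elim: s1 G => [|x s1 IHs] G /=; first by rewrite big_seq1.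
by rewrite big_cat big_map /= !IHs big_cat big_map.
Qed.

Lemma big_sublists_map (f : U -> T) s (G : seq T -> V) :
  \sum_(L <- sublists (map f s)) G L = \sum_(L <- sublists s) G (map f L).
Proof.
elim: s G => [|x s IHs] G /=; first by rewrite !big_seq1.
by rewrite !big_cat !big_map /= !IHs.
Qed.

End SublistSums.

Section CKCuts.
Variable D : graded_set.
Implicit Types (F : pforest D) (p : pred (seq nat)).
Notation address := (seq nat).

(** The addresses of [F] when its roots are numbered from [i], so that the tails of a
    forest keep their addresses. *)
Definition addr_from i F : seq address :=
  flatten (mapi (fun i u => map (cons i) (taddr u)) i F).

Definition induced_from i p F : pforest D :=
  flatten (mapi (fun i u => tinduced (fun a => p (i :: a)) u) i F).

Lemma addr_from_cons i d s F :
  addr_from i (PNode d s :: F) =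
  map (cons i) ([::] :: addr_from 0 s) ++ addr_from i.+1 F.
Proof. by []. Qed.

Lemma induced_from_cons i p d s F :
  induced_from i p (PNode d s :: F) =
  (if p [:: i] then [:: PNode d (induced_from 0 (fun a => p (i :: a)) s)]
   else induced_from 0 (fun a => p (i :: a)) s) ++ induced_from i.+1 p F.
Proof. by []. Qed.

Lemma addr_fromP i F a : a \in addr_from i F -> exists j b, a = j :: b /\ i <= j.
Proof.
elim/pforest_ind: F i a => // d s F _ IHF i a.
rewrite addr_from_cons mem_cat => /orP[/mapP[b _ ->]|/IHF[j [b [-> ij]]]].
  by exists i, b.
by exists j, b; rewrite ltnW.
Qed.

Lemma addr_from_uniq i F : uniq (addr_from i F).
Proof.
elim/pforest_ind: F i => // d s F IHs IHF i.
rewrite addr_from_cons cat_uniq IHF andbT map_inj_uniq; last by move=> ? ? [].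
rewrite cons_uniq IHs andbT; apply/andP; split.
  by apply/negP=> /addr_fromP[j [b []]].
apply/hasPn=> a /addr_fromP[j [b [-> ij]]]; apply/mapP=> -[c _ [eji _]].
by rewrite eji ltnn in ij.
Qed.

Lemma eq_induced_from i p q F : {in addr_from i F, p =1 q} ->
  induced_from i p F = induced_from i q F.
Proof.
elim/pforest_ind: F i p q => // d s F IHs IHF i p q pq.
rewrite !induced_from_cons (IHF _ p q) => [|a ha]; last first.
  by apply: pq; rewrite addr_from_cons mem_cat ha orbT.
rewrite (IHs 0 (fun a => p (i :: a)) (fun a => q (i :: a))) => [|a ha]; last first.
  by apply: pq; rewrite addr_from_cons mem_cat map_f // inE ha orbT.
by rewrite pq // addr_from_cons mem_cat map_f // mem_head.
Qed.

(** Ideals of vertices, in terms of lists of addresses. *)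
Definition closed_in (s L : seq address) : bool :=
  all (fun a => all (fun b => prefix a b ==> (b \in L)) s) L.

Lemma closed_inP s L : reflect
  (forall a b, a \in L -> b \in s -> prefix a b -> b \in L) (closed_in s L).
Proof.
apply: (iffP allP) => [h a b aL bs|h a aL].
  by have /allP/(_ b bs)/implyP := h a aL.
by apply/allP=> b bs; apply/implyP; apply: h.
Qed.

Lemma closed_in_cat s1 s2 L1 L2 : subseq L1 s1 -> subseq L2 s2 ->
  (forall a b, a \in s1 -> b \in s2 -> [&& a != b, ~~ prefix a b & ~~ prefix b a]) ->
  closed_in (s1 ++ s2) (L1 ++ L2) = closed_in s1 L1 && closed_in s2 L2.
Proof.
move=> /mem_subseq l1 /mem_subseq l2 no; apply/closed_inP/andP.
  move=> h; split; apply/closed_inP=> a b aL bs ab.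
    have := h a b; rewrite !mem_cat aL bs => /(_ isT isT ab)/orP[//|/l2 b2].
    by have := no b b bs b2; rewrite eqxx.
  have := h a b; rewrite !mem_cat aL bs !orbT => /(_ isT isT ab)/orP[/l1 b1|//].
  by have := no b b b1 bs; rewrite eqxx.
case=> /closed_inP h1 /closed_inP h2 a b.
rewrite !mem_cat => /orP[aL|aL] /orP[bs|bs] ab.
- by rewrite (h1 a).
- by have /and3P[_] := no a b (l1 _ aL) bs; rewrite ab.
- by have /and3P[_ _] := no b a bs (l2 _ aL); rewrite ab.
- by rewrite (h2 a) ?orbT.
Qed.

Lemma closed_in_map i s L :
  closed_in (map (cons i) s) (map (cons i) L) = closed_in s L.
Proof.
have ci : injective (cons i) by move=> ? ? [].
apply/closed_inP/closed_inP=> h.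
  move=> a b aL bs ab; have := h (i :: a) (i :: b).
  by rewrite !mem_map //= eqxx; apply.
move=> _ _ /mapP[a aL ->] /mapP[b bs ->]; rewrite /= eqxx mem_map //.
exact: h.
Qed.

(** This gives the first term of [tcuts]. *)
Lemma closed_in_root s L : uniq s -> [::] \notin s -> subseq L s ->
  closed_in ([::] :: s) ([::] :: L) = (L == s).
Proof.
move=> us ns Ls; apply/closed_inP/eqP=> [h|-> a b _ //].
apply/eqP; rewrite -(size_subseq_leqif Ls).2 eqn_leq size_subseq //=.
apply: uniq_leq_size => // b bs.
have := h [::] b; rewrite !inE bs orbT prefix0s /= => /(_ isT isT isT).
by case/predU1P=> // b0; rewrite b0 (negbTE ns) in bs.
Qed.

Lemma closed_in_noroot s L : [::] \notin s -> subseq L s ->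
  closed_in ([::] :: s) L = closed_in s L.
Proof.
move=> ns /mem_subseq Ls; apply/closed_inP/closed_inP=> h a b aL bs ab.
  by apply: (h a) => //; rewrite inE bs orbT.
move: bs ab; rewrite inE => /predU1P[->|bs ab]; last exact: (h a).
by rewrite prefixs0 => /eqP a0; move/Ls: aL; rewrite a0 (negbTE ns).
Qed.

Fixpoint tcuts (t : ptree D) : seq (pforest D * pforest D) :=
  let: PNode d s := t in
  ([::], [:: t]) ::
  [seq ([:: PNode d c.1], c.2)
     | c <- foldr (fun u cs => [seq (a.1 ++ b.1, a.2 ++ b.2)
                                  | a <- tcuts u, b <- cs]) [:: ([::], [::])] s].

(** The cuts of a forest, without addresses: each tree is cut independently, and in a
    tree with root [d] either the whole tree is on the right or [d] stays on the left. *)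
Definition fcuts F : seq (pforest D * pforest D) :=
  foldr (fun u cs => [seq (a.1 ++ b.1, a.2 ++ b.2) | a <- tcuts u, b <- cs])
    [:: ([::], [::])] F.

Lemma fcuts_cons t F :
  fcuts (t :: F) = [seq (a.1 ++ b.1, a.2 ++ b.2) | a <- tcuts t, b <- fcuts F].
Proof. by []. Qed.

Lemma tcuts_node d s : tcuts (PNode d s) =
  ([::], [:: PNode d s]) :: [seq ([:: PNode d c.1], c.2) | c <- fcuts s].
Proof. by []. Qed.

Section CutSums.
Variable V : nmodType.
Local Open Scope ring_scope.

Lemma induced_from_true i p F : {in addr_from i F, forall a, p a} ->
  induced_from i p F = F.
Proof.
elim/pforest_ind: F i p => // d s F IHs IHF i p hp.
rewrite induced_from_cons hp ?IHs ?IHF // ?addr_from_cons ?mem_cat ?map_f ?mem_head //.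
  by move=> a ha; apply: hp; rewrite addr_from_cons mem_cat ha orbT.
by move=> a ha; apply: hp; rewrite addr_from_cons mem_cat map_f // inE ha orbT.
Qed.

Lemma induced_from_false i p F : {in addr_from i F, forall a, ~~ p a} ->
  induced_from i p F = [::].
Proof.
elim/pforest_ind: F i p => // d s F IHs IHF i p hp.
rewrite induced_from_cons (negbTE (hp _ _)) ?IHs ?IHF // ?addr_from_cons ?mem_cat ?map_f ?mem_head //.
  by move=> a ha; apply: hp; rewrite addr_from_cons mem_cat ha orbT.
by move=> a ha; apply: hp; rewrite addr_from_cons mem_cat map_f // inE ha orbT.
Qed.

(** The recursion of [fcuts] on address sets: an ideal of a forest restricts to an ideal
    of its first tree and one of the remaining forest, and an ideal of a tree is either
    everything or an ideal of the forest of subtrees. *)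
Lemma sum_closed F i (G : pforest D * pforest D -> V) :
  \sum_(L <- sublists (addr_from i F) | closed_in (addr_from i F) L)
     G (induced_from i (fun a => a \notin L) F, induced_from i (fun a => a \in L) F) =
  \sum_(c <- fcuts F) G c.
Proof.
elim/pforest_ind: F i G => [|d s F IHs IHF] i G.
  by rewrite /= big_cons big_nil big_seq1 addr0.
have ci : injective (cons i : address -> address) by move=> ? ? [].
set s0 := addr_from 0 s; set s1 := addr_from i.+1 F.
have us0 : uniq s0 by apply: addr_from_uniq.
have ns0 : [::] \notin s0 by apply/negP=> /addr_fromP[j [b []]].
have s1P a : a \in s1 -> i :: behead a != a.
  by case/addr_fromP=> j [b [-> ij]]; apply/eqP=> -[eij]; rewrite eij ltnn in ij.
have sepa a b : a \in map (cons i) ([::] :: s0) -> b \in s1 ->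
    [&& a != b, ~~ prefix a b & ~~ prefix b a].
  case/mapP=> a' _ -> /addr_fromP[j [b' [-> ij]]].
  have nij : (i == j) = false by apply/negbTE; rewrite neq_ltn ij.
  by rewrite /= eqseq_cons nij [j == i]eq_sym nij.
rewrite fcuts_cons tcuts_node addr_from_cons -/s0 -/s1 big_allpairs_dep.
pose tree_cut L : pforest D * pforest D :=
  (induced_from i (fun a => a \notin map (cons i) L) [:: PNode d s],
   induced_from i (fun a => a \in map (cons i) L) [:: PNode d s]).
have At : addr_from i [:: PNode d s] = map (cons i) ([::] :: s0).
  by rewrite addr_from_cons cats0.
have ind p : induced_from i p (PNode d s :: F) =
    induced_from i p [:: PNode d s] ++ induced_from i.+1 p F.
  by rewrite !induced_from_cons cats0.
transitivity (\sum_(L1 <- sublists ([::] :: s0) | closed_in ([::] :: s0) L1)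
   \sum_(L2 <- sublists s1 | closed_in s1 L2)
     G ((tree_cut L1).1 ++ induced_from i.+1 (fun a => a \notin L2) F,
        (tree_cut L1).2 ++ induced_from i.+1 (fun a => a \in L2) F)).
  rewrite [LHS]big_mkcond big_sublists_cat big_sublists_map [RHS]big_mkcond.
  apply: eq_big_seq => L1; rewrite mem_sublists => hL1.
  have hL1' : subseq (map (cons i) L1) (map (cons i) ([::] :: s0)).
    exact: map_subseq.
  transitivity (\sum_(L2 <- sublists s1)
    if closed_in ([::] :: s0) L1 && closed_in s1 L2 then
     G ((tree_cut L1).1 ++ induced_from i.+1 (fun a => a \notin L2) F,
        (tree_cut L1).2 ++ induced_from i.+1 (fun a => a \in L2) F) else 0).
    apply: eq_big_seq => L2; rewrite mem_sublists => hL2.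
    rewrite closed_in_cat // closed_in_map !ind.
    have m1 a : a \in addr_from i [:: PNode d s] ->
        (a \in map (cons i) L1 ++ L2) = (a \in map (cons i) L1).
      rewrite At => ha; rewrite mem_cat orbC; case: (boolP (a \in L2)) => // a2.
      by have := sepa a a ha (mem_subseq hL2 a2); rewrite eqxx.
    have m2 a : a \in s1 -> (a \in map (cons i) L1 ++ L2) = (a \in L2).
      move=> ha; rewrite mem_cat; case: (boolP (a \in map (cons i) L1)) => // a1.
      by have := sepa a a (mem_subseq hL1' a1) ha; rewrite eqxx.
    set M := map (cons i) L1 ++ L2 in m1 m2 *.
    rewrite (@eq_induced_from i (fun a => a \notin M) (fun a => a \notin map (cons i) L1));
      last by move=> a ha /=; rewrite m1.
    rewrite (@eq_induced_from i.+1 (fun a => a \notin M) (fun a => a \notin L2));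
      last by move=> a ha /=; rewrite m2.
    rewrite (@eq_induced_from i (fun a => a \in M) (fun a => a \in map (cons i) L1));
      last by move=> a ha /=; rewrite m1.
    by rewrite (@eq_induced_from i.+1 (fun a => a \in M) (fun a => a \in L2));
      last by move=> a ha /=; rewrite m2.
  by case: (closed_in _ L1); rewrite /= -?big_mkcond // big1.
pose H x : V := \sum_(b <- fcuts F) G (x.1 ++ b.1, x.2 ++ b.2).
transitivity (\sum_(L1 <- sublists ([::] :: s0) | closed_in ([::] :: s0) L1) H (tree_cut L1)).
  by apply: eq_bigr => L1 _; apply: (IHF i.+1 (fun c => G (_ ++ c.1, _ ++ c.2))).
rewrite /sublists -/(sublists s0) big_cat big_cons big_map /=; congr (_ + _).
  rewrite big_seq_cond (eq_bigl (fun L => (L \in sublists s0) && (L == s0))); last first.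
    move=> L; case: (boolP (L \in sublists s0)) => //=; rewrite mem_sublists.
    exact: closed_in_root.
  rewrite -big_seq_cond big_mkcond (bigD1_seq s0) ?mem_sublists ?sublists_uniq //=.
  have -> : tree_cut ([::] :: s0) = ([::], [:: PNode d s]).
    congr (_, _).
      by apply: induced_from_false => a; rewrite At => ha; rewrite negbK.
    by apply: induced_from_true => a; rewrite At.
  by rewrite eqxx big1 ?addr0 // => L /negbTE->.
rewrite big_map -/(fcuts s) -(IHs 0 (fun c => H ([:: PNode d c.1], c.2))).
rewrite big_seq_cond [RHS]big_seq_cond; apply: eq_big => L.
  case: (boolP (L \in sublists s0)) => //=; rewrite mem_sublists.
  exact: closed_in_noroot.
move=> /andP[]; rewrite mem_sublists => hL _; congr H.
rewrite /tree_cut !induced_from_cons !cats0 !mem_map //.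
have -> : ([::] \in L) = false.
  by apply/negbTE; apply: contra ns0; apply: (mem_subseq hL).
congr (([:: PNode d _], _)); apply: eq_induced_from => a _.
  by rewrite mem_map.
by rewrite mem_map.
Qed.

End CutSums.

Section VertexSets.
Variable F : pforest D.
Implicit Types (I : {set vertex F}).

Definition addresses I : seq address :=
  [seq a <- faddr F | a \in [seq val v | v in I]].

Lemma mem_addresses I (v : vertex F) : (val v \in addresses I) = (v \in I).
Proof.
rewrite mem_filter (valP v) andbT; apply/mapP/idP=> [[w]|vI].
  by rewrite mem_enum => wI /val_inj->.
by exists v; rewrite ?mem_enum.
Qed.

Lemma addresses_sublists :
  perm_eq (map addresses (enum {set vertex F})) (sublists (faddr F)).
Proof.
have uF : uniq (faddr F) by apply: (addr_from_uniq 0).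
apply: uniq_perm; rewrite ?sublists_uniq //.
  rewrite map_inj_uniq ?enum_uniq // => I J eIJ; apply/setP=> v.
  by rewrite -!mem_addresses eIJ.
move=> L; rewrite mem_sublists; apply/mapP/idP=> [[I _ ->]|sL].
  exact: filter_subseq.
exists [set v : vertex F | val v \in L]; first by rewrite mem_enum.
rewrite [LHS](elimT (subseq_uniqP uF) sL); apply: eq_in_filter => a aF; rewrite /=.
apply/idP/mapP=> [aL|[v]]; last by rewrite mem_enum inE => vL ->.
by exists (SeqSub aF); rewrite ?mem_enum ?inE.
Qed.

Lemma closed_in_addresses I : closed_in (faddr F) (addresses I) = fideal I.
Proof.
apply/closed_inP/forallP=> [h v|h a b].
  apply/implyP=> vI; apply/forallP=> w; apply/implyP=> vw.
  by rewrite -mem_addresses; apply: h vw; rewrite ?mem_addresses ?(valP w).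
move=> aI bF ab; have aF : a \in faddr F by move: aI; rewrite mem_filter => /andP[].
have := h (SeqSub aF); rewrite -mem_addresses aI /= => /forallP/(_ (SeqSub bF)).
by rewrite ab /= -mem_addresses.
Qed.

Lemma ck_comulE (K : fieldType) : ck_comul K F = lsum K (fcuts F).
Proof.
rewrite /ck_comul /lsum -(sum_closed F 0) -(perm_big _ addresses_sublists) /=.
rewrite big_map big_enum_cond /=; apply: eq_big => [I|I _].
  by rewrite closed_in_addresses.
have e (J : {set vertex F}) a (aF : a \in faddr F) : (a \in [seq val v | v in J]) = (SeqSub aF \in J).
  by rewrite -(mem_addresses J (SeqSub aF)) mem_filter /= aF andbT.
congr (<< (_, _) >>)%R; apply: (@eq_induced_from 0) => a aF; rewrite (e _ _ aF).
  by rewrite in_setC -(mem_addresses I (SeqSub aF)).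
by rewrite -(mem_addresses I (SeqSub aF)).
Qed.

End VertexSets.

End CKCuts.

(** * Elements as forests of indecomposable elements *)

Section Generators.
Variable D : cut_bialgebra.
Local Notation deg := (@cb_deg D).
Local Notation one := (@cb_one D).
Local Notation mul := (@cb_mul D).
Local Notation nw := (@cb_nw D).

Definition indec : pred D := fun b => (b != one) && ~~ cb_dec b.

Lemma indec_deg_gt0 (g : {b : D | indec b}) : 0 < deg (val g).
Proof. by rewrite deg_gt0; case/andP: (valP g). Qed.

Definition gens : graded_set :=
  @GradedSet {b : D | indec b} (fun g => deg (val g)) indec_deg_gt0.

Lemma indec_mul b a c : indec b -> b = mul a c -> a != one -> c = one.
Proof.
move=> /andP[_ nb] eb na; apply/eqP/negPn/negP=> nc.
by case/negP: nb; apply/cb_decP; exists a, c; split=> //; left.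
Qed.

Lemma indec_nw b a c : indec b -> b = nw a c -> a != one -> c = one.
Proof.
move=> /andP[_ nb] eb na; apply/eqP/negPn/negP=> nc.
by case/negP: nb; apply/cb_decP; exists a, c; split=> //; right.
Qed.

Lemma nw_neq1 (g r : D) : g != one -> nw g r != one.
Proof. by rewrite -!deg_gt0 cb_degW => h; rewrite addn_gt0 h. Qed.

(** The three coincidence laws, applied to the two decompositions, give a middle factor
    that would decompose [g] or [g'] unless it is the unit. *)
Lemma decomposition_unique l g r l' g' r' : indec g -> indec g' ->
  mul l (nw g r) = mul l' (nw g' r') -> [/\ l = l', g = g' & r = r'].
Proof.
wlog ll' : l g r l' g' r' / deg l <= deg l'.
  move=> h ig ig' e; case/orP: (leq_total (deg l) (deg l')) => hl; first exact: h.
  by have [-> -> ->] := h _ _ _ _ _ _ hl ig' ig (esym e).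
move=> ig ig' e; have [ng _] := andP ig; have [ng' _] := andP ig'.
have [c el' e1] := cb_mul_eq e ll'.
have ec : c = one.
  apply/eqP/negPn/negP=> nc; have [er|nr] := eqVneq r one.
    move: e1; rewrite er cb_nwb1 => /(indec_mul ig)/(_ nc)/eqP.
    by rewrite (negbTE (nw_neq1 r' ng')).
  have [d [nd ed _]] := cb_mul_nw_eq ng (nw_neq1 r' ng') nr (esym e1).
  by move: nd; rewrite (indec_mul ig ed nc) eqxx.
rewrite ec cb_mulb1 in el'; rewrite ec cb_mul1b in e1; rewrite el'; split=> //.
  case/orP: (leq_total (deg g) (deg g')) => hg.
    by have [d ed _] := cb_nw_eq e1 hg; rewrite ed (indec_nw ig' ed ng) cb_nwb1.
  have [d ed _] := cb_nw_eq (esym e1) hg.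
  by rewrite ed (indec_nw ig ed ng') cb_nwb1.
case/orP: (leq_total (deg g) (deg g')) => hg.
  have [d ed ->] := cb_nw_eq e1 hg; by rewrite (indec_nw ig' ed ng) cb_nw1b.
have [d ed ->] := cb_nw_eq (esym e1) hg.
by rewrite (indec_nw ig ed ng') cb_nw1b.
Qed.

Fixpoint tree_val (t : ptree gens) : D :=
  let: PNode g s := t in
  nw (val (g : {b : D | indec b})) (foldr (fun u b => mul (tree_val u) b) one s).
Definition forest_val (F : pforest gens) : D :=
  foldr (fun u b => mul (tree_val u) b) one F.

Fixpoint tree_size (t : ptree gens) : nat :=
  let: PNode _ s := t in (sumn (map tree_size s)).+1.
Definition forest_size (F : pforest gens) : nat := sumn (map tree_size F).

Lemma forest_val_cons g s F :
  forest_val (PNode g s :: F) = mul (nw (val g) (forest_val s)) (forest_val F).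
Proof. by []. Qed.

Lemma forest_val_cat F G : forest_val (F ++ G) = mul (forest_val F) (forest_val G).
Proof.
by elim: F => [|t F IHF] /=; rewrite ?cb_mul1b // IHF cb_mulA.
Qed.

Lemma forest_val_rcons F g s :
  forest_val (rcons F (PNode g s)) = mul (forest_val F) (nw (val g) (forest_val s)).
Proof. by rewrite -cats1 forest_val_cat forest_val_cons cb_mulb1. Qed.

Lemma forest_size_cons g s F :
  forest_size (PNode g s :: F) = ((forest_size s).+1 + forest_size F)%N.
Proof. by []. Qed.

Lemma forest_size_cat F G : forest_size (F ++ G) = forest_size F + forest_size G.
Proof. by rewrite /forest_size map_cat sumn_cat. Qed.

Lemma forest_size_rcons F g s :
  forest_size (rcons F (PNode g s)) = (forest_size F + (forest_size s).+1)%N.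
Proof. by rewrite -cats1 forest_size_cat forest_size_cons addn0. Qed.

Lemma fdeg_cons g s F :
  Defs.fdeg (PNode g s :: F : pforest gens) = (gs_deg g + Defs.fdeg s + Defs.fdeg F)%N.
Proof. by []. Qed.

Lemma deg_forest_val F : deg (forest_val F) = Defs.fdeg F.
Proof.
elim/pforest_ind: F => [|g s F IHs IHF]; first by rewrite deg1.
by rewrite forest_val_cons fdeg_cons cb_degM cb_degW IHs IHF.
Qed.

Lemma forest_size_le F : forest_size F <= Defs.fdeg F.
Proof.
elim/pforest_ind: F => [//|g s F IHs IHF].
rewrite forest_size_cons fdeg_cons -add1n; apply: leq_add => //.
by apply: leq_add => //; apply: gs_deg_gt0.
Qed.

Lemma forest_size_eq0 F : (forest_size F == 0) = (F == [::]).
Proof. by case: F => [|[g s] F]. Qed.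

(** By [cb_mul_nw] and associativity, grafting on a product grafts on its last tree. *)
Lemma graft_exists F G : exists H : pforest gens,
  forest_val H = nw (forest_val F) (forest_val G) /\
  forest_size H = forest_size F + forest_size G.
Proof.
have [k Fk] := ubnP (forest_size F); elim: k F Fk => // k IHk F; rewrite ltnS.
case/lastP: F => [|F [g s]] Fk; first by exists G; rewrite /= cb_nw1b.
have [|H [eH sH]] := IHk s.
  by apply: leq_trans Fk; rewrite forest_size_rcons addnS ltnS leq_addl.
exists (rcons F (PNode g H)); rewrite !forest_val_rcons !forest_size_rcons eH sH.
split; last by rewrite -addnA addSn.
rewrite cb_mul_nw ?cb_nwA //; apply: nw_neq1.
by case/andP: (valP (g : {b : D | indec b})).
Qed.

(** Split off the last tree and apply [decomposition_unique]. *)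
Lemma forest_val_inj : injective forest_val.
Proof.
move=> F; have [k Fk] := ubnP (forest_size F); elim: k F Fk => // k IHk F.
rewrite ltnS; case/lastP: F => [|F [g s]] Fk G e.
  apply/esym/eqP; rewrite -forest_size_eq0 -leqn0 (leq_trans (forest_size_le G)) //.
  by rewrite -deg_forest_val -e deg1.
case/lastP: G e => [|G [h t]] e.
  have := forest_size_le (rcons F (PNode g s)).
  by rewrite -deg_forest_val e deg1 forest_size_rcons addnS.
move: e; rewrite !forest_val_rcons.
case/(decomposition_unique (valP (g : {b : D | indec b})) (valP (h : {b : D | indec b})))
  => eF /val_inj -> es.
rewrite forest_size_rcons in Fk.
by rewrite (IHk F _ G eF) 1?(IHk s _ t es) //; lia.
Qed.

Lemma forest_val_surj b : exists F, forest_val F == b.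
Proof.
have [k bk] := ubnP (deg b); elim: k b bk => // k IHk b; rewrite ltnS => bk.
have [->|nb] := eqVneq b one; first by exists [::].
have [/cb_decP[a [c [na nc h]]]|ib] := boolP (cb_dec b); last first.
  have ib' : indec b by rewrite /indec nb.
  exists [:: PNode (exist (fun b => indec b) b ib' : gens) [::]].
  by rewrite forest_val_cons cb_nwb1 cb_mulb1.
have da : 0 < deg a by rewrite deg_gt0.
have dc : 0 < deg c by rewrite deg_gt0.
have db : deg b = deg a + deg c by case: h => ->; rewrite ?cb_degM ?cb_degW.
have [|Fa /eqP ea] := IHk a; first by lia.
have [|Fc /eqP ec] := IHk c; first by lia.
case: h => ->; first by exists (Fa ++ Fc); rewrite forest_val_cat ea ec.
by have [H [eH _]] := graft_exists Fa Fc; exists H; rewrite eH ea ec.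
Qed.

Definition forest_of b : pforest gens := xchoose (forest_val_surj b).

Lemma forest_ofK : cancel forest_of forest_val.
Proof. by move=> b; apply/eqP/(xchooseP (forest_val_surj b)). Qed.

Lemma forest_valK : cancel forest_val forest_of.
Proof. by move=> F; apply: forest_val_inj; rewrite forest_ofK. Qed.

(** The filtration for which the isomorphism is unitriangular: it is additive for both
    products, equal to [1] on indecomposable elements and at least [2] on decomposable
    ones. *)
Definition rk b : nat := forest_size (forest_of b).

Lemma rk_mul a b : rk (mul a b) = rk a + rk b.
Proof.
rewrite /rk -forest_size_cat; congr forest_size; apply: forest_val_inj.
by rewrite forest_val_cat !forest_ofK.
Qed.

Lemma rk_nw a b : rk (nw a b) = rk a + rk b.
Proof.
have [H [eH sH]] := graft_exists (forest_of a) (forest_of b).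
rewrite /rk -sH; congr forest_size; apply: forest_val_inj.
by rewrite eH !forest_ofK.
Qed.

Lemma rk_gt0 b : (0 < rk b) = (b != one).
Proof.
rewrite lt0n forest_size_eq0; congr negb; apply/eqP/eqP=> [e|->].
  by rewrite -(forest_ofK b) e.
by rewrite -[one]/(forest_val [::]) forest_valK.
Qed.

Lemma rk_dec b : cb_dec b -> 1 < rk b.
Proof.
case/cb_decP=> a [c [na nc h]]; have ra := rk_gt0 a; have rc := rk_gt0 c.
by case: h => ->; rewrite ?rk_mul ?rk_nw; rewrite na in ra; rewrite nc in rc; lia.
Qed.

Lemma rk_le b : rk b <= deg b.
Proof. by rewrite -{2}(forest_ofK b) deg_forest_val; apply: forest_size_le. Qed.

End Generators.

Local Open Scope ring_scope.

(** * Unitriangular endomorphisms *)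

Section Unitriangular.
#[local] Opaque tmap tens star clam crho cdel cmul cnw lext.
Variables (K : fieldType) (B : choiceType) (deg rk : B -> nat).
Hypothesis rk_le : forall b, (rk b <= deg b)%N.
Local Notation A := {malg K[B]}.

(** The filtration; its span is zero for [k] larger than [n]. *)
Definition above n k : pred B := fun b => (deg b == n) && (k <= rk b)%N.

Variable E : A -> A.
Hypothesis El : linear E.
Hypothesis EU : forall b, supported (above (deg b) (rk b).+1) (<< b >> - E << b >>).

Let N (x : A) : A := x - E x.

Lemma N_linear : linear N.
Proof. by move=> c x y; rewrite /N El scalerBr opprD addrACA. Qed.

HB.instance Definition _ := GRing.isLinear.Build K A A *:%R N N_linear.

Lemma N_above n k x : supported (above n k) x -> supported (above n k.+1) (N x).
Proof.
move=> hx; rewrite (linear_comb N_linear); apply: supported_lext hx => b /andP[/eqP bn kb].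
apply: sub_supported (@EU b) => c /andP[/eqP cb hc].
by rewrite /above cb bn eqxx; apply: leq_trans hc.
Qed.

Lemma iter_N_above j n k x : supported (above n k) x ->
  supported (above n (j + k)%N) (iter j N x).
Proof. by move=> hx; elim: j => //= j IHj; apply: N_above. Qed.

Lemma above_gt0 n k x : (n < k)%N -> supported (above n k) x -> x = 0 :> A.
Proof.
move=> nk hx; apply/malgP=> b; rewrite mcoeff0; apply: (supported_eq0 hx).
apply/negP=> /andP[/eqP bn kb]; have := leq_trans kb (rk_le b).
by rewrite bn leqNgt nk.
Qed.

(** The geometric series of [id - E], which is nilpotent in each degree. *)
Definition Einv : A -> A := lext (fun b => \sum_(j < (deg b).+1) iter j N << b >>).

HB.instance Definition _ := GRing.isLinear.Build K A A *:%R Einv (lext_linear _).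

Lemma iter_N_linear j : linear (iter j N).
Proof. by elim: j => // j IHj c x y; rewrite !iterS IHj N_linear. Qed.

Lemma EinvE n x : supported (fun b => deg b == n) x ->
  Einv x = \sum_(j < n.+1) iter j N x.
Proof.
move=> hx; transitivity (lext (fun b => \sum_(j < n.+1) iter j N << b >>) x).
  by apply: eq_in_lext => b /hx /eqP ->.
have lin : linear (fun x => \sum_(j < n.+1) iter j N x).
  move=> c y z; rewrite scaler_sumr -big_split; apply: eq_bigr => j _.
  exact: iter_N_linear.
by rewrite (linear_comb lin).
Qed.

Lemma iter_N_eq0 n x : supported (fun b => deg b == n) x -> iter n.+1 N x = 0.
Proof.
move=> hx; have hx0 : supported (above n 0) x by move=> b /hx bn; rewrite /above bn.
by apply: above_gt0 (iter_N_above (j := n.+1) hx0); rewrite addn0.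
Qed.

Lemma supported_deg_E n x : supported (fun b => deg b == n) x ->
  supported (fun b => deg b == n) (E x).
Proof.
move=> hx; have -> : E x = x - N x by rewrite /N subKr.
apply: supportedB => //.
have hx0 : supported (above n 0) x by move=> b /hx bn; rewrite /above bn.
by apply: sub_supported (N_above hx0) => b /andP[].
Qed.

Lemma E_telescope n x : supported (fun b => deg b == n) x ->
  \sum_(j < n.+1) (iter j N x - iter j.+1 N x) = x.
Proof.
move=> hx; suff -> m : \sum_(j < m) (iter j N x - iter j.+1 N x) = x - iter m N x.
  by rewrite (iter_N_eq0 hx) subr0.
elim: m => [|m IHm]; first by rewrite big_ord0 subrr.
by rewrite big_ord_recr /= IHm addrA subrK.
Qed.

Lemma EinvK : cancel Einv E.
Proof.
apply: (linear_eq (f := fun x => E (Einv x)) (g := fun x => x)) => [c x y|//|b].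
  by rewrite linearP El.
have hb : supported (fun c => deg c == deg b) (<< b >> : A) by apply: supportedU.
rewrite (EinvE hb) -[RHS](E_telescope hb).
pose EL : {linear A -> A} := HB.pack E (GRing.isLinear.Build K A A *:%R E El).
rewrite -[E]/(EL : A -> A) linear_sum; apply: eq_bigr => j _.
by rewrite /= [in RHS]/N subKr.
Qed.

Lemma EK : cancel E Einv.
Proof.
apply: (linear_eq (f := fun x => Einv (E x)) (g := fun x => x)) => [c x y|//|b].
  by rewrite El linearP.
have hb : supported (fun c => deg c == deg b) (<< b >> : A) by apply: supportedU.
rewrite (EinvE (supported_deg_E hb)) -[RHS](E_telescope hb).
apply: eq_bigr => j _.
have -> : E << b >> = << b >> - N << b >> by rewrite /N subKr.
have := iter_N_linear j (-1) (N << b >>) << b >>.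
rewrite !scaleN1r ![- _ + _]addrC => ->; congr (_ - _).
by rewrite -iterSr.
Qed.

Lemma supported_deg_Einv n x : supported (fun b => deg b == n) x ->
  supported (fun b => deg b == n) (Einv x).
Proof.
move=> hx; rewrite (EinvE hx); apply: supported_sum => j _.
have hx0 : supported (above n 0) x by move=> b /hx bn; rewrite /above bn.
by apply: sub_supported (iter_N_above (j := j) hx0) => b /andP[].
Qed.

End Unitriangular.

(** * The isomorphism with the Connes-Kreimer algebra *)

Section Isomorphism.
#[local] Opaque tmap tens star clam crho cdel cmul cnw lext.
Variables (K : fieldType) (D : cut_bialgebra).
Local Notation A := {malg K[D]}.
Local Notation A2 := {malg K[(D * D)%type]}.
Local Notation deg := (@cb_deg D).
Local Notation one := (@cb_one D).
Local Notation mul := (@cb_mul D).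
Local Notation nw := (@cb_nw D).
Local Notation MM := (star (K := K) mul mul).
Local Notation id := (fun x : A => x).
Local Notation cmul := (@cmul K D).
Local Notation cnw := (@cnw K D).
Local Notation G := (gens D).
Local Notation forest := (pforest G).
Local Notation CK := {malg K[forest]}.

Definition hopf_of : graded_hopf K D :=
  {| h_mul := cmul; h_one := << one >>; h_comul := @cdel K D;
     h_counit := fun x => x@_one; h_deg := deg |}.

(** A boolean form of [primitive_projection], so that the correction can be chosen. *)
Definition primitive_part (g : G) (b : A) : bool :=
  [&& all (dec_of (gs_deg g)) (msupp b),
      crho (<< val g >> - b) == tens (<< val g >> - b) << one >> &
      clam (<< val g >> - b) == tens << one >> (<< val g >> - b)].

Lemma primitive_part_exists g : exists b, primitive_part g b.
Proof.
have [|b hb [rb lb]] := @primitive_projection K D (gs_deg g) << val g >> (gs_deg_gt0 g).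
  by apply: supportedU; rewrite /ofdeg eqxx.
exists b; rewrite /primitive_part rb lb !eqxx !andbT; apply/allP=> c; exact: hb.
Qed.

(** The primitive element with leading term [g]. *)
Definition prim_gen (g : G) : A := << val g >> - xchoose (primitive_part_exists g).

Lemma prim_genP g : primitive (prim_gen g).
Proof.
by have /and3P[_ /eqP ? /eqP ?] := xchooseP (primitive_part_exists g); split.
Qed.

Lemma prim_gen_dec (g : G) : supported (@dec_of D (gs_deg g)) (<< val g >> - prim_gen g).
Proof.
have /and3P[/allP h _ _] := xchooseP (primitive_part_exists g).
by rewrite /prim_gen subKr => b /h.
Qed.

(** Like [tree_val], with each decoration replaced by the primitive element that it leads. *)
Fixpoint tree_map (t : ptree G) : A :=
  let: PNode g s := t in
  cnw (prim_gen g) (foldr (fun u x => cmul (tree_map u) x) << one >> s).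
Definition forest_map (F : forest) : A :=
  foldr (fun u x => cmul (tree_map u) x) << one >> F.
Definition ck_map : CK -> A := lext forest_map.

HB.instance Definition _ := GRing.isLinear.Build K CK A *:%R ck_map (lext_linear _).

Lemma forest_map_cons g s F :
  forest_map (PNode g s :: F) = cmul (cnw (prim_gen g) (forest_map s)) (forest_map F).
Proof. by []. Qed.

Lemma forest_map_cat F F' : forest_map (F ++ F') = cmul (forest_map F) (forest_map F').
Proof.
elim: F => [|t F IHF] /=; first by rewrite cmul1l.
by rewrite IHF cmulA.
Qed.

Lemma ck_mapU F : ck_map << F >> = forest_map F.
Proof. exact: lextU. Qed.

Lemma cmul1r x : cmul x << one >> = x.
Proof.
apply: (linear_eq (f := cmul^~ << one >>) (g := id)) => [c y z|//|b].
  by rewrite cmulPl.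
by rewrite cmulU cb_mulb1.
Qed.

Lemma star_tens x y z t :
  MM (tens x y) (tens z t) = tens (cmul x z) (cmul y t).
Proof.
apply: (bilinear_eq (F := fun x y => MM (tens x y) (tens z t))
  (G := fun x y => tens (cmul x z) (cmul y t))) => [u c v w|u c v w|u c v w|u c v w|a b].
- by rewrite linearP starPl.
- by rewrite tensPl starPl.
- by rewrite cmulPl linearP.
- by rewrite cmulPl tensPl.
apply: (bilinear_eq (F := fun z t => MM (tens << a >> << b >>) (tens z t))
  (G := fun z t => tens (cmul << a >> z) (cmul << b >> t))) => [u c v w|u c v w|u c v w|u c v w|a' b'].
- by rewrite !linearP.
- by rewrite tensPl linearP.
- by rewrite !linearP.
- by rewrite linearP tensPl.
by rewrite !tensU starU !cmulU tensU.
Qed.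

Lemma star_suml (I J : Type) (s : seq I) (t : seq J) (F : I -> A2) (F' : J -> A2) :
  MM (\sum_(i <- s) F i) (\sum_(j <- t) F' j) =
  \sum_(i <- s) \sum_(j <- t) MM (F i) (F' j).
Proof.
have suml u : MM (\sum_(i <- s) F i) u = \sum_(i <- s) MM (F i) u.
  exact: bext_suml.
rewrite suml; apply: eq_bigr => i _; exact: linear_sum.
Qed.

(** Delta of the image satisfies the recursion of [fcuts], by [cdel_graft]. *)
Lemma cdel_forest F : cdel (forest_map F) =
  \sum_(c <- fcuts F) tens (forest_map c.1) (forest_map c.2).
Proof.
elim/pforest_ind: F => [|g s F IHs IHF].
  by rewrite /= cdelU acb1 /lsum !big_seq1 tensU.
rewrite forest_map_cons cdel_mul (cdel_graft _ (prim_genP g)) IHF IHs.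
have -> : tens << one >> (cnw (prim_gen g) (forest_map s))
    + tmap (cnw (prim_gen g)) id (\sum_(c <- fcuts s) tens (forest_map c.1) (forest_map c.2))
  = \sum_(a <- tcuts (PNode g s)) tens (forest_map a.1) (forest_map a.2).
  rewrite -> tcuts_node. rewrite -> big_cons. rewrite -> big_map.
  apply: f_equal2.
    by rewrite forest_map_cons cmul1r.
  rewrite linear_sum; apply: eq_bigr => c _.
  rewrite forest_map_cons cmul1r; apply: tmap_tens => [|//].
  exact: linearP.
rewrite star_suml fcuts_cons big_allpairs_dep; apply: eq_bigr => a _.
by apply: eq_bigr => b _; rewrite star_tens -!forest_map_cat.
Qed.

Local Notation up := (above deg (@rk D)).

Lemma up_cmul n k n' k' x y : supported (up n k) x -> supported (up n' k') y ->
  supported (up (n + n')%N (k + k')%N) (cmul x y).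
Proof.
apply: supported_bext => a b /andP[/eqP an ka] /andP[/eqP bn kb]; apply: supportedU.
by rewrite /above cb_degM rk_mul an bn eqxx leq_add.
Qed.

Lemma up_cnw n k n' k' x y : supported (up n k) x -> supported (up n' k') y ->
  supported (up (n + n')%N (k + k')%N) (cnw x y).
Proof.
apply: supported_bext => a b /andP[/eqP an ka] /andP[/eqP bn kb]; apply: supportedU.
by rewrite /above cb_degW rk_nw an bn eqxx leq_add.
Qed.

Lemma up_le n k k' x : (k <= k')%N -> supported (up n k') x -> supported (up n k) (x : A).
Proof.
move=> kk'; apply: sub_supported => b /andP[bn kb].
by rewrite /above bn (leq_trans kk').
Qed.

Lemma up_forest_val F : supported (up (Defs.fdeg F) (forest_size F)) (<< forest_val F >> : A).
Proof.
by apply: supportedU; rewrite /above deg_forest_val eqxx /rk forest_valK leqnn.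
Qed.

Lemma cmulB x y z t : cmul x y - cmul z t = cmul (x - z) y + cmul z (y - t).
Proof.
have -> : cmul (x - z) y = cmul x y - cmul z y by exact: bextBl.
have -> : cmul z (y - t) = cmul z y - cmul z t by exact: linearB.
by rewrite addrA subrK.
Qed.

Lemma cnwB x y z t : cnw x y - cnw z t = cnw (x - z) y + cnw z (y - t).
Proof.
have -> : cnw (x - z) y = cnw x y - cnw z y by exact: bextBl.
have -> : cnw z (y - t) = cnw z y - cnw z t by exact: linearB.
by rewrite addrA subrK.
Qed.

(** Replacing [g] by [prim_gen g] adds decomposable terms, which have rank at least [2]
    instead of [1]. *)
Lemma forest_map_lead F :
  supported (up (Defs.fdeg F) (forest_size F).+1) (<< forest_val F >> - forest_map F).
Proof.
elim/pforest_ind: F => [|g s F IHs IHF].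
  by rewrite /= subrr; apply: supported0.
have hg : supported (up (gs_deg g) 2) (<< val g >> - prim_gen g).
  apply: sub_supported (@prim_gen_dec g) => b /andP[db bn].
  by rewrite /above bn rk_dec.
have gU : supported (up (gs_deg g) 1) (<< val g >> : A).
  by apply: supportedU; rewrite /above eqxx rk_gt0; case/andP: (valP (g : {b : D | indec b})).
have hp : supported (up (gs_deg g) 1) (prim_gen g).
  have -> : prim_gen g = << val g >> - (<< val g >> - prim_gen g) by rewrite subKr.
  by apply: supportedB => //; apply: up_le hg.
have hs : supported (up (Defs.fdeg s) (forest_size s)) (forest_map s).
  have -> : forest_map s = << forest_val s >> - (<< forest_val s >> - forest_map s).
    by rewrite subKr.
  by apply: supportedB; [exact: up_forest_val | apply: up_le IHs].
have hF : supported (up (Defs.fdeg F) (forest_size F)) (forest_map F).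
  have -> : forest_map F = << forest_val F >> - (<< forest_val F >> - forest_map F).
    by rewrite subKr.
  by apply: supportedB; [exact: up_forest_val | apply: up_le IHF].
rewrite forest_map_cons forest_val_cons forest_size_cons fdeg_cons -cmulU -cnwU.
rewrite cmulB; apply: supportedD.
  rewrite -addSn; apply: up_cmul; last exact: up_forest_val.
  rewrite cnwB; apply: supportedD.
    by rewrite -add2n; apply: up_cnw hg (@up_forest_val s).
  by rewrite -[(forest_size s).+2]add1n; apply: up_cnw.
rewrite -addnS; apply: up_cmul => //; rewrite -add1n; exact: up_cnw.
Qed.

End Isomorphism.

Section HopfIsomorphism.
#[local] Opaque tmap tens star clam crho cdel cmul cnw lext.
Variables (K : fieldType) (D : cut_bialgebra).
Local Notation A := {malg K[D]}.
Local Notation deg := (@cb_deg D).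
Local Notation cmul := (@cmul K D).
Local Notation G := (gens D).
Local Notation CK := {malg K[pforest G]}.
Local Notation ck_map := (@ck_map K D).

Definition val_lin : CK -> A := lext (fun F => << forest_val F >>).
Definition of_lin : A -> CK := lext (fun b => << forest_of b >>).

HB.instance Definition _ := GRing.isLinear.Build K CK A *:%R val_lin (lext_linear _).
HB.instance Definition _ := GRing.isLinear.Build K A CK *:%R of_lin (lext_linear _).

Lemma val_linU F : val_lin << F >> = << forest_val F >>.
Proof. exact: lextU. Qed.
Lemma of_linU b : of_lin << b >> = << forest_of b >>.
Proof. exact: lextU. Qed.

Lemma val_linK : cancel val_lin of_lin.
Proof.
apply: (linear_eq (f := fun x => of_lin (val_lin x)) (g := fun x => x)) => [c x y|c x y|F].
- by rewrite !linearP.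
- by [].
- by rewrite val_linU of_linU forest_valK.
Qed.

(** [ck_map] read on elements through the bijection with forests. *)
Definition endo (x : A) : A := ck_map (of_lin x).

Lemma endo_linear : linear endo.
Proof. by move=> c x y; rewrite /endo !linearP. Qed.

Lemma endo_unitriangular b :
  supported (above deg (@rk D) (deg b) (@rk D b).+1) (<< b >> - endo << b >>).
Proof.
rewrite /endo of_linU ck_mapU.
have := forest_map_lead (K := K) (F := forest_of b).
by rewrite -deg_forest_val forest_ofK.
Qed.

Lemma ck_map_endo x : ck_map x = endo (val_lin x).
Proof. by rewrite /endo val_linK. Qed.

Definition ck_inv (x : A) : CK := of_lin (Einv deg endo x).

HB.instance Definition _ := GRing.isLinear.Build K A CK *:%R ck_inv
  (fun c x y => etrans (congr1 of_lin (linearP (Einv deg endo) c x y)) (linearP of_lin c _ _)).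

Lemma ck_mapK : cancel ck_map ck_inv.
Proof.
move=> y; rewrite ck_map_endo /ck_inv (EK (rk := @rk D)) ?val_linK //.
- exact: rk_le.
- exact: endo_linear.
- exact: endo_unitriangular.
Qed.

Lemma ck_invK : cancel ck_inv ck_map.
Proof.
move=> x; rewrite /ck_inv -[ck_map _]/(endo _); apply: (EinvK (rk := @rk D)).
- exact: rk_le.
- exact: endo_linear.
- exact: endo_unitriangular.
Qed.

Lemma ck_invE F : ck_inv (forest_map K F) = << F >>.
Proof. by rewrite -ck_mapU ck_mapK. Qed.

Lemma ck_map_mul y z : ck_map (bext (@ck_mul G K) y z) = cmul (ck_map y) (ck_map z).
Proof.
apply: (bilinear_eq (F := fun y z => ck_map (bext (@ck_mul G K) y z))
  (G := fun y z => cmul (ck_map y) (ck_map z))) => [u c v w|u c v w|u c v w|u c v w|F F'].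
- by rewrite !linearP.
- by rewrite bextPl linearP.
- by rewrite !linearP.
- by rewrite linearP cmulPl.
by rewrite bextU !ck_mapU forest_map_cat.
Qed.

Lemma ck_inv_mul x x' :
  ck_inv (cmul x x') = bext (@ck_mul G K) (ck_inv x) (ck_inv x').
Proof. by rewrite -{1}[x]ck_invK -{1}[x']ck_invK -ck_map_mul ck_mapK. Qed.

Lemma ck_inv_comul x : tmap ck_inv ck_inv (cdel x) = lext (@ck_comul G K) (ck_inv x).
Proof.
rewrite -[in LHS](ck_invK x); move: (ck_inv x) => {x} y.
apply: (linear_eq (f := fun y => tmap ck_inv ck_inv (cdel (ck_map y)))
  (g := lext (@ck_comul G K))) => [c z t|c z t|F].
- by rewrite !linearP.
- by rewrite linearP.
rewrite lextU ck_comulE ck_mapU cdel_forest linear_sum; apply: eq_bigr => c _ /=.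
by rewrite tmap_tens ?ck_invE ?tensU -?surjective_pairing //; apply: linearP.
Qed.

Lemma forest_map_supported F :
  supported (above deg (@rk D) (Defs.fdeg F) (forest_size F)) (forest_map K F).
Proof.
rewrite -[forest_map K F](subKr (<< forest_val F >>)).
apply: supportedB; first exact: up_forest_val.
exact: up_le (@forest_map_lead K D F).
Qed.

(** The image of a nonempty forest has no term of degree [0]. *)
Lemma ck_map_counit y : (ck_map y)@_(@cb_one D) = y@_[::].
Proof.
apply: (linear_eq (V := K^o) (f := fun y : CK => (ck_map y)@_(@cb_one D))
  (g := fun y : CK => y@_[::])) => [c z t|c z t|F].
- by rewrite linearP mcoeffD mcoeffZ.
- by rewrite mcoeffD mcoeffZ.
rewrite ck_mapU mcoeffU; case: F => [|[g s] F]; first by rewrite mcoeffU !eqxx.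
rewrite (supported_eq0 (@forest_map_supported _)) // /above deg1 fdeg_cons.
by have := gs_deg_gt0 g; lia.
Qed.

Theorem hopf_of_isomorphic : hopf_isomorphic (hopf_of K D) (CK_hopf G K).
Proof.
exists ck_inv; last by exists ck_map; [apply: ck_invK | apply: ck_mapK].
split=> [||x|x|n x hx]; first exact: linearP.
- split; first exact: ck_inv_mul.
  exact: (ck_invE [::]).
- exact: ck_inv_comul.
- by rewrite -[in RHS](ck_invK x); rewrite /= ck_map_counit.
have sx : supported (fun b => deg b == n) x by move=> b /hx /= ->.
have sy : supported (fun F => Defs.fdeg F == n) (ck_inv x).
  apply: supported_lext (supported_deg_Einv (rk := @rk D) _ _ sx) => [b /eqP bn||].
  - by apply: supportedU; rewrite -deg_forest_val forest_ofK bn.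
  - exact: endo_linear.
  - exact: endo_unitriangular.
by move=> F /sy /eqP.
Qed.

End HopfIsomorphism.
(** * Dup-Dend bialgebras from lists of reduced cuts *)

Section DupDendOfCuts.
#[local] Opaque tmap tens lext bext.
Variables (K : fieldType) (B : choiceType).
Variables (m w : B -> B -> B) (c : bool -> B -> seq (B * B)).
Local Notation V := {malg K[B]}.
Local Notation V2 := {malg K[(B * B)%type]}.
Let ct b := c false b ++ c true b.

Hypothesis mA : forall a b d, m (m a b) d = m a (m b d).
Hypothesis wA : forall a b d, w (w a b) d = w a (w b d).
Hypothesis mwA : forall a b d, w (m a b) d = m a (w b d).
Hypothesis coFF : forall b,
  perm_eq [seq (q.1, (q.2, p.2)) | p <- c false b, q <- c false p.1]
          [seq (p.1, q) | p <- c false b, q <- ct p.2].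
Hypothesis coTF : forall b,
  perm_eq [seq (q.1, (q.2, p.2)) | p <- c false b, q <- c true p.1]
          [seq (p.1, q) | p <- c true b, q <- c false p.2].
Hypothesis coTT : forall b,
  perm_eq [seq (q.1, (q.2, p.2)) | p <- c true b, q <- ct p.1]
          [seq (p.1, q) | p <- c true b, q <- c true p.2].
Hypothesis cFm : forall a b, perm_eq (c false (m a b))
  ((b, a) :: [seq (p.1, m a p.2) | p <- c false b]
     ++ [seq (m a p.1, p.2) | p <- c false b]
     ++ [seq (m p.1 b, p.2) | p <- ct a]
     ++ [seq (m p.1 q.1, m p.2 q.2) | p <- ct a, q <- c false b]).
Hypothesis cTm : forall a b, perm_eq (c true (m a b))
  ((a, b) :: [seq (m a p.1, p.2) | p <- c true b]
     ++ [seq (p.1, m a p.2) | p <- c true b]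
     ++ [seq (p.1, m p.2 b) | p <- ct a]
     ++ [seq (m p.1 q.1, m p.2 q.2) | p <- ct a, q <- c true b]).
Hypothesis cFw : forall a b, perm_eq (c false (w a b))
  ([seq (w a p.1, p.2) | p <- c false b]
     ++ [seq (w p.1 b, p.2) | p <- c false a]
     ++ [seq (w p.1 q.1, m p.2 q.2) | p <- c false a, q <- c false b]).
Hypothesis cTw : forall a b, perm_eq (c true (w a b))
  ((a, b) :: [seq (w a p.1, p.2) | p <- c true b]
     ++ [seq (p.1, w p.2 b) | p <- c true a]
     ++ [seq (p.1, m p.2 b) | p <- c false a]
     ++ [seq (w p.1 q.1, m p.2 q.2) | p <- c false a, q <- c true b]).

(** The hypotheses above are the axioms on basis elements, one list for each side. *)
Definition dup_dend_of : dup_dend K B :=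
  {| dd_mul := bext (fun a b => << m a b >>);
     dd_nw := bext (fun a b => << w a b >>);
     dd_prec := lext (fun b => lsum K (c false b));
     dd_succ := lext (fun b => lsum K (c true b)) |}.

Local Notation Mm := (bext (fun a b => << m a b >> : V)).
Local Notation Mw := (bext (fun a b => << w a b >> : V)).
Local Notation L s := (lext (fun b => lsum K (c s b))).
Local Notation id := (fun x : V => x).

Let Lt (x : V) : V2 := L false x + L true x.

Lemma Lt_linear : linear Lt.
Proof. by move=> k x y; rewrite /Lt !linearP scalerDr addrACA. Qed.

Lemma LtU b : Lt << b >> = lsum K (ct b).
Proof. by rewrite /Lt !lextU lsum_cat. Qed.

Lemma bext_assoc (f g h k : B -> B -> B) :
  (forall a b d, f (g a b) d = h a (k b d)) -> forall x y z : V,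
  bext (fun a b => << f a b >> : V) (bext (fun a b => << g a b >>) x y) z =
  bext (fun a b => << h a b >> : V) x (bext (fun a b => << k a b >>) y z).
Proof.
move=> fghk x y z.
have E b d : (fun x => bext (fun a b => << f a b >> : V)
      (bext (fun a b => << g a b >>) x << b >>) << d >>) =1
   (fun x => bext (fun a b => << h a b >> : V) x
      (bext (fun a b => << k a b >>) << b >> << d >>)).
  apply: linear_eq => [r u v|r u v|a]; [by rewrite !bextPl | exact: bextPl |].
  by rewrite !bextU fghk.
apply: (bilin_eq (F := fun y z => bext (fun a b => << f a b >> : V)
      (bext (fun a b => << g a b >>) x y) z)
   (G := fun y z => bext (fun a b => << h a b >> : V) x
      (bext (fun a b => << k a b >>) y z))) => [||b d]; last exact: E.
  split=> [u|v] r s t; first exact: linearP.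
  by rewrite linearP bextPl.
by split=> [u|v] r s t; rewrite ?bextPl !linearP.
Qed.

Lemma dup_dend_of_codendriform : is_codendriform dup_dend_of.
Proof.
have EL s b : L s << b >> = lsum K (c s b) by exact: lextU.
have tl (f : V -> V2) : linear (fun u : V2 => tassoc (tmap f id u)).
  by move=> k u v; rewrite linearP; apply: lext_linear.
split.
- apply: (linear_eq (f := fun x => tassoc (tmap (L false) id (L false x)))
    (g := fun x => tmap id Lt (L false x))) => [k u v|k u v|b].
  + by rewrite linearP; apply: tl.
  + by rewrite !linearP.
  by rewrite EL (tmapl_lsum _ (EL false)) (tmapr_lsum _ LtU); apply: perm_lsum.
- apply: (linear_eq (f := fun x => tassoc (tmap (L true) id (L false x)))
    (g := fun x => tmap id (L false) (L true x))) => [k u v|k u v|b].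
  + by rewrite linearP; apply: tl.
  + by rewrite !linearP.
  by rewrite !EL (tmapl_lsum _ (EL true)) (tmapr_lsum _ (EL false)); apply: perm_lsum.
- apply: (linear_eq (f := fun x => tassoc (tmap Lt id (L true x)))
    (g := fun x => tmap id (L true) (L true x))) => [k u v|k u v|b].
  + by rewrite linearP; apply: tl.
  + by rewrite !linearP.
  by rewrite EL (tmapl_lsum _ LtU) (tmapr_lsum _ (EL true)); apply: perm_lsum.
Qed.

Lemma dup_dend_of_compat : dup_dend_compat dup_dend_of.
Proof.
have Ml s : linear (L s) by exact: linearP.
have Mmb : bilin Mm by exact: bilin_bext.
have Mwb : bilin Mw by exact: bilin_bext.
have EL s b : L s << b >> = lsum K (c s b) by exact: lextU.
have Em a b : Mm << a >> << b >> = << m a b >> by exact: bextU.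
have Ew a b : Mw << a >> << b >> = << w a b >> by exact: bextU.
have I b : id << b >> = << b >> by [].
split.
- apply: (bilin_eq (F := fun x y => L false (Mm x y))
   (G := fun x y => tens y x + tmap id (Mm x) (L false y) + tmap (Mm x) id (L false y)
      + tmap (Mm^~ y) id (Lt x) + tmap2 Mm Mm (Lt x) (L false y))) => [||a b].
  + exact: bilin_lin.
  + apply: bilinD; last exact: (bilin_tmap2 Lt_linear _ _ (Ml _)).
    apply: bilinD; last exact: bilin_swap (bilin_tmapl (bilin_swap Mmb) Lt_linear).
    apply: bilinD; last exact: bilin_tmapl.
    apply: bilinD; last exact: bilin_tmapr.
    exact: bilin_swap (bilin_tens _ _).
  rewrite Em !EL LtU tensU (tmap_lsum _ I (Em a)) (tmap_lsum _ (Em a) I).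
  by rewrite (tmap_lsum (f := Mm^~ << b >>) _ (fun p => Em p b) I) tmap2_lsum (perm_lsum _ (cFm a b))
    lsum_cons !lsum_cat !addrA.
- apply: (bilin_eq (F := fun x y => L true (Mm x y))
   (G := fun x y => tens x y + tmap (Mm x) id (L true y) + tmap id (Mm x) (L true y)
      + tmap id (Mm^~ y) (Lt x) + tmap2 Mm Mm (Lt x) (L true y))) => [||a b].
  + exact: bilin_lin.
  + apply: bilinD; last exact: (bilin_tmap2 Lt_linear _ _ (Ml _)).
    apply: bilinD; last exact: bilin_swap (bilin_tmapr (bilin_swap Mmb) Lt_linear).
    apply: bilinD; last exact: bilin_tmapr.
    apply: bilinD; last exact: bilin_tmapl.
    exact: bilin_tens.
  rewrite Em !EL LtU tensU (tmap_lsum _ I (Em a)) (tmap_lsum _ (Em a) I).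
  by rewrite (tmap_lsum (g := Mm^~ << b >>) _ I (fun p => Em p b)) tmap2_lsum
    (perm_lsum _ (cTm a b)) lsum_cons !lsum_cat !addrA.
- apply: (bilin_eq (F := fun x y => L false (Mw x y))
   (G := fun x y => tmap (Mw x) id (L false y) + tmap (Mw^~ y) id (L false x)
      + tmap2 Mw Mm (L false x) (L false y))) => [||a b].
  + exact: bilin_lin.
  + apply: bilinD; last exact: (bilin_tmap2 (Ml _) _ _ (Ml _)).
    apply: bilinD; last exact: bilin_swap (bilin_tmapl (bilin_swap Mwb) (Ml _)).
    exact: bilin_tmapl.
  rewrite Ew !EL (perm_lsum _ (cFw a b)) !lsum_cat !addrA.
  rewrite (tmap_lsum _ (Ew a) I).
  by rewrite (tmap_lsum (f := Mw^~ << b >>) _ (fun p => Ew p b) I) tmap2_lsum.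
apply: (bilin_eq (F := fun x y => L true (Mw x y))
   (G := fun x y => tens x y + tmap (Mw x) id (L true y) + tmap id (Mw^~ y) (L true x)
      + tmap id (Mm^~ y) (L false x) + tmap2 Mw Mm (L false x) (L true y))) => [||a b].
+ exact: bilin_lin.
+ apply: bilinD; last exact: (bilin_tmap2 (Ml _) _ _ (Ml _)).
  apply: bilinD; last exact: bilin_swap (bilin_tmapr (bilin_swap Mmb) (Ml _)).
  apply: bilinD; last exact: bilin_swap (bilin_tmapr (bilin_swap Mwb) (Ml _)).
  apply: bilinD; last exact: bilin_tmapl.
  exact: bilin_tens.
rewrite Ew !EL (perm_lsum _ (cTw a b)) lsum_cons !lsum_cat !addrA tensU.
rewrite (tmap_lsum _ (Ew a) I) (tmap_lsum (g := Mw^~ << b >>) _ I (fun p => Ew p b)).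
by rewrite (tmap_lsum (g := Mm^~ << b >>) _ I (fun p => Em p b)) tmap2_lsum.
Qed.

Theorem dup_dend_ofP : is_dup_dend_bialgebra dup_dend_of.
Proof.
split.
- by split; [exact: bilin_bext | exact: bilin_bext | exact: linearP | exact: linearP].
- split; [exact: bext_assoc mA | exact: bext_assoc wA | exact: bext_assoc mwA].
- exact: dup_dend_of_codendriform.
- exact: dup_dend_of_compat.
Qed.

End DupDendOfCuts.
(** * The Dup-Dend bialgebra of a family of nontrivial elements *)

Section PositivePart.
Variables (K : fieldType) (C : cut_bialgebra) (q : pred C).
Hypothesis q_neq1 : forall b, q b -> b != cb_one.
Hypothesis qM : forall a b, q a -> q b -> q (cb_mul a b).
Hypothesis qW : forall a b, q a -> q b -> q (cb_nw a b).
Hypothesis q_rcuts : forall s b p, p \in rcuts s b -> q b -> q p.1 /\ q p.2.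

Local Notation F := {b : C | q b}.
Local Notation v := (@f_val C q).
Local Notation v3 := (@f_val3 C q).

(** The default value of [insubd] is not reached, since the parts of a reduced cut
    satisfy [q]. *)
Definition p_cuts (s : bool) (b : F) : seq (F * F) :=
  [seq (insubd b p.1, insubd b p.2) | p <- rcuts s (val b)].

Lemma val_p_cuts s b : map v (p_cuts s b) = rcuts s (val b).
Proof.
rewrite -map_comp map_id_in // => -[x y] /q_rcuts/(_ (valP b))[/= qx qy].
by rewrite /f_val /= !insubdK.
Qed.

Lemma val_cat_p_cuts b :
  map v (p_cuts false b ++ p_cuts true b) = rcuts false (val b) ++ rcuts true (val b).
Proof. by rewrite map_cat !val_p_cuts. Qed.

Local Notation pm := (f_mul qM).
Local Notation pw := (f_nw qW).

Definition family_dup_dend : dup_dend K F := dup_dend_of K pm pw p_cuts.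

Lemma val_map (f : F * F -> F * F) (f' : C * C -> C * C) s :
  (forall p, v (f p) = f' (v p)) -> map v (map f s) = map f' (map v s).
Proof. by move=> ff'; rewrite -!map_comp; apply: eq_map. Qed.

Lemma family_dup_dendP : is_dup_dend_bialgebra family_dup_dend.
Proof.
have n1 (b : F) := q_neq1 (valP b).
apply: dup_dend_ofP.
- by move=> a b d; apply/val_inj/esym/cb_mulA.
- by move=> a b d; apply/val_inj/esym/cb_nwA.
- by move=> a b d; apply/val_inj/cb_mul_nw/n1.
- move=> b; apply: (perm_map_inj (@f_val3_inj C q)).
  rewrite (@val_allpairs C q _ _ _ _ (fun p r => (r.1, (r.2, p.2))) _ _ (fun p => rcuts false p.1))
    => // [|p]; last exact: val_p_cuts.
  rewrite (@val_allpairs C q _ _ _ _ (fun p r => (p.1, r))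
    _ _ (fun p => rcuts false p.2 ++ rcuts true p.2)) => // [|p]; last exact: val_cat_p_cuts.
  by rewrite !val_p_cuts rcuts_coassFF.
- move=> b; apply: (perm_map_inj (@f_val3_inj C q)).
  rewrite (@val_allpairs C q _ _ _ _ (fun p r => (r.1, (r.2, p.2))) _ _ (fun p => rcuts true p.1))
    => // [|p]; last exact: val_p_cuts.
  rewrite (@val_allpairs C q _ _ _ _ (fun p r => (p.1, r)) _ _ (fun p => rcuts false p.2))
    => // [|p]; last exact: val_p_cuts.
  by rewrite !val_p_cuts rcuts_coassTF.
- move=> b; apply: (perm_map_inj (@f_val3_inj C q)).
  rewrite (@val_allpairs C q _ _ _ _ (fun p r => (r.1, (r.2, p.2)))
    _ _ (fun p => rcuts false p.1 ++ rcuts true p.1)) => // [|p]; last exact: val_cat_p_cuts.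
  rewrite (@val_allpairs C q _ _ _ _ (fun p r => (p.1, r)) _ _ (fun p => rcuts true p.2))
    => // [|p]; last exact: val_p_cuts.
  by rewrite !val_p_cuts rcuts_coassTT.
- move=> a b; apply: (perm_map_inj (@f_val_inj C q)).
  move et: (p_cuts false a ++ p_cuts true a) => t; rewrite map_cons !map_cat val_p_cuts.
  rewrite (val_map (f' := fun p => (p.1, cb_mul (val a) p.2))) //.
  rewrite (val_map (f' := fun p => (cb_mul (val a) p.1, p.2))) //.
  rewrite (val_map (f' := fun p => (cb_mul p.1 (val b), p.2))) //.
  rewrite (@val_allpairs C q _ _ _ _ (fun p r => (cb_mul p.1 r.1, cb_mul p.2 r.2))
    _ _ (fun=> rcuts false (val b))) => // [|p]; last exact: val_p_cuts.
  by rewrite -et val_cat_p_cuts !val_p_cuts; apply: rcutsF_mul.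
- move=> a b; apply: (perm_map_inj (@f_val_inj C q)).
  move et: (p_cuts false a ++ p_cuts true a) => t; rewrite map_cons !map_cat val_p_cuts.
  rewrite (val_map (f' := fun p => (cb_mul (val a) p.1, p.2))) //.
  rewrite (val_map (f' := fun p => (p.1, cb_mul (val a) p.2))) //.
  rewrite (val_map (f' := fun p => (p.1, cb_mul p.2 (val b)))) //.
  rewrite (@val_allpairs C q _ _ _ _ (fun p r => (cb_mul p.1 r.1, cb_mul p.2 r.2))
    _ _ (fun=> rcuts true (val b))) => // [|p]; last exact: val_p_cuts.
  by rewrite -et val_cat_p_cuts !val_p_cuts; apply: rcutsT_mul.
- move=> a b; apply: (perm_map_inj (@f_val_inj C q)); rewrite !map_cat val_p_cuts.
  rewrite (val_map (f' := fun p => (cb_nw (val a) p.1, p.2))) //.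
  rewrite (val_map (f' := fun p => (cb_nw p.1 (val b), p.2))) //.
  rewrite (@val_allpairs C q _ _ _ _ (fun p r => (cb_nw p.1 r.1, cb_mul p.2 r.2))
    _ _ (fun=> rcuts false (val b))) => // [|p]; last exact: val_p_cuts.
  by rewrite !val_p_cuts; apply: rcutsF_nw.
move=> a b; apply: (perm_map_inj (@f_val_inj C q)); rewrite map_cons !map_cat val_p_cuts.
rewrite (val_map (f' := fun p => (cb_nw (val a) p.1, p.2))) //.
rewrite (val_map (f' := fun p => (p.1, cb_nw p.2 (val b)))) //.
rewrite (val_map (f' := fun p => (p.1, cb_mul p.2 (val b)))) //.
rewrite (@val_allpairs C q _ _ _ _ (fun p r => (cb_nw p.1 r.1, cb_mul p.2 r.2))
  _ _ (fun=> rcuts true (val b))) => // [|p]; last exact: val_p_cuts.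
by rewrite !val_p_cuts; apply: rcutsT_nw.
Qed.

End PositivePart.

(** * Inclusions of families *)

Section Inclusion.
#[local] Opaque tmap tens lext bext.
Variables (K : fieldType) (C : cut_bialgebra) (q : pred C).
Local Notation F := {b : C | q b}.
Local Notation incl := (@incl K C q).

Lemma incl_linear : linear incl.
Proof. exact: lext_linear. Qed.

Lemma inclU (b : F) : incl << b >> = << val b >>.
Proof. exact: lextU. Qed.

Lemma incl_bext (f : F -> F -> F) (g : C -> C -> C) x y :
  (forall a b, val (f a b) = g (val a) (val b)) ->
  incl (bext (fun a b => << f a b >>) x y) =
  bext (fun a b => << g a b >>) (incl x) (incl y).
Proof.
move=> fg; apply: (bilin_eq (F := fun x y => incl (bext (fun a b => << f a b >>) x y))
  (G := fun x y => bext (fun a b => << g a b >>) (incl x) (incl y))) => [||a b].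
- by apply: bilin_lin; [apply: bilin_bext | apply: incl_linear].
- split=> [u|v] c s t /=; first by rewrite incl_linear; apply: bext_linearr.
  by rewrite incl_linear; apply: bextPl.
by rewrite bextU !inclU bextU fg.
Qed.

Lemma incl_lsum (f : F -> seq (F * F)) (g : C -> seq (C * C)) x :
  (forall b, map (@f_val C q) (f b) = g (val b)) ->
  tmap incl incl (lext (fun b => lsum K (f b)) x) = lext (fun b => lsum K (g b)) (incl x).
Proof.
move=> fg; apply: (linear_eq
  (f := fun x => tmap incl incl (lext (fun b => lsum K (f b)) x))
  (g := fun x => lext (fun b => lsum K (g b)) (incl x))) => [c y z|c y z|b].
- by rewrite !linearP.
- by rewrite incl_linear; apply: linearP.
by rewrite inclU !lextU (tmap_lsum _ inclU inclU) -fg.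
Qed.

Section Hopf.
Hypothesis q1 : q cb_one.
Hypothesis qM : forall a b, q a -> q b -> q (cb_mul a b).
Hypothesis qW : forall a b, q a -> q b -> q (cb_nw a b).
Hypothesis q_cuts : forall s b p, p \in cb_cuts s b -> q b -> q p.1 /\ q p.2.
Hypothesis q_div : forall a b, q (cb_mul a b) -> q a /\ q b.
Hypothesis q_divw : forall a b, q (cb_nw a b) -> q a /\ q b.

Lemma incl_hopf_hom :
  hopf_hom (hopf_of K (restricted q1 qM qW q_cuts q_div q_divw)) (hopf_of K C) incl.
Proof.
split=> [||x|x|n x hx]; first exact: incl_linear.
- split=> [x y|]; last exact: inclU.
  exact: incl_bext.
- apply: incl_lsum => b; exact: val_cat_f_cuts.
- apply: (linear_eq (V := K^o) (f := fun x : {malg K[F]} => (incl x)@_(@cb_one C))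
    (g := fun x : {malg K[F]} => x@_(f_one q1))) => [c y z|c y z|b].
  + by rewrite incl_linear mcoeffD mcoeffZ.
  + by rewrite mcoeffD mcoeffZ.
  by rewrite inclU !mcoeffU.
have sx : supported (fun b : F => cb_deg (val b) == n) x by move=> b /hx /= ->.
have sy : supported (fun b => cb_deg b == n) (incl x).
  by apply: supported_lext sx => b bn; apply: supportedU.
by move=> b /sy /eqP.
Qed.

End Hopf.

Section DupDend.
Hypothesis q_neq1 : forall b, q b -> b != cb_one.
Hypothesis qM : forall a b, q a -> q b -> q (cb_mul a b).
Hypothesis qW : forall a b, q a -> q b -> q (cb_nw a b).
Hypothesis q_rcuts : forall s b p, p \in rcuts s b -> q b -> q p.1 /\ q p.2.

Lemma incl_dup_dend_hom : dup_dend_hom (family_dup_dend K qM qW)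
  (dup_dend_of K (@cb_mul C) (@cb_nw C) (@rcuts C)) incl.
Proof.
split=> [|x y|x y|x|x]; first exact: incl_linear.
- exact: incl_bext.
- exact: incl_bext.
- by apply: incl_lsum => b; apply: val_p_cuts.
- by apply: incl_lsum => b; apply: val_p_cuts.
Qed.

End DupDend.
End Inclusion.

Lemma hopf_hom_eq_comul (K : fieldType) (B C : choiceType) (S : graded_hopf K B)
    (S1 : graded_hopf K C) d f : h_comul S1 =1 d -> hopf_hom S S1 f ->
  hopf_hom S {| h_mul := h_mul S1; h_one := h_one S1; h_comul := d;
    h_counit := h_counit S1; h_deg := h_deg S1 |} f.
Proof. by move=> e [fl fm fc fe fd]; split=> // x; rewrite fc e. Qed.

Lemma dup_dend_hom_eq (K : fieldType) (B C : choiceType) (S : dup_dend K B)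
    (S1 : dup_dend K C) d d' f : dd_prec S1 =1 d -> dd_succ S1 =1 d' ->
  dup_dend_hom S S1 f ->
  dup_dend_hom S {| dd_mul := dd_mul S1; dd_nw := dd_nw S1; dd_prec := d;
    dd_succ := d' |} f.
Proof. by move=> e e' [fl fm fw fp fs]; split=> // x; rewrite ?fp ?fs ?e ?e'. Qed.

(** * The families of special posets *)

Section SpecialPosets.
#[local] Opaque tmap tens lext bext.
Variable K : fieldType.

Lemma idealinT (T : finType) (P : sposet T) I : idealin P setT I = ideal P I.
Proof.
apply/idealinP/forallP=> [[_ h] x|h].
  apply/implyP=> xI; apply/forallP=> y; apply/implyP; exact: h.
split=> [|x y xI _ xy]; first exact: subsetT.
by have /implyP/(_ xI)/forallP/(_ y)/implyP/(_ xy) := h x.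
Qed.

Lemma cutE P I : cut I = (cl (srep P) (setT :\: I), cl (srep P) I).
Proof. by rewrite setTD. Qed.

Lemma lsum_cuts s b : lsum K (cuts s b) =
  \sum_(I | ideal (srep b) I && (topin (srep b) setT I == s)) << cut I >>.
Proof.
rewrite /lsum /cuts big_map big_enum /=; apply: eq_big => [I|I _]; first by rewrite inE idealinT.
by rewrite cutE.
Qed.

(** The two halves partition the ideals. *)
Lemma sp_comulE b : sp_comul K b = lsum K (cuts false b ++ cuts true b).
Proof.
rewrite lsum_cat !lsum_cuts /sp_comul (bigID (topin (srep b) setT)) addrC /=.
by congr (_ + _); apply: eq_bigl => I; rewrite ?eqb_id ?eqbF_neg.
Qed.

Lemma lsum_rcuts s b : lsum K (@rcuts special_posets s b) =
  \sum_(I | [&& ideal (srep b) I, I != set0, I != setT &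
     topin (srep b) setT I == s]) << cut I >>.
Proof.
rewrite /lsum /rcuts big_filter /= /cuts big_map big_enum_cond /=.
apply: eq_big => [I|I _]; last by rewrite cutE.
rewrite inE idealinT /proper_cut /= !cl_eq1 setD_eq0 subTset; case: (ideal _ _) => //=.
by rewrite andbC [(_ != setT) && _]andbC andbA.
Qed.

(** For a nonempty ideal the greatest element exists, and the quantifications over maxima
    speak of it. *)
Lemma topin_max b (I : {set 'I_(scard b)}) : I != set0 ->
  (topin (srep b) setT I == true) = [forall g, is_max (srep b) g ==> (g \in I)] /\
  (topin (srep b) setT I == false) = [forall g, is_max (srep b) g ==> (g \notin I)].
Proof.
case/set0Pn=> x xI; have [|g _ gm] := @max_exists _ (srep b) setT.
  by apply/set0Pn; exists x.
have gmax : is_max (srep b) g by apply/forallP=> z; apply: gm.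
have E h : is_max (srep b) h -> h = g.
  by move=> /forallP hm; apply: (@le2_anti _ (srep b)); [apply: gm | apply: hm].
rewrite (topE (g := g)) ?subsetT // eqb_id eqbF_neg; split; apply/idP/forallP.
- by move=> gI h; apply/implyP=> /E->.
- by move=> /(_ g)/implyP; apply.
- by move=> gI h; apply/implyP=> /E->.
- by move=> /(_ g)/implyP; apply.
Qed.

Lemma sp_precE b : sp_prec K b = lsum K (@rcuts special_posets false b).
Proof.
rewrite lsum_rcuts; apply: eq_bigl => I; case: (ideal _ _) => //=.
by have [//|n0] := eqVneq I set0; rewrite /= (topin_max n0).2.
Qed.

Lemma sp_succE b : sp_succ K b = lsum K (@rcuts special_posets true b).
Proof.
rewrite lsum_rcuts; apply: eq_bigl => I; case: (ideal _ _) => //=.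
by have [//|n0] := eqVneq I set0; rewrite /= (topin_max n0).1.
Qed.

Section Family.
Variable X : poset_family.

Lemma family_cuts s b p :
  p \in cuts s b -> in_family X b -> in_family X p.1 /\ in_family X p.2.
Proof.
case/mapP=> J _ -> h; rewrite -(sclass_cl b) in h.
by split; apply: in_family_sub h; apply: subsetT.
Qed.

Lemma family_mul_inv a b : in_family X (mulc a b) -> in_family X a /\ in_family X b.
Proof.
have [T [P [S1 [S2 [_ <- <- ->]]]]] := mulc_ex a b.
by move=> h; split; apply: in_family_sub h; rewrite ?subsetUl ?subsetUr.
Qed.

Lemma family_nw_inv a b : in_family X (nwc a b) -> in_family X a /\ in_family X b.
Proof.
have [T [P [S1 [S2 [_ <- <- ->]]]]] := nwc_ex a b.
by move=> h; split; apply: in_family_sub h; rewrite ?subsetUl ?subsetUr.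
Qed.

(** [in_family_sub] gives the stability under cuts and under factors. *)
Definition family_bialgebra : cut_bialgebra :=
  @restricted special_posets (in_family X) (in_family1 X) (@in_family_mul X)
    (@in_family_nw X) family_cuts family_mul_inv family_nw_inv.

Lemma sub_hopf_family : @sub_hopf K X (hopf_of K family_bialgebra).
Proof.
have h := @incl_hopf_hom K special_posets (in_family X)
  (in_family1 X) (@in_family_mul X) (@in_family_nw X) family_cuts family_mul_inv
  family_nw_inv.
apply: (hopf_hom_eq_comul _ h) => x.
by apply: eq_lext => b; apply/esym/sp_comulE.
Qed.

Definition plus : pred spclass := fun P => in_family X P && (0 < scard P)%N.

Lemma plus_neq1 (b : special_posets) : plus b -> b != cb_one.
Proof. by case/andP=> _; rewrite lt0n scard_eq0. Qed.

Lemma plus_mul (a b : special_posets) : plus a -> plus b -> plus (cb_mul a b).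
Proof.
move=> /andP[Xa a0] /andP[Xb _].
by rewrite /plus scard_mulc addn_gt0 a0 in_family_mul.
Qed.

Lemma plus_nw (a b : special_posets) : plus a -> plus b -> plus (cb_nw a b).
Proof.
move=> /andP[Xa a0] /andP[Xb _].
by rewrite /plus scard_nwc addn_gt0 a0 in_family_nw.
Qed.

Lemma plus_rcuts s (b : special_posets) p : p \in rcuts s b -> plus b ->
  plus p.1 /\ plus p.2.
Proof.
rewrite mem_filter => /andP[/andP[n1 n2] /family_cuts h] /andP[/h[X1 X2] _].
by rewrite /plus X1 X2 !lt0n !scard_eq0.
Qed.

Definition plus_dup_dend : dup_dend K (fam_plus X) :=
  @family_dup_dend K special_posets plus plus_mul plus_nw.

Lemma sub_dup_dend_plus : sub_dup_dend plus_dup_dend.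
Proof.
apply: (dup_dend_hom_eq _ _ (@incl_dup_dend_hom K special_posets plus plus_mul
  plus_nw plus_rcuts)) => x; apply: eq_lext => b; apply/esym.
  exact: sp_precE.
exact: sp_succE.
Qed.

End Family.
End SpecialPosets.

Theorem mainTheorem12 (K : fieldType) :
  (forall X : poset_family,
     exists S : dup_dend K (fam_plus X),
       sub_dup_dend S /\ is_dup_dend_bialgebra S) /\
  (forall X : poset_family,
     exists S : graded_hopf K (fam X),
       sub_hopf S /\ exists D : graded_set, hopf_isomorphic S (CK_hopf D K)).
Proof.
split=> X.
  exists (plus_dup_dend K X); split; first exact: sub_dup_dend_plus.
  exact: family_dup_dendP (@plus_neq1 X) (@plus_mul X) (@plus_nw X) (@plus_rcuts X).
exists (hopf_of K (family_bialgebra X)); split; first exact: sub_hopf_family.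
exists (gens (family_bialgebra X)); exact (@hopf_of_isomorphic K (family_bialgebra X)).
Qed.
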